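(* Let $N\ge1$, $K\ge 0$, $\varphi\in L^1_K$, and let $f\in C(\mathbf{R}^N\times(0,\infty)\times\mathbf{R}\times\mathbf{R}^N)$ satisfy, for some constants $C>0$ and $A>1$, $$|f(x,t,p,q)|\le C(1+t)^{-A}\big(|p|+(1+t)^{1/2}|q|\big)\quad\text{for all }(x,t,p,q)\in\mathbf{R}^N\times(0,\infty)\times\mathbf{R}\times\mathbf{R}^N .$$ Then there exists a solution $u$ of the Cauchy problem $\partial_t u=\Delta u+f(x,t,u,\nabla u)$ in $\mathbf{R}^N\times(0,\infty)$, $u(x,0)=\varphi(x)$, with the following properties: (i) $u,\nabla u\in C(\mathbf{R}^N\times(0,\infty))$; (ii) for every $q\in[1,\infty]$ and $l\in[0,K]$, $$\sup_{0<t<\infty}t^{\frac N2(1-\frac1q)}\Big[\|u(t)\|_q+t^{1/2}\|\nabla_x u(t)\|_q\Big]<\infty,\qquad \sup_{0<t<\infty}(1+t)^{-\frac l2}\Big[|||u(t)|||_l+t^{1/2}|||\nabla_x u(t)|||_l\Big]<\infty;$$ (iii) the limit $$M:=\lim_{t\to\infty}\int_{\mathbf{R}^N}u(x,t)\,dx=\int_{\mathbf{R}^N}\varphi\,dx+\int_0^\infty\!\!\int_{\mathbf{R}^N}f(x,t,u(x,t),\nabla u(x,t))\,dx\,dt$$ exists and, for every $q\in[1,\infty]$ and $j=0,1$, $$\lim_{t\to\infty}t^{\frac N2(1-\frac1q)+\frac j2}\big\|\nabla^j[u(t)-Mg(t)]\big\|_q=0.$$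
   Context: Notation: $G(x,t)=(4\pi t)^{-N/2}\exp(-|x|^2/(4t))$; $g(x,t)=G(x,1+t)$. $\|\cdot\|_q$ is the norm of $L^q(\mathbf{R}^N)$; for $m\ge0$, $|||f|||_m=\int_{\mathbf{R}^N}(1+|x|)^m|f(x)|\,dx$; $L^1_K=\{\phi\in L^1(\mathbf{R}^N):|||\phi|||_K<\infty\}$. A solution of the Cauchy problem $\partial_tu=\Delta u+f(x,t,u,\nabla u)$, $u(\cdot,0)=\varphi$ (with $\varphi\in L^1(\mathbf{R}^N)$) is a function $u\in L^\infty_{loc}(0,\infty:W^{1,1}(\mathbf{R}^N))$ such that $u(x,t)=\int G(x-\xi,t)\varphi(\xi)d\xi+\int_0^t\int G(x-\xi,t-s)f(\xi,s,u(\xi,s),\nabla u(\xi,s))\,d\xi\,ds$ for almost all $(x,t)\in\mathbf{R}^N\times(0,\infty)$. *)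

(* Defs.v *)
From HB Require Import structures.
From mathcomp Require Import all_boot all_order all_algebra.
From mathcomp Require Import all_classical all_reals all_analysis.
Set Implicit Arguments. Unset Strict Implicit. Unset Printing Implicit Defensive.
Import Order.TTheory GRing.Theory Num.Theory.
Import numFieldNormedType.Exports.
Local Open Scope classical_set_scope.
Local Open Scope ring_scope.

Section Defs.
Variable R : realType.

(* Euclidean norm |x| on R^N = 'rV[R]_N (the library norm on matrices is the
   max norm, so we define the Euclidean one explicitly). *)
Definition enorm (N : nat) (v : 'rV[R]_N) : R :=
  Num.sqrt (\sum_(i < N) (v ord0 i) ^+ 2).

(* Lebesgue integral over R^n of a nonnegative (extended-real valued)
   function, computed as the iterated one-dimensional Lebesgue integral
   (Tonelli: equal to the integral w.r.t. n-dimensional Lebesgue measure for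
   nonnegative Borel functions). *)
Fixpoint intRN (n : nat) : ('rV[R]_n -> \bar R) -> \bar R :=
  match n with
  | 0 => fun F => F 0
  | n'.+1 => fun F =>
      (\int[@lebesgue_measure R]_x
         intRN (fun v : 'rV[R]_n' =>
           F (row_mx (const_mx (x : R) : 'M[R]_(1, 1)) v : 'rV[R]_(n'.+1))))%E
  end.

(* signed integral over R^N of a real function:  int h^+ - int h^-
   (equals the Lebesgue integral when h is integrable, by Fubini) *)
Definition sintRN (N : nat) (h : 'rV[R]_N -> R) : \bar R :=
  (intRN (fun x => (Num.max (h x) 0)%:E) - intRN (fun x => (Num.max (- h x) 0)%:E))%E.

Definition borel_RN (N : nat) : set (set 'rV[R]_N) := <<s open >>.
Definition borel_RN1 (N : nat) : set (set ('rV[R]_N * R)) := <<s open >>.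

Definition borel_fun (N : nat) (h : 'rV[R]_N -> R) : Prop :=
  forall B : set R, measurable B -> borel_RN (h @^-1` B).

Definition wnorm (N : nat) (m : R) (h : 'rV[R]_N -> R) : \bar R :=
  intRN (fun x => ((1 + enorm x) `^ m * `|h x|)%:E).

(* L^q norm, q in [1, +oo].  For q = +oo we use the supremum; every function
   to which this is applied below is continuous, for which sup = ess sup. *)
Definition Lqnorm (N : nat) (q : \bar R) (h : 'rV[R]_N -> R) : \bar R :=
  match q with
  | r%:E => poweR (intRN (fun x => (`|h x| `^ r)%:E)) r^-1
  | _ => ereal_sup (range (fun x => (`|h x|)%:E))
  end.

Definition qinv (q : \bar R) : R :=
  match q with r%:E => r^-1 | _ => 0 end.

Definition gradx (N : nat) (h : 'rV[R]_N -> R) (x : 'rV[R]_N) : 'rV[R]_N :=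
  \row_(i < N) 'D_(delta_mx ord0 i) h x.

Definition has_partials (N : nat) (h : 'rV[R]_N -> R) (x : 'rV[R]_N) : Prop :=
  forall i : 'I_N, derivable h x (delta_mx ord0 i).

Definition Gk (N : nat) (x : 'rV[R]_N) (t : R) : R :=
  (4 * pi * t) `^ (- (N%:R / 2)) * expR (- (enorm x ^+ 2) / (4 * t)).

Definition gk (N : nat) (x : 'rV[R]_N) (t : R) : R := Gk x (1 + t).

Definition ae_RN1 (N : nat) (P : 'rV[R]_N -> R -> Prop) : Prop :=
  exists Z : set ('rV[R]_N * R), borel_RN1 Z /\
    (\int[@lebesgue_measure R]_(t in [set t : R | (0 < t)%R])
        intRN (fun x => (\1_Z (x, t))%:E) = 0)%E /\
    (forall x t, 0 < t -> ~ Z (x, t) -> P x t).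

(* The mild (Duhamel) formulation of the Cauchy problem
   u_t = Delta u + f(x,t,u,grad u), u(0) = phi, holding a.e. with all the
   integrals absolutely convergent; and u in L^oo_loc(0,oo : W^{1,1}) *)
Definition mild_solution (N : nat)
    (f : 'rV[R]_N -> R -> R -> 'rV[R]_N -> R) (phi : 'rV[R]_N -> R)
    (u : 'rV[R]_N -> R -> R) : Prop :=
  (forall a b, 0 < a -> a <= b -> exists B : R, forall t, a <= t <= b ->
      (Lqnorm 1%E (fun x => u x t)
       + Lqnorm 1%E (fun x => enorm (gradx (fun y => u y t) x)) <= B%:E)%E) /\
  ae_RN1 (fun x t =>
    let H := fun s xi => Gk (x - xi) (t - s) *
               f xi s (u xi s) (gradx (fun y => u y s) xi) in
    (intRN (fun xi => (`|Gk (x - xi) t * phi xi|)%R%:E) < +oo)%E /\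
    (\int[@lebesgue_measure R]_(s in [set s : R | (0 < s < t)%R])
        intRN (fun xi => (`|H s xi|)%R%:E) < +oo)%E /\
    ((u x t)%:E = sintRN (fun xi => (Gk (x - xi) t * phi xi)%R)
      + ((\int[@lebesgue_measure R]_(s in [set s : R | (0 < s < t)%R])
            intRN (fun xi => (Num.max (H s xi) 0)%R%:E))
       - (\int[@lebesgue_measure R]_(s in [set s : R | (0 < s < t)%R])
            intRN (fun xi => (Num.max (- H s xi) 0)%R%:E))))%E).

End Defs.

(* Main.v *)
Require Import Defs.
From HB Require Import structures.
From mathcomp Require Import all_boot all_order all_algebra.
From mathcomp Require Import all_classical all_reals all_analysis.
From mathcomp Require Import measurable_realfun ring lra.
Import Order.TTheory GRing.Theory Num.Theory.
Import numFieldNormedType.Exports.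
Local Open Scope classical_set_scope.
Local Open Scope ring_scope.
Set Implicit Arguments. Unset Strict Implicit. Unset Printing Implicit Defensive.

(* Write w(t) for the heat flow of |phi| at double speed. The kernel G(.,t) and sqrt t times its
   gradient are bounded by a multiple of G(.,2t), and G(.,2(t-s)) * w(s) = w(t); hence, if a
   source satisfies |F(s)| <= h(s) L(s) w(s), then its Duhamel integral is at most w(t) times a
   scalar Volterra integral of h L. For h(s) = s^(-1/2) (1 + sqrt s)^(1-2A), which dominates the
   decay imposed on f, the function L = exp of a multiple of the (bounded) antiderivative of h
   is a supersolution of this scalar inequality, so the pointwise bound |u| + sqrt t |grad u| <= L w
   is preserved by the iteration. Delaying the nonlinearity gives approximate solutions; their
   Duhamel integrals are equicontinuous, a subsequence converges pointwise, and dominated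
   convergence yields a mild solution. The bounds (ii) follow from the bound by L w. For (iii),
   u(t) - M g(t) is, up to terms near s = t and to a tail of the source, a superposition of
   differences of unit-mass heat kernels smoothed by G(t/4), and the L^1 distance of these kernels
   tends to 0. *)

(** * Lebesgue measure on row vectors *)

(** The nonlinearity is merely continuous, so neither contraction nor uniqueness is at hand; its
    linear growth is what lets one bound survive every iteration without smallness of the data. The
    same bound has to yield all L^q norms and all weighted norms, hence it is kept pointwise.
    Running the majorant at double speed from the start, instead of doubling the time at each
    application of a kernel estimate, keeps the speed fixed along the iteration. Two singularities
    meet in the scalar Volterra kernel: (t-s)^(-1/2) from the gradient of the heat kernel, and
    s^(-1/2) from the gradient of u, the datum being only integrable. Both are integrable, and at
    infinity h(s) decays like s^(-A), so that A > 1 is what makes h integrable. The function and its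
    partial derivatives form one family indexed by an option type, derivatives carrying the weight
    sqrt t, so that each estimate is made once. In the asymptotics the factor G(t/4) is kept apart
    because an L^1 distance alone controls neither the sup norm nor the gradient; convolution with
    it gives both, with the right powers of t. *)

HB.instance Definition _ (R : realType) (n : nat) :=
  @isMeasurable.Build default_measure_display 'rV[R]_n
    (@borel_RN R n) (@sigma_algebra0 _ setT open)
    (@sigma_algebraC _ open) (@sigma_algebra_bigcup _ setT open).

Section borel.
Context {R : realType}.
Local Notation TR := (measurableTypeR R).

Lemma open_measurable_rV n (U : set 'rV[R]_n) : open U -> measurable U.
Proof. exact: sub_sigma_algebra. Qed.

(** Countability is the point: a product sigma-algebra contains the rectangles, and an open set of a
    product is a countable union of rectangles of base sets. The family [tau] is a free parameter,
    so that a topology can be pulled back to a type that carries only a sigma-algebra. *)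
Definition has_base d (T : measurableType d) (tau : set (set T)) :=
  exists b : nat -> set T, (forall k, measurable (b k)) /\
    (forall U x, tau U -> U x -> exists2 k, b k x & b k `<=` U).

Lemma base_measurable d (T : measurableType d) (tau : set (set T)) U :
  has_base tau -> tau U -> measurable U.
Proof.
move=> [b [mb bU]] tU.
have -> : U = \bigcup_(k in [set k | b k `<=` U]) b k.
  apply/seteqP; split => [x Ux|x [k] /= + bkx]; last exact.
  by have [k bkx bkU] := bU _ _ tU Ux; exists k.
by apply: bigcup_measurable.
Qed.

Lemma rat_dense_rV n (x : 'rV[R]_n) (e : R) : 0 < e ->
  exists q : 'rV[rat]_n, ball x e (map_mx ratr q).
Proof.
move=> e0.
have H (i : 'I_n) : exists q : rat, `|x ord0 i - ratr q| < e.
  have /rat_in_itvoo[q] : x ord0 i - e < x ord0 i + e.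
    by rewrite ltrBlDr -addrA ltrDl addr_gt0.
  rewrite in_itv/= => /andP[h1 h2]; exists q.
  by rewrite ltr_distlC h2 h1.
exists (\row_i xchoose (H i)); split => // i j.
by rewrite !mxE (ord1 i) /ball/=; exact: (xchooseP (H j)).
Qed.

(** The base consists of the balls with rational centres and radii 1/(j+1), enumerated through
    [pickle]. A radius below e / 2 ensures that a ball containing x lies in the ball of radius e
    about x. *)
Lemma rV_has_base n : has_base (@open 'rV[R]_n).
Proof.
exists (fun k => if unpickle k is Some (q, j) then
  ball (map_mx ratr (q : 'rV[rat]_n) : 'rV[R]_n) (j.+1%:R^-1) else set0).
split=> [k|U x oU Ux].
  case: unpickle => [[q j]|//]; apply: open_measurable_rV; exact: ball_open.
have [e /= e0 eU] := (nbhs_ballP _ _).1 (open_nbhs_nbhs (conj oU Ux)).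
have [j jP] : exists j : nat, (j.+1%:R^-1 : R) < e / 2.
  have [j _ h] := near_infty_natSinv_lt (PosNum (divr_gt0 e0 (ltr0Sn R 1))).
  by exists j; exact: h (leqnn j).
have j0 : 0 < j.+1%:R^-1 :> R by rewrite invr_gt0.
have [q qP] := rat_dense_rV x j0.
exists (pickle (q, j)); rewrite pickleK; first exact: ball_sym.
move=> y hy; apply: eU; apply: (@le_ball _ _ _ (j.+1%:R^-1 + j.+1%:R^-1)).
  by rewrite [leRHS]splitr lerD// ltW.
exact: ball_triangle hy.
Qed.

Lemma R_has_base : has_base (@open R : set (set TR)).
Proof.
exists (fun k => if unpickle k is Some (q, j) then
  ball (ratr (q : rat) : R) (j.+1%:R^-1) else set0).
split=> [k|U x oU Ux].
  case: unpickle => [[q j]|//]; apply: open_measurable; exact: ball_open.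
have [e /= e0 eU] := (nbhs_ballP _ _).1 (open_nbhs_nbhs (conj oU Ux)).
have [j jP] : exists j : nat, (j.+1%:R^-1 : R) < e / 2.
  have [j _ h] := near_infty_natSinv_lt (PosNum (divr_gt0 e0 (ltr0Sn R 1))).
  by exists j; exact: h (leqnn j).
have j0 : 0 < j.+1%:R^-1 :> R by rewrite invr_gt0.
have [q qP] : exists q : rat, ball (x : R) j.+1%:R^-1 (ratr q).
  have /rat_in_itvoo[q] : (x : R) - j.+1%:R^-1 < x + j.+1%:R^-1.
    by rewrite ltrBlDr -addrA ltrDl addr_gt0.
  rewrite in_itv/= => /andP[h1 h2]; exists q.
  by rewrite /ball/= ltr_distlC h2 h1.
exists (pickle (q, j)); rewrite pickleK; first exact: ball_sym.
move=> y hy; apply: eU; apply: (@le_ball _ _ _ (j.+1%:R^-1 + j.+1%:R^-1)).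
  by rewrite [leRHS]splitr lerD// ltW.
exact: ball_triangle hy.
Qed.

Lemma prod_has_base d1 d2 (T1 : measurableType d1) (T2 : measurableType d2)
    (S1 S2 : topologicalType) (j1 : T1 -> S1) (j2 : T2 -> S2) :
  has_base [set j1 @^-1` U | U in @open S1] ->
  has_base [set j2 @^-1` U | U in @open S2] ->
  has_base [set (fun z : T1 * T2 => (j1 z.1, j2 z.2)) @^-1` U
           | U in @open (S1 * S2)%type].
Proof.
move=> [b1 [m1 B1]] [b2 [m2 B2]].
exists (fun k => if unpickle k is Some (i, j) then b1 i `*` b2 j else set0).
split=> [k|_ [x1 x2] [U oU <-] /= Ux].
  by case: unpickle => [[i j]|//]; exact: measurableX.
have : nbhs (j1 x1, j2 x2) U by apply: open_nbhs_nbhs.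
move=> [[A B] /= [nA nB] AB].
have [A' [oA' A'x] A'A] : exists2 A', open_nbhs (j1 x1) A' & A' `<=` A.
  by move: nA; rewrite nbhsE => -[A' ? ?]; exists A'.
have [B' [oB' B'x] B'B] : exists2 B', open_nbhs (j2 x2) B' & B' `<=` B.
  by move: nB; rewrite nbhsE => -[B' ? ?]; exists B'.
have [i i1 i2] := B1 _ x1 (ex_intro2 _ _ A' oA' erefl) A'x.
have [j j3 j4] := B2 _ x2 (ex_intro2 _ _ B' oB' erefl) B'x.
exists (pickle (i, j)); rewrite pickleK//=.
move=> [y1 y2] /= [/i2 h1 /j4 h2]; apply: AB => /=; split; [exact: A'A|exact: B'B].
Qed.

(** Balls of the max norm are finite intersections of conditions on single coordinates, and every
    open set is a countable union of rational balls. *)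
Lemma measurable_rV d (T : measurableType d) n (g : T -> 'rV[R]_n) :
  (forall i, measurable_fun setT (fun x => g x ord0 i)) -> measurable_fun setT g.
Proof.
move=> mg; apply: (measurability _ (erefl (@borel_RN R n))).
move=> _ [U oU <-]; rewrite setTI.
have -> : g @^-1` U = \bigcup_(k in [set k : 'rV[rat]_n * nat |
    ball (map_mx ratr k.1 : 'rV[R]_n) k.2.+1%:R^-1 `<=` U])
    g @^-1` ball (map_mx ratr k.1 : 'rV[R]_n) k.2.+1%:R^-1.
  apply/seteqP; split => [x Ux|x [k] /= h]; last exact: h.
  have [e /= e0 eU] := (nbhs_ballP _ _).1 (open_nbhs_nbhs (conj oU Ux)).
  have [j jP] : exists j : nat, (j.+1%:R^-1 : R) < e / 2.
    have [j _ h] := near_infty_natSinv_lt (PosNum (divr_gt0 e0 (ltr0Sn R 1))).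
    by exists j; exact: h (leqnn j).
  have j0 : 0 < j.+1%:R^-1 :> R by rewrite invr_gt0.
  have [q qP] := rat_dense_rV (g x) j0.
  exists (q, j) => /=; last exact: ball_sym.
  move=> y hy; apply: eU; apply: (@le_ball _ _ _ (j.+1%:R^-1 + j.+1%:R^-1)).
    by rewrite [leRHS]splitr lerD// ltW.
  exact: ball_triangle hy.
rewrite bigcup_mkcond; apply: countable_bigcupT_measurable; first exact: countableP.
move=> [q j] /=; case: ifP => // _.
have -> : g @^-1` ball (map_mx ratr q : 'rV[R]_n) j.+1%:R^-1 =
  \bigcap_(i in [set: 'I_n]) ((fun x => g x ord0 i) @^-1` ball (ratr (q ord0 i) : R) j.+1%:R^-1).
  apply/seteqP; split=> x /=.
    by move=> [_ h] i _ /=; have := h ord0 i; rewrite mxE.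
  move=> h; split; first by rewrite invr_gt0.
  by move=> i k; rewrite (ord1 i) mxE; exact: h.
apply: fin_bigcap_measurable; first exact: finite_finset.
move=> i _; rewrite -[X in measurable X]setTI; apply: mg => //.
by apply: open_measurable; exact: ball_open.
Qed.

Lemma measurable_coord n (i : 'I_n) :
  measurable_fun setT (fun x : 'rV[R]_n => x ord0 i).
Proof.
apply: (measurability _ (RGenOpens.measurableE R)).
move=> _ [_ [a [b ->] <-]]; rewrite setTI; apply: open_measurable_rV.
apply: open_comp; last exact: interval_open.
by move=> x _; exact: coord_continuous.
Qed.

Lemma open_preimage_id (S : topologicalType) :
  [set (id : S -> S) @^-1` V | V in open] = open.
Proof. by apply/seteqP; split => [V [W oW <-]//|V oV]; exists V. Qed.

Lemma open_measurable_RrV n (U : set (R * 'rV[R]_n)) :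
  open U -> measurable (U : set (TR * 'rV[R]_n)).
Proof.
move=> oU; apply: (@base_measurable _ (TR * 'rV[R]_n)%type
  [set (fun z : R * 'rV[R]_n => (id z.1, id z.2)) @^-1` U | U in open]).
  apply: (@prod_has_base _ _ TR 'rV[R]_n R 'rV[R]_n id id).
    by rewrite open_preimage_id; exact: R_has_base.
  by rewrite open_preimage_id; exact: rV_has_base.
by exists U => //; apply/seteqP; split => [[x y]|[x y]].
Qed.

Lemma open_measurable_rVR n (U : set ('rV[R]_n * R)) :
  open U -> measurable (U : set ('rV[R]_n * TR)).
Proof.
move=> oU; apply: (@base_measurable _ ('rV[R]_n * TR)%type
  [set (fun z : 'rV[R]_n * R => (id z.1, id z.2)) @^-1` U | U in open]).
  apply: (@prod_has_base _ _ 'rV[R]_n TR 'rV[R]_n R id id).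
    by rewrite open_preimage_id; exact: rV_has_base.
  by rewrite open_preimage_id; exact: R_has_base.
by exists U => //; apply/seteqP; split => [[x y]|[x y]].
Qed.

Lemma open_measurable_rVrV n (U : set ('rV[R]_n * 'rV[R]_n)) :
  open U -> measurable (U : set ('rV[R]_n * 'rV[R]_n)).
Proof.
move=> oU; apply: (@base_measurable _ ('rV[R]_n * 'rV[R]_n)%type
  [set (fun z : 'rV[R]_n * 'rV[R]_n => (id z.1, id z.2)) @^-1` U | U in open]).
  apply: (@prod_has_base _ _ 'rV[R]_n 'rV[R]_n 'rV[R]_n 'rV[R]_n id id);
  by rewrite open_preimage_id; exact: rV_has_base.
by exists U => //; apply/seteqP; split => [[x y]|[x y]].
Qed.

(** The map [g] separates the type that carries the sigma-algebra from the one that carries the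
    topology. It is the identity for the usual statement, and a parametrized shift when a kernel is
    composed with measurable data. *)
Lemma continuous_on_measurable d (T : measurableType d) (S : topologicalType)
    (g : T -> S) (D : set S) (h : S -> R) :
  (forall U, open U -> measurable (g @^-1` U)) -> open D ->
  (forall x, D x -> {for x, continuous h}) ->
  measurable_fun (g @^-1` D) (h \o g).
Proof.
move=> mg oD ch; apply: (measurability _ (RGenOpens.measurableE R)).
move=> _ [_ [a [b ->] <-]].
have -> : g @^-1` D `&` (h \o g) @^-1` `]a, b[ = g @^-1` (D `&` h @^-1` `]a, b[).
  by [].
apply: mg; rewrite openE => x [Dx hx]; apply: filterI; first exact: open_nbhs_nbhs.
by apply: (ch x Dx); apply: open_nbhs_nbhs; split => //; exact: interval_open.
Qed.

Lemma continuous_on_measurable_rV n (D : set 'rV[R]_n) (h : 'rV[R]_n -> R) :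
  open D -> (forall x, D x -> {for x, continuous h}) -> measurable_fun D h.
Proof.
move=> oD ch; apply: (@continuous_on_measurable _ 'rV[R]_n 'rV[R]_n id D h) => //.
exact: open_measurable_rV.
Qed.

Lemma continuous_on_measurable_RrV n (D : set (R * 'rV[R]_n)) (h : R * 'rV[R]_n -> R) :
  open D -> (forall x, D x -> {for x, continuous h}) ->
  measurable_fun (D : set (TR * 'rV[R]_n)) h.
Proof.
move=> oD ch.
apply: (@continuous_on_measurable _ (TR * 'rV[R]_n)%type (R * 'rV[R]_n)%type id D h) => //.
exact: open_measurable_RrV.
Qed.

End borel.

(** * The measure behind the iterated integral *)

Section lebesgue_rV.
Context {R : realType}.
Local Notation TR := (measurableTypeR R).

(** Written exactly as in the recursion of [intRN], so that one step of the iterated integral is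
    integration along this map. *)
Definition rV_cons n (z : R * 'rV[R]_n) : 'rV[R]_n.+1 :=
  row_mx (const_mx z.1 : 'M[R]_(1, 1)) z.2.

Definition rV_behead n (v : 'rV[R]_n.+1) : 'rV[R]_n :=
  \row_i v ord0 (lift ord0 i).

Lemma rV_cons0 n z : @rV_cons n z ord0 ord0 = z.1.
Proof.
rewrite /rV_cons.
have -> : (ord0 : 'I_n.+1) = lshift n (ord0 : 'I_1) by apply/val_inj.
by apply: etrans (row_mxEl _ _ _ _) _; rewrite mxE.
Qed.

Lemma rV_consS n z (i : 'I_n) : @rV_cons n z ord0 (lift ord0 i) = z.2 ord0 i.
Proof.
rewrite /rV_cons.
have -> : lift ord0 i = rshift 1 i by apply/val_inj.
exact: etrans (row_mxEr _ _ _ _) _.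
Qed.

Lemma rV_consK n z : (@rV_cons n z ord0 ord0, rV_behead (rV_cons z)) = z.
Proof.
case: z => x v; rewrite rV_cons0; congr pair; apply/rowP => i.
by rewrite mxE rV_consS.
Qed.

Lemma rV_consK2 n z : rV_behead (@rV_cons n z) = z.2.
Proof. by have /(congr1 snd) := rV_consK z. Qed.

Lemma measurable_rV_cons n :
  measurable_fun setT (@rV_cons n : TR * 'rV[R]_n -> 'rV[R]_n.+1).
Proof.
apply: measurable_rV => i; case: (unliftP ord0 i) => [j ->|->].
  under eq_fun do rewrite rV_consS.
  exact: measurableT_comp (measurable_coord j) measurable_snd.
under eq_fun do rewrite rV_cons0.
exact: measurable_fst.
Qed.

Lemma measurable_rV_behead n : measurable_fun setT (@rV_behead n).
Proof.
apply: measurable_rV => i; under eq_fun do rewrite mxE.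
exact: measurable_coord.
Qed.

Lemma sigma_finite_measure_of d (T : measurableType d) (mu : {measure set T -> \bar R}) :
  sigma_finite setT mu ->
  exists m : {sigma_finite_measure set T -> \bar R}, (m : set T -> \bar R) = mu.
Proof.
move=> sf; pose H := isSigmaFinite.Build _ _ _ _ sf.
pose H2 := isSFinite.Build _ _ _ _ (sfinite_measure_sigma_finite sf).
by exists (HB.pack_for (SigmaFiniteMeasure.type T R) (Measure.sort mu) H H2).
Qed.

Lemma pushforward_measure d (T : measurableType d) (mu : {measure set T -> \bar R})
    d' (T' : measurableType d') (c : T -> T') (mc : measurable_fun setT c) :
  exists m : {measure set T' -> \bar R}, (m : set T' -> \bar R) = pushforward mu c.
Proof. by unshelve eexists (pushforward mu c). Qed.

(** By induction: a Dirac mass in dimension 0, then the push-forward under [rV_cons] of the product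
    of Lebesgue measure with the measure already built; Tonelli recovers the iterated integral.
    Sigma-finiteness is carried through the induction because Tonelli asks for it. *)
Lemma intRN_measure n : exists m : {sigma_finite_measure set 'rV[R]_n -> \bar R},
  forall F : 'rV[R]_n -> \bar R, measurable_fun setT F -> (forall x, 0 <= F x)%E ->
    intRN F = (\int[m]_x F x)%E.
Proof.
elim: n => [|n [m IH]].
  exists (@dirac _ 'rV[R]_0 0 R) => F mF F0 /=.
  by rewrite integral_dirac// diracT mul1e.
pose mu : {measure set (TR * 'rV[R]_n)%type -> \bar R} := (@lebesgue_measure R \x m)%E.
pose m' := pushforward mu (@rV_cons n).
have sf : sigma_finite setT m'.
  have /sigma_finiteP[F [FT ndF mF]] := sigma_finiteT (@lebesgue_measure R).
  have /sigma_finiteP[A [AT ndA mA]] := sigma_finiteT m.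
  exists (fun k => (fun v : 'rV[R]_n.+1 => (v ord0 ord0, rV_behead v)) @^-1` (F k `*` A k)).
    apply/esym/seteqP; split=> // v _.
    have [k _ Fk] : (\bigcup_k F k) (v ord0 ord0) by rewrite -FT.
    have [l _ Al] : (\bigcup_k A k) (rV_behead v) by rewrite -AT.
    exists (maxn k l) => //; split => /=.
      by move: Fk; apply/subsetPset/ndF/leq_maxl.
    by move: Al; apply/subsetPset/ndA/leq_maxr.
  move=> k; have [mFk Fk] := mF k; have [mAk Ak] := mA k; split.
    rewrite -[X in measurable X]setTI.
    apply: (@measurable_fun_pair _ _ _ _ _ _ (fun v : 'rV[R]_n.+1 => v ord0 ord0 : TR)
      (@rV_behead n) (measurable_coord _) (@measurable_rV_behead n)) => //.
    exact: measurableX.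
  have -> : m' ((fun v : 'rV[R]_n.+1 => (v ord0 ord0, rV_behead v)) @^-1` (F k `*` A k)) = mu (F k `*` A k).
    rewrite /m' /pushforward; congr (mu _).
    by apply/seteqP; split => z /=; rewrite rV_cons0 rV_consK2.
  have -> : mu (F k `*` A k) = (lebesgue_measure (F k) * m (A k))%E.
    exact: product_measure1E.
  by rewrite lte_mul_pinfty// ge0_fin_numE.
pose c : TR * 'rV[R]_n -> 'rV[R]_n.+1 := @rV_cons n.
have mc := @measurable_rV_cons n.
have [m1 m1E] := pushforward_measure mu mc.
have [|m2 m2E] := @sigma_finite_measure_of _ _ m1; first by rewrite m1E.
exists m2 => F mF F0 /=.
have -> : (\int[m2]_x F x = \int[pushforward mu c]_x F x)%E by rewrite m2E m1E.
rewrite (@ge0_integral_pushforward _ _ _ _ R c mc mu setT F) //.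
have mFc : measurable_fun setT (F \o c) by exact: measurableT_comp mF mc.
rewrite preimage_setT /mu fubini_tonelli1//; last by move=> z; exact: F0.
apply: eq_integral => x _; rewrite IH//.
exact: measurableT_comp mFc (pair1_measurable x).
Qed.

Definition leb n : {sigma_finite_measure set 'rV[R]_n -> \bar R} :=
  sval (cid (intRN_measure n)).

Lemma intRNE n (F : 'rV[R]_n -> \bar R) :
  measurable_fun setT F -> (forall x, 0 <= F x)%E -> intRN F = (\int[leb n]_x F x)%E.
Proof. exact: (svalP (cid (intRN_measure n))). Qed.

Lemma sintRNE n (h : 'rV[R]_n -> R) : (leb n).-integrable setT (EFin \o h) ->
  sintRN h = (\int[leb n]_x (h x)%:E)%E.
Proof.
move=> /integrableP[/measurable_EFinP mh _]; rewrite /sintRN integralE.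
congr (_ - _)%E; rewrite intRNE //.
- by apply: eq_integral => x _; rewrite funeposE /= EFin_max.
- by apply/measurable_EFinP; exact: measurable_maxr.
- by move=> x; rewrite lee_fin le_max lexx orbT.
- by apply: eq_integral => x _; rewrite funenegE /= EFin_max.
- by apply/measurable_EFinP; apply: measurable_maxr => //; exact: measurable_funN.
- by move=> x; rewrite lee_fin le_max lexx orbT.
Qed.

End lebesgue_rV.

(** * The heat kernel *)

Section euclidean_norm.
Context {R : realType} {n : nat}.
Implicit Types x y v : 'rV[R]_n.

Lemma enorm_ge0 v : 0 <= enorm v.
Proof. exact: sqrtr_ge0. Qed.

Lemma enorm_sqr v : enorm v ^+ 2 = \sum_(i < n) v ord0 i ^+ 2.
Proof. by rewrite sqr_sqrtr// sumr_ge0// => i _; exact: sqr_ge0. Qed.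

Lemma enormN v : enorm (- v) = enorm v.
Proof. by congr Num.sqrt; apply: eq_bigr => i _; rewrite mxE sqrrN. Qed.

Lemma enorm0 : enorm (0 : 'rV[R]_n) = 0.
Proof. by rewrite /enorm big1 ?sqrtr0// => i _; rewrite mxE expr0n. Qed.

Lemma coord_le_enorm v i : `|v ord0 i| <= enorm v.
Proof.
rewrite -(@ler_pXn2r _ 2)// ?nnegrE ?enorm_ge0// enorm_sqr real_normK ?num_real//.
by rewrite (bigD1 i)//= lerDl sumr_ge0// => j _; exact: sqr_ge0.
Qed.

Lemma enorm_le v (B : R) : 0 <= B -> (forall i, `|v ord0 i| <= B) -> enorm v <= n%:R * B.
Proof.
move=> B0 vB; rewrite -(@ler_pXn2r _ 2)// ?nnegrE ?enorm_ge0 ?mulr_ge0//.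
rewrite enorm_sqr; have [n0|n0] := posnP n.
  by rewrite big1 ?sqr_ge0// => i; have := ltn_ord i; rewrite {2}n0.
apply: (@le_trans _ _ (\sum_(i < n) B ^+ 2)).
  apply: ler_sum => i _; rewrite -real_normK ?num_real//.
  by rewrite ler_pXn2r// nnegrE.
rewrite sumr_const card_ord -[leLHS]mulr_natl exprMn ler_wpM2r ?sqr_ge0//.
by rewrite expr2 ler_peMl// ler1n.
Qed.

(** Coordinatewise, the right side minus the left side is (e a - b)^2 / e. The parameter [e] is
    optimized for the triangle inequality and sent to 0 in the comparison of translated kernels. *)
Lemma enorm_sqrD_le x y (e : R) : 0 < e ->
  enorm (x + y) ^+ 2 <= (1 + e) * enorm x ^+ 2 + (1 + e^-1) * enorm y ^+ 2.
Proof.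
move=> e0; rewrite !enorm_sqr !mulr_sumr -big_split/=; apply: ler_sum => i _.
rewrite mxE; set a := x _ _; set b := y _ _.
rewrite -subr_ge0.
have -> : (1 + e) * a ^+ 2 + (1 + e^-1) * b ^+ 2 - (a + b) ^+ 2 =
   e^-1 * (e * a - b) ^+ 2 by field; rewrite gt_eqF.
by rewrite mulr_ge0 ?invr_ge0 ?sqr_ge0// ltW.
Qed.

Lemma enormD x y : enorm (x + y) <= enorm x + enorm y.
Proof.
have [x0|x0] := eqVneq (enorm x) 0.
  suff -> : x = 0 by rewrite add0r enorm0 add0r.
  apply/rowP => i; rewrite mxE; apply/eqP; rewrite -normr_le0.
  by rewrite (le_trans (coord_le_enorm _ _))// x0.
have [y0|y0] := eqVneq (enorm y) 0.
  suff -> : y = 0 by rewrite addr0 enorm0 addr0.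
  apply/rowP => i; rewrite mxE; apply/eqP; rewrite -normr_le0.
  by rewrite (le_trans (coord_le_enorm _ _))// y0.
have xp : 0 < enorm x by rewrite lt0r x0 enorm_ge0.
have yp : 0 < enorm y by rewrite lt0r y0 enorm_ge0.
rewrite -(@ler_pXn2r _ 2)// ?nnegrE ?enorm_ge0 ?addr_ge0 ?enorm_ge0//.
(* With e = |y| / |x| the right side is exactly (|x| + |y|)^2. *)
apply: (le_trans (@enorm_sqrD_le x y (enorm y / enorm x) (divr_gt0 yp xp))).
rewrite le_eqVlt; apply/orP; left; apply/eqP; field.
by rewrite !gt_eqF.
Qed.

Lemma continuous_enorm : continuous (@enorm R n).
Proof.
have cs : continuous (fun v : 'rV[R]_n => \sum_(i < n) v ord0 i ^+ 2).
  elim: (index_enum 'I_n) => [|i s IH] v.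
    have -> : (fun v0 : 'rV[R]_n => \sum_(i <- [::]) v0 ord0 i ^+ 2) = cst 0.
      by apply/funext => ?; rewrite big_nil.
    exact: cst_continuous.
  have -> : (fun v0 : 'rV[R]_n => \sum_(j <- i :: s) v0 ord0 j ^+ 2) =
      (fun v0 => v0 ord0 i ^+ 2) \+ (fun v0 => \sum_(j <- s) v0 ord0 j ^+ 2).
    by apply/funext => ?; rewrite big_cons.
  apply: (@continuousD _ _ _ (fun v : 'rV[R]_n => v ord0 i ^+ 2)); last exact: IH.
  apply: (@continuous_comp _ _ _ (fun v : 'rV[R]_n => v ord0 i) (fun x : R => x ^+ 2)).
    exact: coord_continuous.
  exact: exprn_continuous.
move=> v; apply: (@continuous_comp _ _ _ (fun v : 'rV[R]_n => \sum_(i < n) v ord0 i ^+ 2)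
  (@Num.sqrt R)); [exact: cs|exact: sqrt_continuous].
Qed.

End euclidean_norm.

Lemma continuous_pair (S T1 T2 : topologicalType) (f : S -> T1) (g : S -> T2) x :
  {for x, continuous f} -> {for x, continuous g} ->
  {for x, continuous (fun y => (f y, g y))}.
Proof. by move=> cf cg; apply: (cvg_pair cf cg). Qed.

Section heat_kernel.
Context {R : realType}.

(** The maximum of the heat kernel in space, attained at the origin. *)
Definition gam (n : nat) (t : R) : R := (4 * pi * t) `^ (- (n%:R / 2)).

Definition dGk n (i : 'I_n) (x : 'rV[R]_n) (t : R) : R :=
  - (x ord0 i / (2 * t)) * Gk x t.

Lemma GkE n (x : 'rV[R]_n) t : Gk x t = gam n t * expR (- (enorm x ^+ 2) / (4 * t)).
Proof. by []. Qed.

Lemma pi4_gt0 (t : R) : 0 < t -> 0 < 4 * pi * t.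
Proof. by move=> t0; rewrite !mulr_gt0// pi_gt0. Qed.

Lemma gam_gt0 n (t : R) : 0 < t -> 0 < gam n t.
Proof. by move=> t0; apply: powR_gt0; exact: pi4_gt0. Qed.

Lemma gamM n (a t : R) : 0 < a -> 0 < t -> gam n (a * t) = a `^ (- (n%:R / 2)) * gam n t.
Proof.
move=> a0 t0; rewrite /gam (_ : 4 * pi * (a * t) = a * (4 * pi * t)); last by ring.
by rewrite powRM ?ltW ?pi4_gt0.
Qed.

Lemma Gk_gt0 n (x : 'rV[R]_n) t : 0 < t -> 0 < Gk x t.
Proof. by move=> t0; rewrite mulr_gt0 ?expR_gt0//; exact: gam_gt0. Qed.

Lemma Gk_ge0 n (x : 'rV[R]_n) t : 0 <= Gk x t.
Proof. by rewrite mulr_ge0 ?expR_ge0 ?powR_ge0. Qed.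

Lemma GkN n (x : 'rV[R]_n) t : Gk (- x) t = Gk x t.
Proof. by rewrite /Gk enormN. Qed.

Lemma GkC n (x y : 'rV[R]_n) t : Gk (x - y) t = Gk (y - x) t.
Proof. by rewrite -GkN opprB. Qed.

Lemma Gk_le_gam n (x : 'rV[R]_n) t : 0 < t -> Gk x t <= gam n t.
Proof.
move=> t0; rewrite GkE ger_pMr ?gam_gt0// -expR0 ler_expR mulNr oppr_le0.
by rewrite divr_ge0 ?sqr_ge0// mulr_ge0// ltW.
Qed.

(** The prefactor turns the peak at time s into the peak at time t, and the exponential factor
    increases with time. *)
Lemma Gk_time n (x : 'rV[R]_n) s t : 0 < s -> s <= t ->
  (s / t) `^ (n%:R / 2) * Gk x s <= Gk x t.
Proof.
move=> s0 st; have t0 : 0 < t := lt_le_trans s0 st.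
rewrite GkE [Gk x t]GkE mulrA.
have -> : (s / t) `^ (n%:R / 2) * gam n s = gam n t.
  have {2}-> : t = (s / t)^-1 * s by field; rewrite !gt_eqF.
  rewrite gamM ?invr_gt0 ?divr_gt0//; congr (_ * _).
  by rewrite -[(s / t)^-1]powR_inv1 ?divr_ge0 ?ltW// -powRrM mulN1r opprK.
rewrite ler_pM2l ?gam_gt0// ler_expR !mulNr lerN2 ler_wpM2l ?sqr_ge0//.
by rewrite lef_pV2 ?posrE ?mulr_gt0// ler_pM2l.
Qed.

(** Doubling the time splits off a spare Gaussian. It absorbs polynomial factors: the quotient |x| /
    t of the gradient in [dGk_le_Gk2], and the power weights in [moment_Gk_le]. *)
Lemma Gk_half n (x : 'rV[R]_n) t : 0 < t ->
  Gk x t = 2 `^ (n%:R / 2) * expR (- (enorm x ^+ 2) / (8 * t)) * Gk x (2 * t).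
Proof.
move=> t0; rewrite GkE [Gk x (2 * t)]GkE gamM// powRN.
rewrite mulrACA mulrA -[in RHS]mulrA -mulrA.
have -> : 2 `^ (n%:R / 2) * ((2 `^ (n%:R / 2))^-1 * gam n t *
  (expR (- enorm x ^+ 2 / (8 * t)) * expR (- enorm x ^+ 2 / (4 * (2 * t))))) =
  gam n t * (expR (- enorm x ^+ 2 / (8 * t)) * expR (- enorm x ^+ 2 / (4 * (2 * t)))).
  by rewrite -mulrA mulVKf// gt_eqF// powR_gt0.
by congr (_ * _); rewrite -expRD; congr expR; field; rewrite gt_eqF.
Qed.

Lemma Gk_le_Gk2 n (x : 'rV[R]_n) t : 0 < t -> Gk x t <= 2 `^ (n%:R / 2) * Gk x (2 * t).
Proof.
move=> t0; rewrite Gk_half// ler_pM2r ?Gk_gt0 ?mulr_gt0// ger_pMr ?powR_gt0//.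
by rewrite -expR0 ler_expR mulNr oppr_le0 divr_ge0 ?sqr_ge0// mulr_ge0// ltW.
Qed.

Lemma dGk_le_Gk2 n (i : 'I_n) (x : 'rV[R]_n) t : 0 < t ->
  `|dGk i x t| <= 2 `^ (n%:R / 2) * (Num.sqrt t)^-1 * Gk x (2 * t).
Proof.
move=> t0; rewrite /dGk normrM (ger0_norm (Gk_ge0 _ _)) Gk_half// normrN.
rewrite [leLHS](_ : _ = `|x ord0 i / (2 * t)| * expR (- enorm x ^+ 2 / (8 * t)) *
  (2 `^ (n%:R / 2) * Gk x (2 * t))); last by ring.
rewrite [leRHS](_ : _ = (Num.sqrt t)^-1 * (2 `^ (n%:R / 2) * Gk x (2 * t))); last by ring.
apply: ler_wpM2r; first by rewrite mulr_ge0 ?powR_ge0 ?Gk_ge0.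
set z := x ord0 i; set e := expR _.
have st : 0 < Num.sqrt t by rewrite sqrtr_gt0.
have stt : Num.sqrt t ^+ 2 = t by rewrite sqr_sqrtr ?ltW.
pose r := `|z| / Num.sqrt t.
have r0 : 0 <= r by rewrite divr_ge0// ltW.
(* The inequality exp(-y) <= 1 / (1 + y) is enough, since it leaves only r / 2 <= 1 + r^2 / 8 to
   check. *)
have er : e <= (1 + r ^+ 2 / 8)^-1.
  rewrite -[leLHS]invrK lef_pV2 ?posrE ?invr_gt0 ?expR_gt0//; last first.
    by rewrite ltr_wpDr// mulr_ge0// sqr_ge0.
  rewrite -expRN mulNr opprK; apply: le_trans (expR_ge1Dx _).
  rewrite lerD2l /r expr_div_n stt real_normK ?num_real//.
  rewrite [leRHS](_ : _ = enorm x ^+ 2 / t / 8); last by field; rewrite gt_eqF.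
  rewrite ler_pM2r ?invr_gt0// ler_pM2r ?invr_gt0//.
  rewrite -[z ^+ 2]real_normK ?num_real// ler_pXn2r ?nnegrE ?enorm_ge0//.
  exact: coord_le_enorm.
rewrite normrM normfV [`|2 * t|]gtr0_norm ?mulr_gt0//.
have -> : `|z| / (2 * t) = (Num.sqrt t)^-1 * (r / 2).
  by rewrite /r -{1}stt; field; rewrite gt_eqF.
rewrite -mulrA ger_pMr ?invr_gt0//.
apply: le_trans (ler_wpM2l _ er) _; first by rewrite divr_ge0.
rewrite ler_pdivrMr ?mul1r; last by rewrite ltr_wpDr// mulr_ge0// sqr_ge0.
nra.
Qed.

(** Completing the square in z: the product is a Gaussian in z centred at (b x + a y) / (a + b).
    Having this as a pointwise identity reduces the semigroup law to the unit mass of the kernel. *)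
Lemma Gk_semigroup n (x y z : 'rV[R]_n) a b : 0 < a -> 0 < b ->
  Gk (x - z) a * Gk (z - y) b =
  Gk (x - y) (a + b) * Gk (z - ((b / (a + b)) *: x + (a / (a + b)) *: y)) (a * b / (a + b)).
Proof.
move=> a0 b0; have ab0 : 0 < a + b by rewrite addr_gt0.
rewrite !GkE mulrACA [RHS]mulrACA -!expRD; congr (_ * expR _).
  rewrite /gam -!powRM ?ltW ?pi4_gt0 ?divr_gt0 ?mulr_gt0//; congr powR.
  by field; rewrite gt_eqF.
have -> : - enorm (x - z) ^+ 2 / (4 * a) + - enorm (z - y) ^+ 2 / (4 * b) =
  - (b * enorm (x - z) ^+ 2 + a * enorm (z - y) ^+ 2) / (4 * a * b).
  by field; rewrite !gt_eqF.
have -> : - enorm (x - y) ^+ 2 / (4 * (a + b)) + - enorm (z -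
    (b / (a + b) *: x + a / (a + b) *: y)) ^+ 2 / (4 * (a * b / (a + b))) =
  - (a * b / (a + b) * enorm (x - y) ^+ 2 + (a + b) * enorm (z -
    (b / (a + b) *: x + a / (a + b) *: y)) ^+ 2) / (4 * a * b).
  by field; rewrite !gt_eqF.
congr (- _ / _); rewrite !enorm_sqr !mulr_sumr -!big_split/=.
by apply: eq_bigr => i _; rewrite !mxE; field; rewrite gt_eqF.
Qed.

(** From |x - y|^2 <= (1 + e) |x|^2 + (1 + 1/e) |y|^2: a translate dominates a multiple of the
    centred kernel at a slightly earlier time. Lower bounds of this kind are what [density_dist_le]
    turns into L^1 distances. *)
Lemma Gk_shift_ge n (x y : 'rV[R]_n) t e : 0 < t -> 0 < e ->
  (1 + e) `^ (- (n%:R / 2)) * expR (- ((1 + e^-1) * enorm y ^+ 2) / (4 * t)) *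
    Gk x (t / (1 + e)) <= Gk (x - y) t.
Proof.
move=> t0 e0; have e1 : 0 < 1 + e by rewrite addr_gt0.
rewrite [t / _]mulrC !GkE gamM ?invr_gt0//.
rewrite [leLHS](_ : _ = ((1 + e) `^ (- (n%:R / 2)) * (1 + e)^-1 `^ (- (n%:R / 2))) * gam n t *
   (expR (- ((1 + e^-1) * enorm y ^+ 2) / (4 * t)) * expR (- enorm x ^+ 2 / (4 * ((1 + e)^-1 * t))))); last by ring.
rewrite -powRM ?invr_ge0 ?(ltW e1)// divff ?gt_eqF// powR1 mul1r -expRD.
rewrite ler_pM2l ?gam_gt0// ler_expR.
have -> : - ((1 + e^-1) * enorm y ^+ 2) / (4 * t) + - enorm x ^+ 2 / (4 * ((1 + e)^-1 * t)) =
  - ((1 + e) * enorm x ^+ 2 + (1 + e^-1) * enorm (- y) ^+ 2) / (4 * t).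
  by rewrite enormN; field; rewrite !gt_eqF.
rewrite !mulNr lerN2 ler_pM2r ?invr_gt0 ?mulr_gt0//.
exact: enorm_sqrD_le.
Qed.

Lemma continuous_Gk n (x : 'rV[R]_n) t : 0 < t ->
  {for (x, t), continuous (fun z : 'rV[R]_n * R => Gk z.1 z.2)}.
Proof.
move=> t0.
have c2 : {for (x, t), continuous (fun z : 'rV[R]_n * R => z.2)} by exact: cvg_snd.
have cg : {for (x, t), continuous (fun z : 'rV[R]_n * R => gam n z.2)}.
  apply: (@continuous_comp _ _ _ (fun z : 'rV[R]_n * R => 4 * pi * z.2)
    (fun u => powR u (- (n%:R / 2)))).
    by apply: continuousM => //; exact: cvg_cst.
  apply/differentiable_continuous/derivable1_diffP/derivable_powR.
  by rewrite in_itv/= andbT; exact: pi4_gt0.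
apply: continuousM => //.
apply: (@continuous_comp _ _ _ (fun z : 'rV[R]_n * R => - enorm z.1 ^+ 2 / (4 * z.2)) expR);
  last exact: continuous_expR.
apply: continuousM.
  apply: continuousN.
  apply: (@continuous_comp _ _ _ (fun z : 'rV[R]_n * R => enorm z.1) (fun u : R => u ^+ 2)).
    apply: (@continuous_comp _ _ _ (fun z : 'rV[R]_n * R => z.1) (@enorm R n)).
      exact: cvg_fst.
    exact: continuous_enorm.
  exact: exprn_continuous.
apply: continuousV; first by rewrite gt_eqF// mulr_gt0.
by apply: continuousM => //; exact: cvg_cst.
Qed.

Lemma continuous_dGk n (i : 'I_n) (x : 'rV[R]_n) t : 0 < t ->
  {for (x, t), continuous (fun z : 'rV[R]_n * R => dGk i z.1 z.2)}.
Proof.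
move=> t0; apply: continuousM; last exact: continuous_Gk.
apply: continuousN; apply: continuousM.
  apply: (@continuous_comp _ _ _ (fun z : 'rV[R]_n * R => z.1) (fun v : 'rV[R]_n => v ord0 i)).
    exact: cvg_fst.
  exact: coord_continuous.
apply: continuousV; first by rewrite gt_eqF// mulr_gt0.
by apply: continuousM; [exact: cvg_cst|exact: cvg_snd].
Qed.

Lemma enorm_sqr_shift n (i : 'I_n) (x : 'rV[R]_n) (h : R) :
  enorm (h *: delta_mx ord0 i + x) ^+ 2 = enorm x ^+ 2 + h * (2 * x ord0 i) + h ^+ 2.
Proof.
rewrite !enorm_sqr (bigD1 i)//= [in RHS](bigD1 i)//= !mxE !eqxx mulr1.
rewrite (eq_bigr (fun j => x ord0 j ^+ 2)); first by ring.
by move=> j ji; rewrite !mxE eqxx (negbTE ji) mulr0 add0r.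
Qed.

Lemma is_derive_Gk n (i : 'I_n) (x : 'rV[R]_n) (t : R) (r : R) : 0 < t ->
  is_derive r 1 (fun h => Gk (h *: delta_mx ord0 i + x) t)
    (dGk i (r *: delta_mx ord0 i + x) t).
Proof.
move=> t0.
under eq_fun do rewrite /Gk enorm_sqr_shift.
have t4 : 4 * t != 0 by rewrite gt_eqF// mulr_gt0.
rewrite /dGk /Gk enorm_sqr_shift !mxE !eqxx mulr1.
apply: is_derive_eq.
rewrite /GRing.scale/= !mulr0 !mulr1 !add0r.
by field; rewrite gt_eqF.
Qed.

Lemma is_derive_along (V : normedModType R) (f : V -> R) (a v : V) (d : R) :
  is_derive (0 : R) (1 : R) (fun h => f (h *: v + a)) d -> is_derive a v f d.
Proof.
have E : (fun h : R => h^-1 *: (((fun h => f (h *: v + a)) \o shift 0) (h *: 1) -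
    (fun h => f (h *: v + a)) 0)) = (fun h : R => h^-1 *: ((f \o shift a) (h *: v) - f a)).
  apply/funext => h /=; rewrite scale0r add0r; congr (_ *: (f (_ *: _ + _) - _)).
  by rewrite addr0 /GRing.scale/= mulr1.
move=> [d1 d2]; apply: DeriveDef; first by move: d1; rewrite /derivable E.
by rewrite -d2 /derive E.
Qed.

(** In each coordinate the kernel is a normal density of variance 2 t. Splitting off the first
    coordinate matches the recursion of [intRN] and reduces the unit mass to the one-dimensional
    Gaussian integral. *)
Lemma Gk_rV_cons n (c : 'rV[R]_n.+1) (x : R) (v : 'rV[R]_n) t : 0 < t ->
  Gk (rV_cons (x, v) - c) t =
  normal_pdf (c ord0 ord0) (Num.sqrt (2 * t)) x * Gk (v - rV_behead c) t.
Proof.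
move=> t0; have t2 : 0 < 2 * t by rewrite mulr_gt0.
have s2 : Num.sqrt (2 * t) ^+ 2 = 2 * t by rewrite sqr_sqrtr ?ltW.
rewrite normal_pdfE; last by rewrite gt_eqF// sqrtr_gt0.
rewrite /normal_peak /normal_fun s2 !GkE mulrACA -expRD; congr (_ * expR _).
  rewrite /gam -powR12_sqrt; last by rewrite -mulr_natr !mulr_ge0// ?pi_ge0// ltW.
  rewrite -powRN (_ : 2 * t * pi *+ 2 = 4 * pi * t); last by ring.
  rewrite -powRD; last by rewrite (gt_eqF (pi4_gt0 t0)) implybT.
  by congr powR; rewrite -addn1 natrD; field.
have -> : enorm (rV_cons (x, v) - c) ^+ 2 = (x - c ord0 ord0) ^+ 2 + enorm (v - rV_behead c) ^+ 2.
  rewrite !enorm_sqr big_ord_recl/=; congr (_ ^+ 2 + _).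
    by rewrite mxE [(- c) _ _]mxE rV_cons0.
  apply: eq_bigr => i _; congr (_ ^+ 2).
  by rewrite mxE [(- c) _ _]mxE rV_consS [RHS]mxE [in RHS]mxE [in RHS]mxE.
by field; rewrite gt_eqF.
Qed.

Lemma measurable_Gk n (c : 'rV[R]_n) t : 0 < t ->
  measurable_fun setT (fun x : 'rV[R]_n => Gk (x - c) t).
Proof.
move=> t0; apply: continuous_on_measurable_rV; first exact: openT.
move=> x _; apply: (@continuous_comp _ _ _ (fun x : 'rV[R]_n => (x - c, t))
  (fun z : 'rV[R]_n * R => Gk z.1 z.2)); last exact: continuous_Gk.
apply: continuous_pair; last exact: cst_continuous.
by apply: continuousB; [exact: cvg_id|exact: cst_continuous].
Qed.

Lemma intRN_Gk n (c : 'rV[R]_n) t : 0 < t ->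
  intRN (fun x : 'rV[R]_n => (Gk (x - c) t)%:E) = 1%E.
Proof.
move=> t0; elim: n c => [|n IH] c.
  rewrite /= /Gk mul0r oppr0 powRr0 mul1r /enorm big_ord0 sqrtr0 expr0n/= oppr0 mul0r.
  by rewrite expR0.
rewrite -(@integral_normal_pdf R (c ord0 ord0) (Num.sqrt (2 * t))) /=.
apply: eq_integral => x _.
rewrite (_ : (fun v => _) =
  (fun v => (normal_pdf (c ord0 ord0) (Num.sqrt (2 * t)) x)%:E * (Gk (v - rV_behead c) t)%:E)%E).
  rewrite intRNE; first last.
  - by move=> v; rewrite mule_ge0// lee_fin ?normal_pdf_ge0// Gk_ge0.
  - by apply: measurable_funeM; apply/measurable_EFinP; exact: measurable_Gk.
  rewrite ge0_integralZl//; first last.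
  - by rewrite lee_fin normal_pdf_ge0.
  - by move=> v _; rewrite lee_fin Gk_ge0.
  - by apply/measurable_EFinP; exact: measurable_Gk.
  rewrite -intRNE ?IH ?mule1//.
    by apply/measurable_EFinP; exact: measurable_Gk.
  by move=> v; rewrite lee_fin Gk_ge0.
by apply/funext => v; rewrite -EFinM -Gk_rV_cons.
Qed.

Lemma integral_Gk n (c : 'rV[R]_n) t : 0 < t ->
  (\int[leb n]_x (Gk (x - c) t)%:E = 1)%E.
Proof.
move=> t0; rewrite -intRNE ?intRN_Gk//.
  by apply/measurable_EFinP; exact: measurable_Gk.
by move=> v; rewrite lee_fin Gk_ge0.
Qed.

Lemma integral_Gk_semigroup n (x y : 'rV[R]_n) a b : 0 < a -> 0 < b ->
  (\int[leb n]_z (Gk (x - z) a * Gk (z - y) b)%:E = (Gk (x - y) (a + b))%:E)%E.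
Proof.
move=> a0 b0; have ab0 : 0 < a + b by rewrite addr_gt0.
have c0 : 0 < a * b / (a + b) by rewrite divr_gt0 ?mulr_gt0.
under eq_integral do rewrite Gk_semigroup// EFinM.
rewrite ge0_integralZl ?integral_Gk ?mule1//.
- by apply/measurable_EFinP; exact: measurable_Gk.
- by move=> v _; rewrite lee_fin Gk_ge0.
- by rewrite lee_fin Gk_ge0.
Qed.

End heat_kernel.

(** * A scalar Volterra inequality *)

Section antiderivative.
Context {R : realType}.
Implicit Types (g G : R -> R) (a b B : R).
Local Notation mu := (@lebesgue_measure R).

Lemma derive_continuous (f : R -> R) (x d : R) :
  is_derive x 1 f d -> {for x, continuous f}.
Proof.
by move=> fd; apply/differentiable_continuous/derivable1_diffP; exact: ex_derive.
Qed.

Lemma integral_itv_antiderivative g G a b : a < b ->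
  (forall x, a <= x <= b -> is_derive x 1 G (g x)) ->
  (forall x, a <= x <= b -> {for x, continuous g}) ->
  (\int[mu]_(x in `[a, b]) (g x)%:E = (G b - G a)%:E)%E.
Proof.
move=> ab dG cg.
have cG x : a <= x <= b -> {for x, continuous G}.
  by move=> /dG; exact: derive_continuous.
rewrite (@continuous_FTC2 R g G a b ab).
- by rewrite EFinB.
- by apply: continuous_in_subspaceT => x; rewrite inE/= in_itv/=; exact: cg.
- split.
  + by move=> x; rewrite in_itv/= => /andP[? ?]; apply: ex_derive; apply: dG; rewrite !ltW.
  + by apply: cvg_at_right_filter; apply: cG; rewrite lexx ltW.
  + by apply: cvg_at_left_filter; apply: cG; rewrite lexx ltW.
- move=> x; rewrite in_itv/= => /andP[? ?].
  have dGx : is_derive x 1 G (g x) by apply: dG; rewrite !ltW.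
  by rewrite derive1E derive_val.
Qed.

(** Meant for integrands that are singular at the ends or intervals that are unbounded: the
    fundamental theorem is applied on compact intervals inside, monotone convergence does the rest,
    and only the increments of [G] have to be bounded. *)
Lemma ge0_integral_exhaust_le (c d : nat -> R) g G B :
  (forall n, c n < d n) -> (forall n, c n.+1 <= c n) -> (forall n, d n <= d n.+1) ->
  (forall n x, c n <= x <= d n ->
     [/\ 0 <= g x, is_derive x 1 G (g x) & {for x, continuous g}]) ->
  (forall n, G (d n) - G (c n) <= B) ->
  (\int[mu]_(x in \bigcup_n `[c n, d n]%classic) (g x)%:E <= B%:E)%E.
Proof.
move=> cd cS dS gG GB.
have mg n : measurable_fun (`[c n, d n]%classic : set (measurableTypeR R)) (fun x => (g x)%:E).
  apply/measurable_EFinP; apply: subspace_continuous_measurable_fun.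
    exact: measurable_itv.
  by apply: continuous_in_subspaceT => x; rewrite inE/= in_itv/= => /gG[].
have nd : nondecreasing_seq (fun n => `[c n, d n]%classic).
  apply/nondecreasing_seqP => n; apply/subsetPset => x /=; rewrite !in_itv/= => /andP[h1 h2].
  by rewrite (le_trans (cS n) h1) (le_trans h2 (dS n)).
have h := @ge0_nondecreasing_set_cvg_integral _ (measurableTypeR R) R _ (fun x => (g x)%:E) mu nd
  (fun n => measurable_itv _) mg.
have g0 : forall i x, `[c i, d i]%classic x -> (0 <= (g x)%:E)%E.
  by move=> n x /=; rewrite in_itv/= lee_fin => /gG[].
have hc := h g0.
rewrite -(cvg_lim _ hc)//; apply: lime_le; first by apply/cvg_ex; eexists; exact: hc.
apply: nearW => n.
have -> := @integral_itv_antiderivative g G _ _ (cd n) (fun x hx => let: And3 _ h _ := gG n x hx in h)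
  (fun x hx => let: And3 _ _ h := gG n x hx in h).
by rewrite lee_fin.
Qed.

Lemma ge0_integral_oo_le g G a b B : a < b ->
  (forall x, a < x < b ->
     [/\ 0 <= g x, is_derive x 1 G (g x) & {for x, continuous g}]) ->
  (forall c d, a < c -> c < d -> d < b -> G d - G c <= B) ->
  (\int[mu]_(x in `]a, b[) (g x)%:E <= B%:E)%E.
Proof.
move=> ab gG GB.
(* A denominator of at least 3 keeps a + e n < b - e n. *)
pose e n := (b - a) / n.+3%:R : R.
have ba0 : 0 < b - a by rewrite subr_gt0.
have e0 n : 0 < e n by rewrite divr_gt0.
have eS n : e n.+1 <= e n by rewrite ler_pM2l// lef_pV2 ?posrE// ler_nat.
have e3 n : e n <= (b - a) / 3.
  by rewrite ler_pM2l// lef_pV2 ?posrE// ler_nat.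
have -> : `]a, b[%classic = \bigcup_n `[a + e n, b - e n]%classic.
  apply/seteqP; split => [x|x [n _]] /=; rewrite !in_itv/= => /andP[h1 h2]; last first.
    by rewrite (lt_le_trans _ h1) ?ltrDl// (le_lt_trans h2)// gtrBl.
  pose m := Num.min (x - a) (b - x).
  have m0 : 0 < m by rewrite lt_min !subr_gt0 h1.
  have [n _ hn] := near_infty_natSinv_lt (PosNum (divr_gt0 m0 ba0)).
  exists n => //=; rewrite in_itv/=.
  have : e n <= m.
    apply: (@le_trans _ _ ((b - a) / n.+1%:R)).
      by rewrite ler_pM2l// lef_pV2 ?posrE// ler_nat ltnW.
    by have /ltW := hn n (leqnn n); rewrite /= ler_pdivlMr// mulrC.
  by rewrite /m le_min => /andP[? ?]; apply/andP; split; lra.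
apply: (ge0_integral_exhaust_le (G := G)) => [n|n|n|n x|n].
- have := e3 n; lra.
- by rewrite lerD2l.
- by rewrite lerD2l lerN2.
- by move=> /andP[h1 h2]; apply: gG; rewrite (lt_le_trans _ h1) ?ltrDl// (le_lt_trans h2)// gtrBl.
- by apply: GB; [rewrite ltrDl|have := e3 n; lra|rewrite gtrBl].
Qed.

Lemma ge0_integral_oy_le g G a B :
  (forall x, a < x ->
     [/\ 0 <= g x, is_derive x 1 G (g x) & {for x, continuous g}]) ->
  (forall c d, a < c -> c < d -> G d - G c <= B) ->
  (\int[mu]_(x in `]a, +oo[) (g x)%:E <= B%:E)%E.
Proof.
move=> gG GB.
(* The right end is a + n + 2 because at n = 0 the left end is already a + 1. *)
have -> : `]a, +oo[%classic = \bigcup_n `[a + n.+1%:R^-1, a + n.+2%:R]%classic.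
  apply/seteqP; split => [x|x [n _]] /=; rewrite !in_itv/= ?andbT; last first.
    by move=> /andP[h1 h2]; rewrite (lt_le_trans _ h1) ?ltrDl.
  move=> ax; have xa : 0 < x - a by rewrite subr_gt0.
  have [n _ hn] := near_infty_natSinv_lt (PosNum xa).
  pose k := Num.bound (x - a).
  exists (maxn n k) => //=; rewrite in_itv/=; apply/andP; split.
    by rewrite -lerBrDl; apply/ltW/(hn (maxn n k)); exact: leq_maxl.
  rewrite -lerBlDl; apply/ltW.
  have : x - a < k%:R by exact: archi_boundP (ltW xa).
  by move=> /lt_le_trans; apply; rewrite ler_nat (leq_trans (leq_maxr n k))// ltnW.
apply: (ge0_integral_exhaust_le (G := G)) => [n|n|n|n x|n].
- rewrite ltrD2l (@le_lt_trans _ _ 1) ?invf_le1 ?ler1n// ?ltr1n//.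
- by rewrite lerD2l lef_pV2 ?posrE// ler_nat.
- by rewrite lerD2l ler_nat.
- by move=> /andP[h1 h2]; apply: gG; rewrite (lt_le_trans _ h1) ?ltrDl.
- apply: GB; first by rewrite ltrDl.
  rewrite ltrD2l (@le_lt_trans _ _ 1) ?invf_le1 ?ler1n// ?ltr1n//.
Qed.

End antiderivative.

(** * The weight, its antiderivative and the supersolution *)

Section volterra.
Context {R : realType} (a : R) (a0 : 0 < a).
Implicit Types s t L m : R.
Local Notation mu := (@lebesgue_measure R).

(* [hsc] majorizes [s^(-1/2) (1+s)^(1/2-A)], [A = 1+a], up to a constant, and has
   the bounded antiderivative [Hsc]. *)
Definition hsc : R -> R :=
  locked (fun s => (Num.sqrt s)^-1 * (1 + Num.sqrt s) `^ (- (1 + 2 * a))).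
Definition Hsc : R -> R := locked (fun s => (1 - (1 + Num.sqrt s) `^ (- (2 * a))) / a).

Lemma hscE s : hsc s = (Num.sqrt s)^-1 * (1 + Num.sqrt s) `^ (- (1 + 2 * a)).
Proof. by rewrite /hsc -lock. Qed.

Lemma HscE s : Hsc s = (1 - (1 + Num.sqrt s) `^ (- (2 * a))) / a.
Proof. by rewrite /Hsc -lock. Qed.

Lemma sqrt1_gt0 (s : R) : 0 < 1 + Num.sqrt s.
Proof. by rewrite ltr_pwDl// sqrtr_ge0. Qed.

Lemma hsc_ge0 s : 0 <= hsc s.
Proof. by rewrite hscE mulr_ge0 ?powR_ge0 ?invr_ge0. Qed.

Lemma Hsc_ge0 s : 0 <= Hsc s.
Proof.
rewrite HscE divr_ge0 ?(ltW a0)// subr_ge0 powRN invf_le1 ?powR_gt0 ?sqrt1_gt0//.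
have p1 : 1 `^ (2 * a) = 1 :> R by rewrite powR1.
rewrite -{1}p1 ge0_ler_powR ?nnegrE ?(ltW (sqrt1_gt0 _))//.
  by rewrite mulr_ge0 ?(ltW a0).
by rewrite lerDl.
Qed.

Lemma Hsc_le s : Hsc s <= a^-1.
Proof.
by rewrite HscE ler_pdivrMr// mulVf ?gt_eqF// gerBl powR_ge0.
Qed.

Lemma is_derive_Hsc s : 0 < s -> is_derive s 1 Hsc (hsc s).
Proof.
move=> s0; rewrite hscE (_ : Hsc = fun s => (1 - (1 + Num.sqrt s) `^ (- (2 * a))) / a); last first.
  by apply/funext => ?; rewrite HscE.
have d1 : is_derive s 1 (fun x : R => 1 + Num.sqrt x) ((2 * Num.sqrt s)^-1).
  have := is_deriveD (is_derive_cst (1 : R) s 1) (is_derive1_sqrt s0).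
  by rewrite add0r.
have d2 : is_derive (1 + Num.sqrt s) 1 (fun x : R => x `^ (- (2 * a)))
    (- (2 * a) * (1 + Num.sqrt s) `^ (- (2 * a) - 1)).
  exact: is_derive1_powR (sqrt1_gt0 s).
have d3 : is_derive s 1 (fun x => (1 + Num.sqrt x) `^ (- (2 * a))) _ :=
  @is_derive1_comp _ (fun x => x `^ (- (2 * a))) (fun x => 1 + Num.sqrt x) _ _ _ d2 d1.
apply: is_derive_eq.
rewrite /GRing.scale/=.
rewrite (_ : - (1 + 2 * a) = - (2 * a) - 1); last by ring.
by field; rewrite !gt_eqF// ?sqrtr_gt0.
Qed.

Lemma continuous_hsc s : 0 < s -> {for s, continuous hsc}.
Proof.
move=> s0; rewrite (_ : hsc = fun s => (Num.sqrt s)^-1 * (1 + Num.sqrt s) `^ (- (1 + 2 * a))); last first.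
  by apply/funext => ?; rewrite hscE.
apply: continuousM.
  apply: continuousV; first by rewrite gt_eqF// sqrtr_gt0.
  exact: sqrt_continuous.
apply: (@continuous_comp _ _ _ (fun s => 1 + Num.sqrt s) (fun u => u `^ (- (1 + 2 * a)))).
  by apply: continuousD; [exact: cst_continuous|exact: sqrt_continuous].
apply: (@derive_continuous R); exact: is_derive1_powR (sqrt1_gt0 s).
Qed.

(** The solution of y' = m h y with y(0) = L, as [Hsc] vanishes at 0. Hence the integral of h y over
    (0,t) is at most y(t) / m, which a large [m] makes small compared with y(t); and y stays bounded
    because [Hsc] does. *)
Definition Lamsc : R -> R -> R -> R := locked (fun L m s => L * expR (m * Hsc s)).

Lemma LamscE L m s : Lamsc L m s = L * expR (m * Hsc s).
Proof. by rewrite /Lamsc -lock. Qed.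

Lemma is_derive_Lamsc L m s : 0 < s -> is_derive s 1 (Lamsc L m) (m * (hsc s * Lamsc L m s)).
Proof.
move=> s0; have dH := is_derive_Hsc s0; rewrite LamscE.
rewrite (_ : Lamsc L m = fun s => L * expR (m * Hsc s)); last by apply/funext => ?; rewrite LamscE.
have d1 : is_derive s 1 (fun x : R => m * Hsc x) (m * hsc s).
  by apply: is_derive_eq; rewrite /GRing.scale/=; ring.
have d3 : is_derive s 1 (fun x : R => expR (m * Hsc x)) _ :=
  @is_derive1_comp _ expR (fun x : R => m * Hsc x) _ _ _ (is_derive_expR (m * Hsc s)) d1.
by apply: is_derive_eq; rewrite /GRing.scale/=; ring.
Qed.

Lemma continuous_Lamsc L m s : 0 < s -> {for s, continuous (Lamsc L m)}.
Proof. by move=> s0; exact: (derive_continuous (is_derive_Lamsc L m s0)). Qed.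

Lemma Lamsc_gt0 L m s : 0 < L -> 0 < Lamsc L m s.
Proof. by move=> L0; rewrite LamscE mulr_gt0 ?expR_gt0. Qed.

Lemma Lamsc_le L m s : 0 < L -> 0 <= m -> Lamsc L m s <= L * expR (m / a).
Proof. by move=> L0 m0; rewrite LamscE ler_pM2l// ler_expR ler_wpM2l// Hsc_le. Qed.

Lemma Hsc_nd s t : 0 <= s -> s <= t -> Hsc s <= Hsc t.
Proof.
move=> s0 st; rewrite !HscE ler_pM2r ?invr_gt0// lerB// !powRN lef_pV2 ?posrE ?powR_gt0 ?sqrt1_gt0//.
rewrite ge0_ler_powR ?nnegrE ?(ltW (sqrt1_gt0 _))//.
  by rewrite mulr_ge0 ?(ltW a0).
by rewrite lerD2l ler_wsqrtr.
Qed.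

Lemma Lamsc_nd L m s t : 0 < L -> 0 <= m -> 0 <= s -> s <= t -> Lamsc L m s <= Lamsc L m t.
Proof.
move=> L0 m0 s0 st; rewrite !LamscE; apply: ler_wpM2l; first exact: ltW.
by rewrite ler_expR; apply: ler_wpM2l => //; exact: Hsc_nd.
Qed.

Lemma hsc_ni s t : 0 < s -> s <= t -> hsc t <= hsc s.
Proof.
move=> s0 st; have t0 := lt_le_trans s0 st.
rewrite !hscE ler_pM ?invr_ge0 ?powR_ge0//.
  by rewrite lef_pV2 ?posrE ?sqrtr_gt0// ler_wsqrtr.
rewrite !powRN lef_pV2 ?posrE ?powR_gt0 ?sqrt1_gt0//.
rewrite ge0_ler_powR ?nnegrE ?(ltW (sqrt1_gt0 _))//.
  by rewrite addr_ge0 ?mulr_ge0 ?(ltW a0).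
by rewrite lerD2l ler_wsqrtr.
Qed.

Lemma integral_hsc_Lamsc_le L m t : 0 < L -> 0 < m -> 0 < t ->
  (\int[mu]_(s in `]0%R, t[) (hsc s * Lamsc L m s)%:E <= (Lamsc L m t / m)%:E)%E.
Proof.
move=> L0 m0 t0; apply: (@ge0_integral_oo_le _ _ (fun s => Lamsc L m s / m)) => //.
- move=> s /andP[s0 st]; split.
  + by rewrite mulr_ge0 ?hsc_ge0 ?ltW ?Lamsc_gt0.
  + have := is_derive_Lamsc L m s0 => dL.
    by apply: is_derive_eq; rewrite /GRing.scale/=; field; rewrite gt_eqF.
  + by apply: continuousM; [exact: continuous_hsc|exact: continuous_Lamsc].
- move=> c d c0 cd dt; rewrite -mulrBl ler_pM2r ?invr_gt0//.
  have h1 := Lamsc_gt0 m c L0.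
  have d0 : 0 <= d by rewrite ltW// (lt_trans c0).
  have h2 := Lamsc_nd L0 (ltW m0) d0 (ltW dt).
  lra.
Qed.

Lemma integral_hsc_le : (\int[mu]_(s in `]0%R, +oo[) (hsc s)%:E <= (a^-1)%:E)%E.
Proof.
apply: (@ge0_integral_oy_le _ _ Hsc) => [s s0|c d c0 cd].
  by split; [exact: hsc_ge0|exact: is_derive_Hsc|exact: continuous_hsc].
by rewrite (le_trans _ (Hsc_le d))// gerBl Hsc_ge0.
Qed.

Lemma integral_sqrt_le t0 t : t0 < t ->
  (\int[mu]_(s in `]t0, t[) ((Num.sqrt (t - s))^-1)%:E <= (2 * Num.sqrt (t - t0))%:E)%E.
Proof.
move=> tt; apply: (@ge0_integral_oo_le _ _ (fun s => - (2 * Num.sqrt (t - s)))) => //.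
- move=> s /andP[s0 st]; have ts : 0 < t - s by rewrite subr_gt0.
  have d1 : is_derive s 1 (fun x : R => t - x) (-1).
    by apply: is_derive_eq; ring.
  have d3 : is_derive s 1 (fun x : R => Num.sqrt (t - x)) _ :=
    @is_derive1_comp _ Num.sqrt (fun x : R => t - x) _ _ _ (is_derive1_sqrt ts) d1.
  split; first by rewrite invr_ge0.
  + apply: is_derive_eq; rewrite /GRing.scale/=.
    by field; rewrite gt_eqF// sqrtr_gt0.
  + apply: continuousV; first by rewrite gt_eqF// sqrtr_gt0.
    exact: (derive_continuous d3).
- move=> c d c0 cd dt; rewrite opprK addrC (@le_trans _ _ (2 * Num.sqrt (t - c)))//.
    by rewrite gerDl oppr_le0 mulr_ge0.
  by rewrite ler_pM2l// ler_wsqrtr// lerB// ltW.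
Qed.

Lemma continuous_sqrt_shift t s : s < t ->
  {for s, continuous (fun s : R => (Num.sqrt (t - s))^-1)}.
Proof.
move=> st; apply: continuousV; first by rewrite gt_eqF// sqrtr_gt0 subr_gt0.
apply: (@continuous_comp _ _ _ (fun s => t - s) Num.sqrt); last exact: sqrt_continuous.
by apply: continuousB; [exact: cst_continuous|exact: cvg_id].
Qed.

(** On the second half of (0,t) the decreasing weight is at most its value at t / 2, whose factor
    (t/2)^(-1/2) is cancelled by sqrt t; only the integrable singularity (t-s)^(-1/2) is left. *)
Lemma integral_near_le t0 t : 0 < t -> t / 2 <= t0 -> t0 < t ->
  (\int[mu]_(s in `]t0, t[) (Num.sqrt t / Num.sqrt (t - s) * hsc s)%:E <=
   (4 * Num.sqrt (t - t0) * (1 + Num.sqrt (t / 2)) `^ (- (1 + 2 * a)))%:E)%E.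
Proof.
move=> t_gt0 tt0 t0t; set p := _ `^ _.
have p0 : 0 <= p by exact: powR_ge0.
have t20 : 0 < t / 2 by rewrite divr_gt0.
have mk : measurable_fun (`]t0, t[%classic : set (measurableTypeR R))
    (fun s : R => (Num.sqrt (t - s))^-1).
  apply: open_continuous_measurable_fun; first exact: interval_open.
  move=> s; rewrite inE/= in_itv/= => /andP[_ st].
  exact: continuous_sqrt_shift.
apply: (@le_trans _ _ (\int[mu]_(s in `]t0, t[) ((2 * p)%:E * ((Num.sqrt (t - s))^-1)%:E))%E).
  apply: ge0_le_integral => //=.
  - by move=> s _; rewrite lee_fin mulr_ge0 ?hsc_ge0 ?divr_ge0.
  - apply/measurable_EFinP; apply: measurable_funM.
      by apply: measurable_funM => //; exact: measurable_cst.
    apply: open_continuous_measurable_fun; first exact: interval_open.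
    move=> s; rewrite inE/= in_itv/= => /andP[st _].
    by apply: continuous_hsc; rewrite (lt_trans _ st)// (lt_le_trans _ tt0).
  - by apply/measurable_EFinP; apply: measurable_funM => //; exact: measurable_cst.
  - move=> s; rewrite in_itv/= => /andP[s1 s2]; rewrite -EFinM lee_fin.
    rewrite mulrAC; apply: ler_wpM2r; first by rewrite invr_ge0.
    apply: (@le_trans _ _ (Num.sqrt t * hsc (t / 2))).
      apply: ler_wpM2l => //; apply: hsc_ni => //.
      by rewrite ltW// (le_lt_trans tt0).
    rewrite hscE -/p mulrA; apply: ler_wpM2r => //.
    rewrite ler_pdivrMr ?sqrtr_gt0// -[leRHS]ger0_norm ?mulr_ge0// -sqrtr_sqr ler_wsqrtr//.
    by rewrite exprMn sqr_sqrtr ?ltW//; lra.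
rewrite ge0_integralZl//=.
- rewrite (@le_trans _ _ ((2 * p)%:E * (2 * Num.sqrt (t - t0))%:E)%E)//.
    by rewrite lee_pmul2l ?lte_fin// ?integral_sqrt_le// mulr_gt0// powR_gt0 ?sqrt1_gt0.
  by rewrite -EFinM lee_fin le_eqVlt; apply/orP; left; apply/eqP; ring.
- exact/measurable_EFinP.
- by rewrite lee_fin mulr_ge0.
Qed.

Lemma continuous_kernel_hsc t s : 0 < s -> s < t ->
  {for s, continuous (fun s : R => Num.sqrt t / Num.sqrt (t - s) * hsc s)}.
Proof.
move=> s0 st; apply: continuousM; last exact: continuous_hsc.
by apply: continuousM; [exact: cst_continuous|exact: continuous_sqrt_shift].
Qed.

Lemma continuous_kernel_sc L m t s : 0 < s -> s < t ->
  {for s, continuous (fun s => Num.sqrt t / Num.sqrt (t - s) * (hsc s * Lamsc L m s))}.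
Proof.
move=> s0 st; apply: continuousM; last first.
  by apply: continuousM; [exact: continuous_hsc|exact: continuous_Lamsc].
apply: continuousM; first exact: cst_continuous.
exact: continuous_sqrt_shift.
Qed.

(* The singular part of the Volterra kernel near [s = t] is absorbed by taking
   [e] small, the rest by taking [m] large. *)
Lemma supersolution (c C : R) : 0 < c -> 0 < C -> exists L m : R, [/\ 0 < L, 0 < m &
  forall t, 0 < t ->
  (c%:E * (1 + C%:E * \int[mu]_(s in `]0%R, t[)
     (Num.sqrt t / Num.sqrt (t - s) * (hsc s * Lamsc L m s))%:E) <= (Lamsc L m t)%:E)%E].
Proof.
(* The target is c + Lam/4 + Lam/4 <= Lam. The choice of [m] makes the far part Lam/4, the bound 32
   c C e <= 1 makes the part near s = t at most Lam/4, and L = 2 c gives c <= Lam/2. *)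
move=> c0 C0; pose e : R := (2 + 32 * (c * C))^-1.
have cC0 : 0 < c * C by rewrite mulr_gt0.
have e0 : 0 < e by rewrite invr_gt0; lra.
have e2 : e <= 2^-1 by rewrite lef_pV2 ?posrE//; lra.
have ecC : 32 * (c * C) * e <= 1.
  by rewrite ler_pdivrMr ?mul1r; lra.
pose m := 4 * (c * C) / e; have m0 : 0 < m by rewrite divr_gt0// mulr_gt0.
pose L := 2 * c; have L0 : 0 < L by rewrite mulr_gt0.
exists L, m; split => // t t0.
set Lam := Lamsc L m; have Lam0 s : 0 < Lam s by exact: Lamsc_gt0.
have cLam : 2 * c <= Lam t.
  apply: (@le_trans _ _ (Lamsc L m 0)); last by apply: Lamsc_nd => //; exact: ltW.
  rewrite LamscE ler_peMr ?(ltW L0)// -expR0 ler_expR mulr_ge0 ?(ltW m0)//.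
  exact: Hsc_ge0.
(* Before [t1] the factor sqrt t / sqrt (t - s) is at most 1/e; after it the remaining length is e^2
   t, whose square root supplies the small factor e. *)
pose t1 := (1 - e ^+ 2) * t.
have e20 : 0 < e ^+ 2 by rewrite exprn_gt0.
have e24 : e ^+ 2 <= 4^-1 by nra.
have t10 : 0 < t1 by rewrite mulr_gt0//; lra.
have t12 : t / 2 <= t1 by rewrite mulrC ler_pM2r//; lra.
have t1t : t1 < t by rewrite gtr_pMl//; lra.
pose k (s : R) : R := Num.sqrt t / Num.sqrt (t - s) * (hsc s * Lam s).
have hL0 s : 0 <= hsc s * Lam s by apply: mulr_ge0; [exact: hsc_ge0|exact: ltW].
have k0 s : 0 <= k s by apply: mulr_ge0; [exact: divr_ge0|exact: hL0].
have mk : measurable_fun (`]0%R, t[%classic : set (measurableTypeR R)) k.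
  apply: open_continuous_measurable_fun; first exact: interval_open.
  by move=> s; rewrite inE/= in_itv/= => /andP[? ?]; exact: continuous_kernel_sc.
have mhL : measurable_fun (`]0%R, t[%classic : set (measurableTypeR R)) (fun s => hsc s * Lam s).
  apply: open_continuous_measurable_fun; first exact: interval_open.
  move=> s; rewrite inE/= in_itv/= => /andP[? ?].
  by apply: continuousM; [exact: continuous_hsc|exact: continuous_Lamsc].
have splt : `]0%R, t[%classic = `]0%R, t1]%classic `|` `]t1, t[%classic :> set R.
  by rewrite -itv_bndbnd_setU ?bnd_simp// ltW.
have sub1 : (`]0%R, t1]%classic : set R) `<=` `]0%R, t[%classic.
  by rewrite splt; left.
have sub2 : (`]t1, t[%classic : set R) `<=` `]0%R, t[%classic.
  by rewrite splt; right.
have far : (\int[mu]_(s in `]0%R, t1]) (k s)%:E <= (e^-1 * (Lam t / m))%:E)%E.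
  apply: (@le_trans _ _ (\int[mu]_(s in `]0%R, t1]) ((e^-1)%:E * (hsc s * Lam s)%:E))%E).
    apply: ge0_le_integral => //=.
    - by move=> s _; rewrite lee_fin.
    - by apply/measurable_EFinP; exact: measurable_funS mk.
    - apply/measurable_EFinP; apply: measurable_funM; first exact: measurable_cst.
      exact: measurable_funS mhL.
    - move=> s; rewrite in_itv/= => /andP[s0 s1]; rewrite -EFinM lee_fin.
      apply: ler_wpM2r; first exact: hL0.
      have ts : e ^+ 2 * t <= t - s by rewrite /t1 in s1; lra.
      rewrite ler_pdivrMr; last first.
        by rewrite sqrtr_gt0 (lt_le_trans _ ts)// mulr_gt0.
      rewrite ler_pdivlMl// -[e]ger0_norm ?(ltW e0)// -sqrtr_sqr -sqrtrM ?sqr_ge0//.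
      by rewrite ler_wsqrtr.
  rewrite ge0_integralZl//=; first last.
  - by rewrite lee_fin invr_ge0 ltW.
  - by move=> s _; rewrite lee_fin hL0.
  - by apply/measurable_EFinP; exact: measurable_funS mhL.
  have ei0 : 0 < e^-1 by rewrite (invr_gt0 e).
  rewrite [leRHS]EFinM lee_pmul2l ?lte_fin//.
  apply: le_trans (integral_hsc_Lamsc_le L0 m0 t0).
  apply: ge0_subset_integral => //=; first exact/measurable_EFinP.
  by move=> s _; rewrite lee_fin hL0.
have near_ : (\int[mu]_(s in `]t1, t[) (k s)%:E <= (8 * e * Lam t)%:E)%E.
  apply: (@le_trans _ _ (\int[mu]_(s in `]t1, t[)
     ((Lam t)%:E * (Num.sqrt t / Num.sqrt (t - s) * hsc s)%:E))%E).
    have mN : measurable_fun (`]t1, t[%classic : set (measurableTypeR R))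
       (fun s : R => Num.sqrt t / Num.sqrt (t - s) * hsc s).
      apply: open_continuous_measurable_fun; first exact: interval_open.
      move=> s; rewrite inE/= in_itv/= => /andP[st1 st].
      by apply: continuous_kernel_hsc => //; rewrite (lt_trans t10).
    apply: ge0_le_integral => //=.
    - by move=> s _; rewrite lee_fin.
    - by apply/measurable_EFinP; exact: measurable_funS mk.
    - by apply/measurable_EFinP; apply: measurable_funM => //; exact: measurable_cst.
    - move=> s; rewrite in_itv/= => /andP[s1 s2]; rewrite -EFinM lee_fin /k mulrA mulrC.
      apply: ler_wpM2r; first by rewrite mulr_ge0 ?hsc_ge0 ?divr_ge0.
      by apply: Lamsc_nd; rewrite // ?(ltW m0) ?(ltW s2)// ltW// (lt_trans t10).
  rewrite ge0_integralZl//=; first last.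
  - by rewrite lee_fin (ltW (Lam0 _)).
  - by move=> s _; rewrite lee_fin mulr_ge0 ?hsc_ge0 ?divr_ge0.
  - apply/measurable_EFinP.
    apply: open_continuous_measurable_fun; first exact: interval_open.
    move=> s; rewrite inE/= in_itv/= => /andP[st1 st].
    by apply: continuous_kernel_hsc => //; rewrite (lt_trans t10).
  rewrite mulrC [leRHS]EFinM lee_pmul2l ?lte_fin//.
  apply: (le_trans (integral_near_le t0 t12 t1t)); rewrite lee_fin.
  have -> : t - t1 = e ^+ 2 * t by rewrite /t1; ring.
  rewrite sqrtrM ?sqr_ge0// sqrtr_sqr ger0_norm ?(ltW e0)//.
  have h1 : (1 + Num.sqrt (t / 2)) `^ (- (1 + 2 * a)) <= (1 + Num.sqrt (t / 2))^-1.
    rewrite -[leRHS]powR_inv1 ?(ltW (sqrt1_gt0 _))// ler_powR//.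
      by rewrite lerDl.
    by rewrite lerN2 lerDl mulr_ge0 ?(ltW a0).
  have h2 : Num.sqrt t <= 2 * (1 + Num.sqrt (t / 2)).
    have : Num.sqrt t <= 2 * Num.sqrt (t / 2).
      rewrite -[leRHS]ger0_norm ?mulr_ge0// -sqrtr_sqr ler_wsqrtr//.
      by rewrite exprMn sqr_sqrtr ?divr_ge0 ?(ltW t0)//; lra.
    by lra.
  apply: (@le_trans _ _ (4 * (e * Num.sqrt t) * (1 + Num.sqrt (t / 2))^-1)).
    by apply: ler_wpM2l h1; rewrite !mulr_ge0 ?(ltW e0).
  rewrite ler_pdivrMr ?sqrt1_gt0//.
  have := ler_wpM2l (ltW e0) h2; lra.
have kint : (\int[mu]_(s in `]0%R, t[) (k s)%:E <= (e^-1 * (Lam t / m) + 8 * e * Lam t)%:E)%E.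
  rewrite splt ge0_integral_setU//=.
  - by rewrite EFinD; apply: leeD far near_.
  - by rewrite -splt; exact/measurable_EFinP.
  - by move=> s _; rewrite lee_fin.
  - rewrite disj_set2E; apply/eqP; apply/seteqP; split => // s [] /=.
    by rewrite !in_itv/= => /andP[_ h1] /andP[h2 _]; move: (lt_le_trans h2 h1); rewrite ltxx.
apply: (@le_trans _ _ (c%:E * (1 + C%:E * (e^-1 * (Lam t / m) + 8 * e * Lam t)%:E))%E).
  rewrite lee_pmul2l ?lte_fin// leeD2l// lee_pmul2l ?lte_fin//.
rewrite [leLHS](_ : _ = (c * (1 + C * (e^-1 * (Lam t / m) + 8 * e * Lam t)))%:E)// lee_fin.
have -> : c * (1 + C * (e^-1 * (Lam t / m) + 8 * e * Lam t)) =
  c + Lam t / 4 + (32 * (c * C) * e) * (Lam t / 4).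
  by rewrite /m; field; rewrite !gt_eqF.
have := Lam0 t; nra.
Qed.

End volterra.

(** * Limits under the integral sign *)

Section sequential.
Context {R : realType}.

(** Reduces limits along a neighbourhood filter to sequences, the setting in which dominated
    convergence is applied. *)
Lemma cvg_sequential (M : pseudoMetricType R) (g : M -> R) (z0 : M) (l : R) :
  (forall u : nat -> M, u @ \oo --> z0 -> g \o u @ \oo --> l) -> g z @[z --> z0] --> l.
Proof.
move=> H; apply/cvgrPdist_lt => e e0; apply: contrapT => nH.
have bad (n : nat) : exists z, ball z0 n.+1%:R^-1 z /\ e <= `|l - g z|.
  apply: contrapT => nb; apply: nH.
  apply/nbhs_ballP; exists n.+1%:R^-1; first by rewrite /= invr_gt0.
  move=> z hz; rewrite /= ltNge; apply/negP => ez; apply: nb.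
  by exists z.
have [u hu] := choice bad.
have uz : u @ \oo --> z0.
  apply/cvg_ballP => d d0.
  have [n _ hn] := near_infty_natSinv_lt (PosNum d0).
  exists n => // k /= nk; apply: le_ball (hu k).1.
  by apply: ltW; exact: hn.
have /cvgrPdist_lt/(_ e e0)[n _ hn] := H u uz.
by have := hn n (leqnn n); rewrite /= ltNge (hu n).2.
Qed.

End sequential.

Section dominated.
Context {R : realType} d (Y : measurableType d) (mu : {measure set Y -> \bar R}).
Variables (D : set Y) (mD : measurable D).

Lemma Rintegral_dominated_cvg (f_ : nat -> Y -> R) (f g : Y -> R) :
  (forall n, measurable_fun D (f_ n)) ->
  (forall y, D y -> f_ ^~ y @ \oo --> f y) ->
  mu.-integrable D (EFin \o g) ->
  (forall n y, D y -> `|f_ n y| <= g y) ->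
  \int[mu]_(y in D) f_ n y @[n --> \oo] --> \int[mu]_(y in D) f y.
Proof.
move=> mf ff ig fg.
have mfn n : measurable_fun D (EFin \o f_ n) by exact/measurable_EFinP.
have iff_ n : mu.-integrable D (EFin \o f_ n).
  apply: (le_integrable mD (mfn n) _ ig) => y Dy /=; rewrite lee_fin.
  by rewrite (le_trans (fg n y Dy))// ler_norm.
have mff : measurable_fun D f.
  exact: (measurable_fun_cvg mf ff).
have if_ : mu.-integrable D (EFin \o f).
  apply: (le_integrable mD _ _ ig) => [|y Dy /=]; first exact/measurable_EFinP.
  rewrite lee_fin (le_trans _ (ler_norm _))//.
  have cn : `|f_ n y| @[n --> \oo] --> `|f y| by apply: cvg_norm; exact: ff.
  rewrite -(cvg_lim _ cn)//; apply: limr_le; first by apply/cvg_ex; exists `|f y|.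
  by apply: nearW => n; exact: fg.
have h := @dominated_cvg _ _ _ mu D mD (fun n => EFin \o f_ n) (EFin \o f) (EFin \o g) mfn.
apply: fine_cvg; rewrite fineK; last by exact: integrable_fin_num.
apply: h => // y Dy.
by apply: cvg_EFin; [exact: nearW|exact: ff].
Qed.

Lemma dominated_continuity (M : pseudoMetricType R) (k : M -> Y -> R) (z0 : M) (g : Y -> R) :
  (\forall z \near z0, measurable_fun D (k z) /\ forall y, D y -> `|k z y| <= g y) ->
  mu.-integrable D (EFin \o g) ->
  (forall y, D y -> k ^~ y @ z0 --> k z0 y) ->
  \int[mu]_(y in D) k z y @[z --> z0] --> \int[mu]_(y in D) k z0 y.
Proof.
move=> nk ig ck; apply: cvg_sequential => u uz.
have [N _ hN] : \forall n \near \oo, measurable_fun D (k (u n)) /\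
    forall y, D y -> `|k (u n) y| <= g y by exact: uz nk.
rewrite -(cvg_shiftn N) /=.
apply: (@Rintegral_dominated_cvg (fun n => k (u (n + N)%N)) _ g) => //.
- by move=> n; have [] := hN (n + N)%N (leq_addl _ _).
- move=> y Dy; rewrite (cvg_shiftn N (fun n => k (u n) y)).
  exact: cvg_comp uz (ck y Dy).
- by move=> n y Dy; have [_] := hN (n + N)%N (leq_addl _ _); exact.
Qed.

Lemma norm_Rintegral_le (f : Y -> R) (B : \bar R) : measurable_fun D f ->
  (\int[mu]_(y in D) `|f y|%:E <= B)%E -> (B < +oo)%E ->
  (`|\int[mu]_(y in D) f y|%:E <= B)%E.
Proof.
move=> mf fB Boo.
have if_ : mu.-integrable D (EFin \o f).
  by apply/integrableP; split; [exact/measurable_EFinP|exact: le_lt_trans Boo].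
rewrite EFin_normr_Rintegral//; apply: le_trans fB.
by apply: le_abse_integral => //; exact/measurable_EFinP.
Qed.

End dominated.

Section derive_limit.
Context {R : realType}.

(* Uniform limits commute with differentiation, in a pointwise form: the mean value
   theorem is applied to the approximants only. *)
Lemma is_derive_approx (f g : R -> R) (r0 : R) :
  {for r0, continuous g} ->
  (forall e : R, 0 < e -> exists f' g' : R -> R,
     (forall r : R, is_derive r (1 : R) f' (g' r)) /\
     (forall r, `|f r - f' r| <= e /\ `|g r - g' r| <= e)) ->
  is_derive r0 (1 : R) f (g r0).
Proof.
move=> cg H.
suff : h^-1 *: ((f \o shift r0) (h *: 1) - f r0) @[h --> 0^'] --> g r0.
  move=> hc; apply: DeriveDef; first by apply/cvg_ex; exists (g r0).
  by apply/cvg_lim.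
apply/cvgrPdist_le => e e0.
have e20 : 0 < e / 2 by rewrite divr_gt0.
have /cvgrPdist_le/(_ _ e20)/nbhs_ballP[d /= d0 hd] := cg.
near=> h.
have h0 : h != 0 by near: h; exact: nbhs_dnbhs_neq.
have hd' : `|h| < d by near: h; apply: dnbhs0_lt.
(* The approximant is chosen after [h]: two errors of size |h| e / 8, divided by |h| in the
   difference quotient, cost e / 4. *)
pose e' := `|h| * e / 8.
have hp : 0 < `|h| by rewrite normr_gt0.
pose e1 := Num.min e' (e / 4).
have e10 : 0 < e1 by rewrite lt_min !divr_gt0 ?mulr_gt0.
have [f' [g' [df fg]]] := H _ e10.
have [c cb fE] : exists2 c, `|r0 - c| < d & f' (h + r0) - f' r0 = g' c * h.
  have cf' a b : {within `[a, b], continuous f'}.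
    apply: continuous_subspaceT => x; apply/differentiable_continuous/derivable1_diffP.
    exact: ex_derive.
  have [hpos|hneg|h00] := ltgtP 0 h; last by rewrite -h00 eqxx in h0.
    have ab : r0 < h + r0 by rewrite ltrDr.
    have [c cin ->] := MVT ab (fun x _ => df x) (cf' _ _).
    exists c; last by rewrite addrK.
    move: cin; rewrite in_itv/= => /andP[c1 c2].
    by rewrite distrC gtr0_norm ?subr_gt0//; move: hd'; rewrite gtr0_norm//; lra.
  have ab : h + r0 < r0 by rewrite gtrDr.
  have [c cin E] := MVT ab (fun x _ => df x) (cf' _ _).
  exists c; last by rewrite -opprB E; ring.
  move: cin; rewrite in_itv/= => /andP[c1 c2].
  by rewrite gtr0_norm ?subr_gt0//; move: hd'; rewrite ltr0_norm//; lra.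
rewrite /= /GRing.scale/= mulr1.
have -> : g r0 - h^-1 * (f (h + r0) - f r0) =
   (g r0 - g c) + (g c - g' c) + h^-1 * ((f' (h + r0) - f (h + r0)) + (f r0 - f' r0)).
  have -> : h^-1 * (f (h + r0) - f r0) = h^-1 * (f' (h + r0) - f' r0) -
     h^-1 * ((f' (h + r0) - f (h + r0)) + (f r0 - f' r0)) by ring.
  by rewrite fE mulrCA mulVf// mulr1; ring.
have b1 : `|g r0 - g c| <= e / 2 by apply: hd; rewrite /ball/=.
have b2 : `|g c - g' c| <= e / 4.
  by apply: le_trans (fg c).2 _; rewrite /e1 ge_min lexx orbT.
have e1e' : e1 <= e' by rewrite /e1 ge_min lexx.
have b3 : `|h^-1 * ((f' (h + r0) - f (h + r0)) + (f r0 - f' r0))| <= e / 4.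
  rewrite normrM normfV ler_pdivrMl//.
  apply: le_trans (ler_normD _ _) _; rewrite distrC.
  have h1 := (fg (h + r0)).1; have h2 := (fg r0).1.
  by apply: le_trans (lerD (le_trans h1 e1e') (le_trans h2 e1e')) _; rewrite /e'; lra.
apply: le_trans (ler_normD _ _) _; apply: le_trans (lerD (ler_normD _ _) (lexx _)) _.
lra.
Unshelve. all: by end_near. Qed.

End derive_limit.

(** * Parametrized integrals and the majorant *)

Section indexed_kernel.
Context {R : realType} {n : nat}.
Implicit Types (x y v : 'rV[R]_n) (s t tau eta : R) (j : option 'I_n).

(* [None] indexes the heat kernel, [Some i] its [i]-th partial derivative. *)
Definition Kj j : 'rV[R]_n -> R -> R :=
  locked (fun x t => if j is Some i then dGk i x t else Gk x t).

(** The parabolic weight that puts the kernel and its spatial derivatives on the same scale, so that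
    solution and gradient are estimated together. *)
Definition sg j t : R := if j is Some _ then Num.sqrt t else 1.

(** The price of doubling the time: the ratio of the kernel peaks at t and 2 t. *)
Definition cn : R := 2 `^ (n%:R / 2).

Lemma cn_gt0 : 0 < cn.
Proof. exact: powR_gt0. Qed.

Lemma KjE j x t : Kj j x t = if j is Some i then dGk i x t else Gk x t.
Proof. by rewrite /Kj -lock. Qed.

Lemma sg_ge0 j t : 0 <= sg j t.
Proof. by case: j => //= _; exact: sqrtr_ge0. Qed.

Lemma sg_gt0 j t : 0 < t -> 0 < sg j t.
Proof. by case: j => //= _; rewrite sqrtr_gt0. Qed.

Lemma continuous_Kj j x t : 0 < t ->
  {for (x, t), continuous (fun z : 'rV[R]_n * R => Kj j z.1 z.2)}.
Proof.
move=> t0; rewrite (_ : (fun z : 'rV[R]_n * R => Kj j z.1 z.2) =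
  (fun z => if j is Some i then dGk i z.1 z.2 else Gk z.1 z.2)); last first.
  by apply/funext => z; rewrite KjE.
by case: j => [i|]; [exact: continuous_dGk|exact: continuous_Gk].
Qed.

(** The weight is taken at the observation time t, the kernel at the elapsed time tau = t - s. The
    quotient of square roots comes from the derivatives; for the kernel itself it is at least 1 and
    is kept so that one Volterra kernel serves both. *)
Lemma sg_Kj_le j x tau t : 0 < tau -> tau <= t ->
  sg j t * `|Kj j x tau| <= cn * (Num.sqrt t / Num.sqrt tau) * Gk x (2 * tau).
Proof.
move=> tau0 taut; have st : 0 < Num.sqrt tau by rewrite sqrtr_gt0.
rewrite KjE; case: j => [i|] /=.
  apply: le_trans (ler_wpM2l (sqrtr_ge0 _) (dGk_le_Gk2 i x tau0)) _.
  by rewrite le_eqVlt; apply/orP; left; apply/eqP; rewrite /cn; ring.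
rewrite mul1r ger0_norm ?Gk_ge0//; apply: le_trans (Gk_le_Gk2 x tau0) _.
apply: ler_wpM2r; first exact: Gk_ge0.
rewrite /cn ler_peMr ?powR_ge0// ler_pdivlMr// mul1r.
exact: ler_wsqrtr.
Qed.

Lemma gam_ni s t : 0 < s -> s <= t -> gam n t <= gam n s.
Proof.
move=> s0 st; have t0 := lt_le_trans s0 st.
rewrite /gam !powRN lef_pV2 ?posrE ?powR_gt0 ?pi4_gt0//.
apply: ge0_ler_powR; rewrite ?nnegrE ?divr_ge0// ?(ltW (pi4_gt0 _))//.
by rewrite ler_pM2l// mulr_gt0// pi_gt0.
Qed.

(** A bound, uniform in space, for the kernel and its derivatives at all times from [eta] on; it
    supplies the constant in the dominating functions below. *)
Definition Kbd (eta : R) : R := cn * (1 + (Num.sqrt eta)^-1) * gam n (2 * eta).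

Lemma Kj_le_Kbd j x eta tau : 0 < eta -> eta <= tau -> `|Kj j x tau| <= Kbd eta.
Proof.
move=> eta0 le; have tau0 := lt_le_trans eta0 le.
have h := sg_Kj_le j x tau0 (lexx tau).
have s0 := sg_gt0 j tau0.
rewrite divff ?gt_eqF ?sqrtr_gt0// mulr1 in h.
have {}h : `|Kj j x tau| <= (sg j tau)^-1 * cn * Gk x (2 * tau).
  by rewrite -mulrA ler_pdivlMl.
apply: le_trans h _; rewrite /Kbd.
have g1 : Gk x (2 * tau) <= gam n (2 * eta).
  apply: le_trans (Gk_le_gam _ _) _; first by rewrite mulr_gt0.
  by apply: gam_ni; rewrite ?mulr_gt0// ler_pM2l.
have s1 : (sg j tau)^-1 <= 1 + (Num.sqrt eta)^-1.
  case: (j) => [i|] /=; last by rewrite invr1 lerDl invr_ge0.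
  apply: ler_wpDl => //; rewrite lef_pV2 ?posrE ?sqrtr_gt0//.
  exact: ler_wsqrtr.
apply: ler_pM => //; rewrite ?Gk_ge0//.
  by rewrite mulr_ge0 ?invr_ge0 ?sg_ge0// ltW// cn_gt0.
by rewrite mulrC; apply: ler_wpM2l => //; exact/ltW/cn_gt0.
Qed.

Lemma is_derive_Kj (i : 'I_n) x t (r : R) : 0 < t ->
  is_derive r (1 : R) (fun h : R => Kj None (h *: delta_mx ord0 i + x) t)
    (Kj (Some i) (r *: delta_mx ord0 i + x) t).
Proof.
move=> t0; under eq_fun do rewrite KjE; rewrite KjE.
exact: is_derive_Gk.
Qed.

End indexed_kernel.

(** * Integrals of kernels against a density, away from the singular time *)

Section parametrized.
Context {R : realType} {n : nat} d (Z : measurableType d) (m : {measure set Z -> \bar R}).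
Local Notation TR := (measurableTypeR R).
Local Notation Kbd := (@Kbd R n).
Variables (D : set Z) (yy : Z -> 'rV[R]_n) (ss : Z -> R) (psi : Z -> R) (t0 eta : R).
Hypotheses (mD : measurable D) (myy : measurable_fun setT yy) (mss : measurable_fun setT (ss : Z -> TR)).
Hypotheses (ipsi : m.-integrable D (EFin \o psi)) (eta0 : 0 < eta).
Hypothesis sst : forall z, D z -> ss z + eta <= t0.
Implicit Types (x : 'rV[R]_n) (t : R) (j : option 'I_n).

Lemma measurable_shifted_kernel x t : measurable_fun setT
  (fun z => (x - yy z, t - ss z) : 'rV[R]_n * TR).
Proof.
apply: measurable_fun_pair.
  apply: measurable_rV => i.
  rewrite (_ : (fun z => _) = (fun z => x ord0 i - yy z ord0 i)); last first.
    by apply/funext => z; rewrite !mxE.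
  by apply: measurable_funB => //; exact: measurableT_comp (measurable_coord i) myy.
by apply: (@measurable_funB _ _ _ setT (fun=> t) ss).
Qed.

Lemma measurable_Kj_shift j x t (E : set Z) : measurable E ->
  (forall z, E z -> ss z < t) ->
  measurable_fun E (fun z => Kj j (x - yy z) (t - ss z)).
Proof.
move=> mE sE.
pose g := fun z => (x - yy z, t - ss z) : 'rV[R]_n * R.
pose P : set ('rV[R]_n * R) := [set p | 0 < p.2].
have oP : open P.
  rewrite (_ : P = snd @^-1` [set x : R | 0 < x])//.
  apply: open_comp; last exact: open_gt.
  by move=> p _; exact: cvg_snd.
have mg (U : set ('rV[R]_n * R)) : open U -> measurable (g @^-1` U).
  move=> /open_measurable_rVR mU.
  by rewrite -[X in measurable X]setTI; exact: measurable_shifted_kernel.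
apply: (@measurable_funS _ _ _ _ (g @^-1` P)).
- exact: mg.
- by move=> z /sE; rewrite /g /P /= subr_gt0.
apply: (@continuous_on_measurable _ _ _ _ g P (fun p => Kj j p.1 p.2)) => //.
by move=> [y s] s0; exact: continuous_Kj.
Qed.

(** The abstract space [Z] covers the heat flow and the majorant (space alone, source time 0), the
    Duhamel integrals (space-time) and convolutions of two kernels. The gap [eta] between source
    times and [t0] keeps the kernel bounded in the lemmas of this section. *)
Definition Jint j x t : R := \int[m]_(z in D) (Kj j (x - yy z) (t - ss z) * psi z).

Lemma near_shift x : \forall p \near (x, t0), eta / 2 + t0 <= eta + (p : 'rV[R]_n * R).2.
Proof.
have c2 : (fun p : 'rV[R]_n * R => p.2) @ (x, t0) --> t0 by exact: cvg_snd.
have e2 : 0 < eta / 2 by rewrite divr_gt0.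
move/cvgrPdist_lt : c2 => /(_ _ e2); apply: filterS => p /=.
by rewrite ltr_distlC => /andP[h1 h2]; lra.
Qed.

(** The modulus stands inside the integral so that, taken with a majorant for [psi], the limit is
    uniform over all densities below that majorant. This is where the equicontinuity of the Duhamel
    integrals comes from. *)
Lemma Jint_abs_cvg j x :
  \int[m]_(z in D) (`|Kj j (p.1 - yy z) (p.2 - ss z) - Kj j (x - yy z) (t0 - ss z)| * `|psi z|)
    @[p --> (x, t0)] --> (0 : R).
Proof.
pose k (p : 'rV[R]_n * R) z := `|Kj j (p.1 - yy z) (p.2 - ss z) - Kj j (x - yy z) (t0 - ss z)| * `|psi z|.
have mpsi : measurable_fun D psi by apply/measurable_EFinP; exact: measurable_int ipsi.
have -> : (0 : R) = \int[m]_(z in D) k (x, t0) z.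
  rewrite /Rintegral (eq_integral (fun=> 0%E)) ?integral0// => z _.
  by rewrite /k subrr normr0 mul0r.
apply: (@dominated_continuity _ _ _ _ _ mD _ k (x, t0) (fun z => 2 * Kbd (eta / 2) * `|psi z|)).
- have := near_shift x; apply: filterS => p hp.
  have hs z : D z -> eta / 2 <= p.2 - ss z by move=> /sst h; lra.
  have e2 : 0 < eta / 2 by rewrite divr_gt0.
  split.
    apply: measurable_funM; last exact: measurableT_comp.
    apply: measurableT_comp => //; apply: measurable_funB; apply: measurable_Kj_shift => // z Dz.
      by have := hs z Dz; lra.
    by have := sst Dz; lra.
  move=> z Dz; rewrite /k normrM !normr_id; apply: ler_wpM2r => //.
  apply: le_trans (ler_normB _ _) _; rewrite mulrDl !mul1r.
    apply: lerD; apply: Kj_le_Kbd => //; first exact: hs.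
  by have := sst Dz; lra.
- have := @integrableZl _ _ _ m D mD (2 * Kbd (eta / 2)) _ (integrable_norm ipsi).
  by apply: eq_integrable.
- move=> z Dz.
  have cK : {for (x, t0), continuous (fun p : 'rV[R]_n * R => Kj j (p.1 - yy z) (p.2 - ss z))}.
    apply: (@continuous_comp _ _ _ (fun p : 'rV[R]_n * R => (p.1 - yy z, p.2 - ss z))
      (fun p => Kj j p.1 p.2)).
      apply: continuous_pair.
        by apply: continuousB; [exact: cvg_fst|exact: cst_continuous].
      by apply: continuousB; [exact: cvg_snd|exact: cst_continuous].
    by apply: continuous_Kj; rewrite subr_gt0 (lt_le_trans _ (sst Dz))// ltrDl.
  suff : {for (x, t0), continuous (fun p : 'rV[R]_n * R => k p z)} by [].
  apply: (@continuousM _ _ (fun p : 'rV[R]_n * R => `|Kj j (p.1 - yy z) (p.2 - ss z) - _|));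
    last exact: cst_continuous.
  apply: (@continuous_comp _ _ _ (fun p : 'rV[R]_n * R => Kj j (p.1 - yy z) (p.2 - ss z) - _)
    (@Num.norm _ R)); last exact: norm_continuous.
  by apply: continuousB => //; exact: cst_continuous.
Qed.

Lemma integrable_Kj j x t : (forall z, D z -> ss z + eta / 2 <= t) ->
  m.-integrable D (fun z => (Kj j (x - yy z) (t - ss z) * psi z)%:E).
Proof.
move=> ht.
have mpsi : measurable_fun D psi by apply/measurable_EFinP; exact: measurable_int ipsi.
have e2 : 0 < eta / 2 by rewrite divr_gt0.
have := @integrableZl _ _ _ m D mD (Kbd (eta / 2)) _ (integrable_norm ipsi).
apply: le_integrable => //.
  apply/measurable_EFinP; apply: measurable_funM => //; apply: measurable_Kj_shift => // z Dz.
  by have := ht z Dz; lra.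
move=> z Dz /=; rewrite lee_fin; apply: le_trans (ler_norm _).
rewrite normrM ler_wpM2r// Kj_le_Kbd//.
by have := ht z Dz; lra.
Qed.

Lemma Jint_continuous j x : {for (x, t0), continuous (fun p => Jint j p.1 p.2)}.
Proof.
apply/cvgrPdist_le => e e0.
have := Jint_abs_cvg j x; move/cvgrPdist_le => /(_ e e0) h1.
have := near_shift x => h2; move: h1 h2; apply: filterS2 => p h1 h2.
have e2 : 0 < eta / 2 by rewrite divr_gt0.
have ht z : D z -> ss z + eta / 2 <= t0 by move=> /sst; lra.
have hp z : D z -> ss z + eta / 2 <= p.2 by move=> /sst; lra.
rewrite /Jint -RintegralB//; last 2 first.
- exact: integrable_Kj.
- exact: integrable_Kj.
apply: le_trans (le_trans _ h1).
  apply: le_normr_Rintegral => //.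
  by have := integrableB mD (integrable_Kj j x ht) (integrable_Kj j p.1 hp); apply: eq_integrable.
rewrite sub0r normrN ler_normr; apply/orP; left.
rewrite le_eqVlt; apply/orP; left; apply/eqP; apply: eq_Rintegral => z _.
by rewrite -mulrBl normrM distrC.
Qed.

Lemma is_derive_Jint (i : 'I_n) x (r : R) :
  is_derive r (1 : R) (fun h : R => Jint None (h *: delta_mx ord0 i + x) t0)
    (Jint (Some i) (r *: delta_mx ord0 i + x) t0).
Proof.
have e2 : 0 < eta / 2 by rewrite divr_gt0.
have ht z : D z -> ss z + eta / 2 <= t0 by move=> /sst; lra.
have st z : D z -> 0 < t0 - ss z by move=> /sst; lra.
pose f (h : R) z := Kj None (h *: delta_mx ord0 i + x - yy z) (t0 - ss z) * psi z.
have df (h : R) z : D z -> is_derive h (1 : R) (f ^~ z)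
   (Kj (Some i) (h *: delta_mx ord0 i + x - yy z) (t0 - ss z) * psi z).
  move=> /st tz; have := is_derive_Kj i (x - yy z) h tz => dk.
  rewrite /f; under eq_fun do rewrite -addrA; rewrite -addrA.
  by apply: is_derive_eq; rewrite /GRing.scale/= mulr0 add0r mulrC.
have dfE (h : R) z : D z -> partial1of2 f h z =
   Kj (Some i) (h *: delta_mx ord0 i + x - yy z) (t0 - ss z) * psi z.
  by move=> /(df h) d1; rewrite partial1of2E derive_val.
(* Any neighbourhood of [r] would do: [Kbd] bounds the derivative at every position. *)
have rI : `]r - 1, r + 1[%classic r by rewrite /= in_itv/=; apply/andP; split; lra.
pose G z := Kbd (eta / 2) * `|psi z|.
have G0 z : 0 <= G z.
  by rewrite mulr_ge0// /Kbd !mulr_ge0 ?(ltW cn_gt0) ?addr_ge0 ?invr_ge0 ?powR_ge0.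
have iG : m.-integrable D (EFin \o G).
  have := @integrableZl _ _ _ m D mD (Kbd (eta / 2)) _ (integrable_norm ipsi).
  by apply: eq_integrable.
have Gub (h : R) z : `]r - 1, r + 1[%classic h -> D z -> `|partial1of2 f h z| <= G z.
  move=> _ Dz; rewrite dfE// normrM ler_wpM2r// Kj_le_Kbd//.
  by have := sst Dz; lra.
have ddf (h : R) z : D z -> derivable (f ^~ z) h 1.
  by move=> /(df h) d1; exact: ex_derive.
have := @cvg_differentiation_under_integral R _ Z m f D mD r _ _ rI
  (fun h _ => integrable_Kj _ _ ht)
  (fun h z _ Dz => ddf h z Dz) G G0 iG Gub.
move=> hc.
have E : \int[m]_(z in D) partial1of2 f r z = Jint (Some i) (r *: delta_mx ord0 i + x) t0.
  by apply: eq_Rintegral => z; rewrite inE => Dz; rewrite dfE.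
rewrite E in hc.
have hc' : h^-1 *: (((fun h : R => Jint None (h *: delta_mx ord0 i + x) t0) \o shift r) (h *: 1)
   - Jint None (r *: delta_mx ord0 i + x) t0) @[h --> 0^'] -->
   Jint (Some i) (r *: delta_mx ord0 i + x) t0.
  under eq_cvg => h do rewrite /= /GRing.scale/= mulr1.
  exact: hc.
apply: DeriveDef; first by apply/cvg_ex; eexists; exact: hc'.
by apply/cvg_lim.
Qed.

End parametrized.

(** * The majorant and the heat flow of the datum *)

Section majorant.
Context {R : realType} {n : nat} (phi : 'rV[R]_n -> R).
Local Notation cn := (@cn R n).
Hypothesis iphi : (leb n).-integrable setT (EFin \o phi).
Implicit Types (x y : 'rV[R]_n) (s t : R) (j : option 'I_n).

Definition mass : R := \int[leb n]_y `|phi y|.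

(* Pointwise majorant of the solution: the heat flow of [|phi|] at double speed. *)
Definition w : 'rV[R]_n -> R -> R :=
  locked (fun x t => \int[leb n]_y (Gk (x - y) (2 * t) * `|phi y|)).

Lemma measurable_phi : measurable_fun setT phi.
Proof. by apply/measurable_EFinP; exact: measurable_int iphi. Qed.

Lemma measurable_absphi : measurable_fun setT (fun y => `|phi y|).
Proof. exact: measurableT_comp measurable_phi. Qed.

Lemma iabsphi : (leb n).-integrable setT (EFin \o (fun y => `|phi y|)).
Proof. exact: integrable_norm. Qed.

Lemma massE : mass%:E = (\int[leb n]_y (`|phi y|)%:E)%E.
Proof. by rewrite /mass /Rintegral fineK//; exact: integrable_fin_num iabsphi. Qed.

Lemma mass_ge0 : 0 <= mass.
Proof. exact: Rintegral_ge0. Qed.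

Lemma measurable_GkN x t : 0 < t -> measurable_fun setT (fun y : 'rV[R]_n => Gk (x - y) t).
Proof.
move=> t0; rewrite (_ : (fun y => _) = (fun y => Gk (y - x) t)); first exact: measurable_Gk.
by apply/funext => y; rewrite GkC.
Qed.

Lemma integrable_w x t : 0 < t ->
  (leb n).-integrable setT (fun y => (Gk (x - y) (2 * t) * `|phi y|)%:E).
Proof.
move=> t0; have t2 : 0 < 2 * t by rewrite mulr_gt0.
have := @integrableZl _ _ _ (leb n) setT measurableT (gam n (2 * t)) _ iabsphi.
apply: le_integrable => //.
  by apply/measurable_EFinP; apply: measurable_funM; [exact: measurable_GkN|exact: measurable_absphi].
move=> y _ /=; rewrite lee_fin; apply: le_trans (ler_norm _).
rewrite normrM normr_id ger0_norm ?Gk_ge0//; apply: ler_wpM2r => //.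
exact: Gk_le_gam.
Qed.

Lemma wE x t : 0 < t -> (w x t)%:E = (\int[leb n]_y (Gk (x - y) (2 * t) * `|phi y|)%:E)%E.
Proof.
by move=> t0; rewrite /w -lock /Rintegral fineK//; exact: integrable_fin_num (integrable_w x t0).
Qed.

Lemma w_ge0 x t : 0 <= w x t.
Proof. by rewrite /w -lock; apply: Rintegral_ge0 => y _; rewrite mulr_ge0 ?Gk_ge0. Qed.

Lemma w_le_gam x t : 0 < t -> w x t <= gam n (2 * t) * mass.
Proof.
move=> t0; have t2 : 0 < 2 * t by rewrite mulr_gt0.
rewrite -lee_fin wE// EFinM massE -ge0_integralZl//.
- apply: ge0_le_integral => //.
  + by move=> y _; rewrite lee_fin mulr_ge0 ?Gk_ge0.
  + by apply/measurable_EFinP; apply: measurable_funM; [exact: measurable_GkN|exact: measurable_absphi].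
  + apply: measurable_funeM; apply/measurable_EFinP; exact: measurable_absphi.
  + by move=> y _; rewrite -EFinM lee_fin; apply: ler_wpM2r => //; exact: Gk_le_gam.
- by apply/measurable_EFinP; exact: measurable_absphi.
- by rewrite lee_fin ltW// gam_gt0.
Qed.

Lemma continuous_w x t : 0 < t -> {for (x, t), continuous (fun p => w p.1 p.2)}.
Proof.
move=> t0; have t2 : 0 < 2 * t by rewrite mulr_gt0.
have h := @Jint_continuous R n _ _ (leb n) setT id (fun=> 0) (fun y => `|phi y|) (2 * t) t
  measurableT (@measurable_id _ _ _) (@measurable_cst _ _ _ _ _ _) iabsphi t0.
have {}h := h _ None x.
have hh : forall z : 'rV[R]_n, [set: 'rV[R]_n] z -> 0 + t <= 2 * t by move=> _ _; lra.
have c := h hh.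
pose g := fun p : 'rV[R]_n * R => (p.1, 2 * p.2).
have cg : {for (x, t), continuous g}.
  apply: continuous_pair; first exact: cvg_fst.
  by apply: continuousM; [exact: cst_continuous|exact: cvg_snd].
have -> : (fun p => w p.1 p.2) = (fun p => Jint (leb n) setT id (fun=> 0) (fun y => `|phi y|) None p.1 p.2) \o g.
  apply/funext => p /=; rewrite /w -lock /Jint; apply: eq_Rintegral => y _.
  by rewrite KjE subr0.
exact: continuous_comp cg c.
Qed.

Lemma measurable_w t : 0 < t -> measurable_fun setT (fun x => w x t).
Proof.
move=> t0; apply: continuous_on_measurable_rV; first exact: openT.
move=> x _; apply: (@continuous_comp _ _ _ (fun x : 'rV[R]_n => (x, t))
  (fun z : 'rV[R]_n * R => w z.1 z.2)); last exact: continuous_w.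
by apply: continuous_pair; [exact: cvg_id|exact: cst_continuous].
Qed.

Lemma measurable_Gk_diff t : 0 < t ->
  measurable_fun setT (fun z : 'rV[R]_n * 'rV[R]_n => Gk (z.1 - z.2) t).
Proof.
move=> t0.
apply: (@continuous_on_measurable _ _ ('rV[R]_n * 'rV[R]_n)%type ('rV[R]_n * 'rV[R]_n)%type
  id setT (fun z => Gk (z.1 - z.2) t)).
- by move=> U; exact: open_measurable_rVrV.
- exact: openT.
- move=> z _; apply: (@continuous_comp _ _ _ (fun z : 'rV[R]_n * 'rV[R]_n => (z.1 - z.2, t))
    (fun z : 'rV[R]_n * R => Gk z.1 z.2)); last exact: continuous_Gk.
  apply: continuous_pair; last exact: cst_continuous.
  by apply: continuousB; [exact: cvg_fst|exact: cvg_snd].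
Qed.

(** Tonelli, arranged so that all the dependence on [g] sits in an integral against the kernel: g =
    1 gives the mass, a kernel gives the semigroup law, a power weight gives the moments. *)
Lemma integral_wM (g : 'rV[R]_n -> R) t : 0 < t -> measurable_fun setT g ->
  (forall x, 0 <= g x) ->
  (\int[leb n]_x (g x * w x t)%:E =
   \int[leb n]_y ((\int[leb n]_x (g x * Gk (x - y) (2 * t))%:E) * `|phi y|%:E))%E.
Proof.
move=> t0 mg g0; have t2 : 0 < 2 * t by rewrite mulr_gt0.
have m1 x : measurable_fun setT (fun y => (Gk (x - y) (2 * t) * `|phi y|)%:E).
  by apply/measurable_EFinP; apply: measurable_funM; [exact: measurable_GkN|exact: measurable_absphi].
transitivity (\int[leb n]_x (\int[leb n]_y (g x * (Gk (x - y) (2 * t) * `|phi y|))%:E))%E.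
  apply: eq_integral => x _; rewrite EFinM wE// -ge0_integralZl//.
    by move=> y _; rewrite lee_fin mulr_ge0 ?Gk_ge0.
  by rewrite lee_fin.
rewrite (fubini_tonelli (fun z : 'rV[R]_n * 'rV[R]_n =>
   (g z.1 * (Gk (z.1 - z.2) (2 * t) * `|phi z.2|))%:E)); first last.
- by move=> z; rewrite lee_fin mulr_ge0// mulr_ge0// Gk_ge0.
- apply/measurable_EFinP; apply: measurable_funM; first exact: measurableT_comp mg measurable_fst.
  apply: measurable_funM; first exact: measurable_Gk_diff.
  exact: measurableT_comp measurable_absphi measurable_snd.
apply: eq_integral => y _; rewrite /= -ge0_integralZr//.
- by apply: eq_integral => x _; rewrite mulrA EFinM.
- apply/measurable_EFinP; apply: measurable_funM => //; exact: measurable_Gk.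
- by move=> x _; rewrite lee_fin mulr_ge0 ?Gk_ge0.
Qed.

Lemma integral_w t : 0 < t -> (\int[leb n]_x (w x t)%:E = mass%:E)%E.
Proof.
move=> t0; have t2 : 0 < 2 * t by rewrite mulr_gt0.
under eq_integral do rewrite -[w _ _]mul1r.
rewrite (@integral_wM (fun=> 1))// massE; apply: eq_integral => y _.
by under eq_integral do rewrite mul1r; rewrite integral_Gk// mul1e.
Qed.

(** The semigroup law holds with constant exactly one, so a bound by a multiple of [w] can be passed
    through the Duhamel formula repeatedly without loss in the kernel. *)
Lemma integral_Gk_w x s t : 0 < s -> 0 < t ->
  (\int[leb n]_z (Gk (x - z) (2 * t) * w z s)%:E = (w x (t + s))%:E)%E.
Proof.
move=> s0 t0; have s2 : 0 < 2 * s by rewrite mulr_gt0.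
have t2 : 0 < 2 * t by rewrite mulr_gt0.
rewrite (@integral_wM (fun z => Gk (x - z) (2 * t)))//.
- rewrite wE ?addr_gt0//; apply: eq_integral => y _.
  by rewrite integral_Gk_semigroup// -mulrDr EFinM.
- exact: measurable_GkN.
- by move=> z; exact: Gk_ge0.
Qed.

(** Integrated form of [Gk_time]; it is used to bound the majorant at a delayed time s - d by the
    majorant at s. *)
Lemma w_time x s t : 0 < s -> s <= t -> w x s <= (t / s) `^ (n%:R / 2) * w x t.
Proof.
move=> s0 st; have t0 := lt_le_trans s0 st.
have c0 : 0 <= (t / s) `^ (n%:R / 2) by exact: powR_ge0.
rewrite -lee_fin EFinM !wE// -ge0_integralZl//.
- apply: ge0_le_integral => //.
  + by move=> y _; rewrite lee_fin mulr_ge0 ?Gk_ge0.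
  + by apply: measurable_int (integrable_w x s0).
  + by apply: measurable_funeM; exact: measurable_int (integrable_w x t0).
  + move=> y _; rewrite -EFinM lee_fin mulrA; apply: ler_wpM2r => //.
    have h : (s / t) `^ (n%:R / 2) * Gk (x - y) (2 * s) <= Gk (x - y) (2 * t).
      have := @Gk_time R n (x - y) (2 * s) (2 * t).
      rewrite -mulf_div divff ?pnatr_eq0// mul1r; apply; first by rewrite mulr_gt0.
      by rewrite ler_pM2l.
    apply: le_trans (ler_wpM2l c0 h); rewrite mulrA -powRM ?divr_ge0 ?(ltW s0) ?(ltW t0)//.
    have -> : t / s * (s / t) = 1 by field; rewrite !gt_eqF.
    by rewrite powR1 mul1r.
- by apply: measurable_int (integrable_w x t0).
- by move=> y _; rewrite lee_fin mulr_ge0 ?Gk_ge0.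
Qed.

Definition heat_flow j : 'rV[R]_n -> R -> R :=
  locked (fun x t => \int[leb n]_y (Kj j (x - y) t * phi y)).

Lemma heat_flowE j x t : heat_flow j x t = Jint (leb n) setT id (fun=> 0) phi j x t.
Proof.
by rewrite /heat_flow -lock /Jint; apply: eq_Rintegral => y _; rewrite subr0.
Qed.

Lemma heat_flowE2 : heat_flow = fun j x t => Jint (leb n) setT id (fun=> 0) phi j x t.
Proof. by apply/funext => j; apply/funext => x; apply/funext => t; exact: heat_flowE. Qed.

Lemma continuous_heat_flow j x t : 0 < t -> {for (x, t), continuous (fun p => heat_flow j p.1 p.2)}.
Proof.
move=> t0; rewrite heat_flowE2.
apply: (@Jint_continuous R n _ _ (leb n) setT id (fun=> 0) phi t t) => //.
by move=> z _; rewrite add0r.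
Qed.

Lemma is_derive_heat_flow i x t : 0 < t -> is_derive x (delta_mx ord0 i) (fun y => heat_flow None y t) (heat_flow (Some i) x t).
Proof.
move=> t0; apply: is_derive_along; rewrite heat_flowE2.
have := @is_derive_Jint R n _ _ (leb n) setT id (fun=> 0) phi t t measurableT
  (@measurable_id _ _ _) (@measurable_cst _ _ _ _ _ _) iphi t0.
move=> h; have {}h := h (fun z _ => _) i x 0.
have tt : 0 + t <= t by rewrite add0r.
by have := h tt; rewrite [in X in is_derive _ _ _ X]scale0r [in X in is_derive _ _ _ X]add0r.
Qed.

Lemma heat_flow_integrable j x t : 0 < t ->
  (leb n).-integrable setT (fun y => (Kj j (x - y) t * phi y)%:E).
Proof.
move=> t0; have := @integrable_Kj R n _ _ (leb n) setT id (fun=> 0) phi t measurableT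
  (@measurable_id _ _ _) (@measurable_cst _ _ _ _ _ _) iphi t0 j x t.
move=> h; have {}h := h (fun z _ => _).
have tt : 0 + t / 2 <= t by lra.
have := h tt; by apply: eq_integrable => // y _; rewrite subr0.
Qed.

Lemma heat_flow_abs_le j x t : 0 < t ->
  ((sg j t)%:E * \int[leb n]_y (`|Kj j (x - y) t * phi y|)%:E <= (cn * w x t)%:E)%E.
Proof.
move=> t0; have sg0 := sg_ge0 j t; have cn0 := @cn_gt0 R n.
have mI := measurable_int _ (heat_flow_integrable j x t0).
have mI2 : measurable_fun setT (fun y => (`|Kj j (x - y) t * phi y|)%:E).
  by apply/measurable_EFinP; apply: measurableT_comp => //; exact/measurable_EFinP.
rewrite -ge0_integralZl// EFinM wE// -ge0_integralZl//.
- apply: ge0_le_integral => //.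
  + by move=> y _; rewrite mule_ge0// lee_fin.
  + exact: measurable_funeM.
  + by apply: measurable_funeM; exact: measurable_int (integrable_w x t0).
  + move=> y _; rewrite -!EFinM lee_fin normrM mulrA [leRHS]mulrA; apply: ler_wpM2r => //.
    apply: le_trans (sg_Kj_le j (x - y) t0 (lexx t)) _.
    by rewrite divff ?gt_eqF ?sqrtr_gt0// mulr1.
- by apply: measurable_int (integrable_w x t0).
- by move=> y _; rewrite lee_fin mulr_ge0 ?Gk_ge0.
- by rewrite lee_fin ltW.
Qed.

Lemma heat_flow_le j x t : 0 < t -> sg j t * `|heat_flow j x t| <= cn * w x t.
Proof.
move=> t0; rewrite -lee_fin; apply: le_trans (heat_flow_abs_le j x t0).
rewrite EFinM; apply: lee_wpmul2l; first by rewrite lee_fin sg_ge0.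
rewrite /heat_flow -lock EFin_normr_Rintegral//; last exact: heat_flow_integrable.
by apply: le_abse_integral => //; exact: measurable_int (heat_flow_integrable j x t0).
Qed.

End majorant.

(** * Duhamel integrals *)

Section space_time_measure.
Context {R : realType} (n : nat).
Local Notation TR := (measurableTypeR R).

Lemma sigma_finite_prod d1 d2 (T1 : measurableType d1) (T2 : measurableType d2)
    (m1 : {sigma_finite_measure set T1 -> \bar R}) (m2 : {sigma_finite_measure set T2 -> \bar R}) :
  sigma_finite setT (m1 \x m2)%E.
Proof.
have /sigma_finiteP[F [FT ndF mF]] := sigma_finiteT m1.
have /sigma_finiteP[A [AT ndA mA]] := sigma_finiteT m2.
exists (fun k => F k `*` A k).
  apply/esym/seteqP; split=> // -[x y] _.
  have [k _ Fk] : (\bigcup_k F k) x by rewrite -FT.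
  have [l _ Al] : (\bigcup_k A k) y by rewrite -AT.
  exists (maxn k l) => //; split => /=.
    by move: Fk; apply/subsetPset/ndF/leq_maxl.
  by move: Al; apply/subsetPset/ndA/leq_maxr.
move=> k; have [mFk Fk] := mF k; have [mAk Ak] := mA k; split.
  exact: measurableX.
by rewrite product_measure1E// lte_mul_pinfty// ge0_fin_numE.
Qed.

Lemma space_time_measure : exists m : {sigma_finite_measure set (TR * 'rV[R]_n)%type -> \bar R},
  (m : set _ -> \bar R) = (@lebesgue_measure R \x leb n)%E.
Proof. by apply: sigma_finite_measure_of; exact: sigma_finite_prod. Qed.

(** The product measure repackaged as sigma-finite, so that Tonelli can be applied once more to its
    product with [leb n]. *)
Definition STm : {sigma_finite_measure set (TR * 'rV[R]_n)%type -> \bar R} :=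
  sval (cid space_time_measure).

Lemma STmE : (STm : set _ -> \bar R) = (@lebesgue_measure R \x leb n)%E.
Proof. exact: svalP (cid space_time_measure). Qed.

Lemma integral_STm (H : TR * 'rV[R]_n -> \bar R) : measurable_fun setT H ->
  (forall z, 0 <= H z)%E ->
  (\int[STm]_z H z = \int[@lebesgue_measure R]_s \int[leb n]_x H (s, x))%E.
Proof. by move=> mH H0; rewrite STmE fubini_tonelli1. Qed.

Lemma integral_STm_slab (A : set TR) (H : TR * 'rV[R]_n -> \bar R) : measurable A ->
  measurable_fun (fst @^-1` A) H -> (forall z, A z.1 -> 0 <= H z)%E ->
  (\int[STm]_(z in fst @^-1` A) H z =
   \int[@lebesgue_measure R]_(s in A) \int[leb n]_x H (s, x))%E.
Proof.
move=> mA mH H0.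
have mA' : measurable (fst @^-1` A : set (TR * 'rV[R]_n)).
  by rewrite -[X in measurable X]setTI; exact: measurable_fst.
rewrite integral_mkcond integral_STm.
- rewrite [RHS]integral_mkcond; apply: eq_integral => s _.
  rewrite /patch; case: ifPn => sA.
    by apply: eq_integral => x _; rewrite mem_set//=; rewrite inE in sA.
  rewrite integral0_eq// => x _; rewrite memNset//=.
  by move=> As; move/negP: sA; apply; exact/mem_set.
- exact/(measurable_restrictT _ mA').
- by move=> z; apply: erestrict_ge0 => //.
Qed.

Lemma measurable_slab (A : set TR) : measurable A ->
  measurable (fst @^-1` A : set (TR * 'rV[R]_n)).
Proof. by move=> mA; rewrite -[X in measurable X]setTI; exact: measurable_fst. Qed.

End space_time_measure.

Section duhamel.
Context {R : realType} {n : nat} (phi : 'rV[R]_n -> R).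
Local Notation TR := (measurableTypeR R).
Local Notation cn := (@cn R n).
Local Notation w := (w phi).
Local Notation mass := (mass phi).
Local Notation lebR := (@lebesgue_measure R).
Hypothesis iphi : (leb n).-integrable setT (EFin \o phi).
Variables (theta : R -> R) (a Cth : R).
Hypothesis theta_ge0 : forall s : R, 0 <= theta s.
Hypothesis theta_eq0 : forall s : R, s <= 0 -> theta s = 0.
Hypothesis itheta : lebR.-integrable setT (EFin \o theta).
Hypothesis Cth0 : 0 <= Cth.
Hypothesis theta_near : forall t0 t : R, 0 < t -> t / 2 <= t0 -> t0 < t ->
  (\int[lebR]_(s in `]t0, t[) (Num.sqrt t / Num.sqrt (t - s) * theta s)%:E <=
   (Cth * Num.sqrt (t - t0) * (1 + Num.sqrt (t / 2)) `^ (- (1 + 2 * a)))%:E)%E.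
Implicit Types (x y : 'rV[R]_n) (s t : R) (j : option 'I_n).

Definition bd (z : TR * 'rV[R]_n) : R := theta z.1 * w z.2 z.1.

Lemma measurable_theta : measurable_fun setT (theta : TR -> R).
Proof. by apply/measurable_EFinP; exact: measurable_int itheta. Qed.

Lemma bd_ge0 z : 0 <= bd z.
Proof. by rewrite mulr_ge0// w_ge0. Qed.

Lemma measurable_w_st : measurable_fun [set z : TR * 'rV[R]_n | 0 < z.1 :> R] (fun z => w z.2 z.1).
Proof.
apply: (@continuous_on_measurable_RrV R n [set z | 0 < z.1] (fun z => w z.2 z.1)).
  rewrite (_ : [set z | _] = fst @^-1` [set s : R | 0 < s])//.
  apply: open_comp; last exact: open_gt.
  by move=> p _; exact: cvg_fst.
move=> [s x] /= s0; apply: (@continuous_comp _ _ _ (fun z : R * 'rV[R]_n => (z.2, z.1))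
  (fun z : 'rV[R]_n * R => w z.1 z.2)); last exact: continuous_w.
by apply: continuous_pair; [exact: cvg_snd|exact: cvg_fst].
Qed.

Lemma measurable_pos : measurable [set z : TR * 'rV[R]_n | 0 < z.1 :> R].
Proof.
apply: (@measurable_slab R n [set s : R | 0 < s]).
by rewrite -set_itvoy; exact: measurable_itv.
Qed.

(** Measurability of [w] in space-time comes from continuity at positive times; at the other times
    the factor [theta] vanishes. *)
Lemma measurable_bd : measurable_fun setT bd.
Proof.
have -> : bd = (fun z => theta z.1 *
    ((fun z : TR * 'rV[R]_n => w z.2 z.1) \_ [set z : TR * 'rV[R]_n | 0 < z.1 :> R]) z).
  apply/funext => z; rewrite /bd /patch; case: ifPn => // z0.
  rewrite theta_eq0 ?mul0r// leNgt; apply/negP => z1; move: z0; rewrite notin_setE.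
  exact.
apply: measurable_funM; first exact: measurableT_comp measurable_theta measurable_fst.
apply/(measurable_restrictT _ measurable_pos).
exact: measurable_w_st.
Qed.

Lemma integral_bd (A : set TR) : measurable A ->
  (\int[STm n]_(z in fst @^-1` A) (bd z)%:E =
   \int[lebR]_(s in A) (theta s)%:E * mass%:E)%E.
Proof.
move=> mA; rewrite integral_STm_slab//.
- rewrite -ge0_integralZr//.
  + apply: eq_integral => s _; rewrite /bd /=.
    have [s0|s0] := ltP 0 s; last first.
      rewrite theta_eq0// mul0e; rewrite integral0_eq// => x _.
      by rewrite mul0r.
    under eq_integral do rewrite EFinM.
    rewrite ge0_integralZl//.
    * by rewrite integral_w.
    * by apply/measurable_EFinP; exact: measurable_w.
    * by move=> x _; rewrite lee_fin w_ge0.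
    * by rewrite lee_fin.
  + apply/measurable_EFinP; exact: measurable_funTS measurable_theta.
  + by move=> s _; rewrite lee_fin.
  + by rewrite lee_fin mass_ge0.
- apply/measurable_EFinP; exact: measurable_funTS measurable_bd.
- by move=> z _; rewrite lee_fin bd_ge0.
Qed.

Lemma integrable_bd : (STm n).-integrable setT (EFin \o bd).
Proof.
apply/integrableP; split; first by apply/measurable_EFinP; exact: measurable_bd.
have -> : (\int[STm n]_z `|(EFin \o bd) z| = \int[STm n]_(z in fst @^-1` setT) (bd z)%:E)%E.
  by rewrite preimage_setT; apply: eq_integral => z _; rewrite /= ger0_norm ?bd_ge0.
rewrite integral_bd// lte_mul_pinfty//.
- by apply: integral_ge0 => s _; rewrite lee_fin.
- exact: integrable_fin_num itheta.
- by rewrite ltry.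
Qed.

(** Integrating in space first turns the convolution with w(s) into w(t), which does not depend on s
    any more; what remains is a scalar integral of [kappa]. *)
Lemma integral_slab_le (H : TR * 'rV[R]_n -> R) (kappa : R -> R) x t0 t :
  0 <= t0 -> t0 < t ->
  measurable_fun (fst @^-1` `]t0, t[%classic : set (TR * 'rV[R]_n)) H ->
  (forall z, t0 < z.1 < t -> 0 <= H z) ->
  measurable_fun (`]t0, t[%classic : set TR) kappa -> (forall s, t0 < s < t -> 0 <= kappa s) ->
  (forall s y, t0 < s < t -> H (s, y) <= kappa s * (Gk (x - y) (2 * (t - s)) * w y s)) ->
  (\int[STm n]_(z in fst @^-1` `]t0, t[%classic) (H z)%:E <=
   \int[lebR]_(s in `]t0, t[) (kappa s)%:E * (w x t)%:E)%E.
Proof.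
move=> t00 t0t mH H0 mk k0 Hk.
have inI s : (`]t0, t[%classic : set TR) s = (t0 < s < t) :> Prop by rewrite /= in_itv.
rewrite integral_STm_slab//; last exact/measurable_EFinP.
rewrite -ge0_integralZr//; [|exact/measurable_EFinP|by rewrite lee_fin w_ge0].
have mHr : measurable_fun setT ((EFin \o H) \_ (fst @^-1` `]t0, t[%classic : set (TR * 'rV[R]_n))).
  have mSl : measurable (fst @^-1` `]t0, t[%classic : set (TR * 'rV[R]_n)).
    by apply: measurable_slab; exact: measurable_itv.
  apply/(measurable_restrictT _ mSl).
  exact/measurable_EFinP.
have Hr0 z : (0 <= ((EFin \o H) \_ (fst @^-1` `]t0, t[%classic : set (TR * 'rV[R]_n))) z)%E.
  by apply: erestrict_ge0 => {}z /=; rewrite in_itv/= lee_fin; exact: H0.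
have mF := measurable_fun_fubini_tonelli_F (m2 := leb n) _ mHr Hr0.
apply: ge0_le_integral => //.
- by move=> s; rewrite inI => st; apply: integral_ge0 => y _; rewrite lee_fin H0.
- apply: (eq_measurable_fun _ _ (measurable_funTS mF)) => s.
  rewrite inE inI => st; apply: eq_integral => y _.
  by rewrite /patch mem_set//= in_itv.
- by apply: emeasurable_funM => //; exact/measurable_EFinP.
- move=> s; rewrite inI => st.
  have /andP[st0 stt] := st; have s0 : 0 < s := le_lt_trans t00 st0.
  have ts0 : 0 < t - s by rewrite subr_gt0.
  have mHs : measurable_fun setT (fun y => (H (s, y))%:E).
    apply: (eq_measurable_fun _ _ (measurableT_comp mHr (pair1_measurable s))) => y _.
    by rewrite /= /patch mem_set//= in_itv.
  have mGw : measurable_fun setT (fun y => (Gk (x - y) (2 * (t - s)) * w y s)%:E).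
    apply/measurable_EFinP; apply: measurable_funM; last exact: measurable_w.
    by apply: measurable_GkN; rewrite mulr_gt0.
  have -> : w x t = w x (t - s + s) by rewrite subrK.
  rewrite -(integral_Gk_w iphi x s0 ts0) -ge0_integralZl//.
  + apply: ge0_le_integral => //.
    * by move=> y _; rewrite lee_fin H0.
    * exact: measurable_funeM.
    * by move=> y _; rewrite -EFinM lee_fin; exact: Hk.
  + by move=> y _; rewrite lee_fin mulr_ge0 ?Gk_ge0 ?w_ge0.
  + by rewrite lee_fin k0.
Qed.

Definition source (F : TR * 'rV[R]_n -> R) : Prop :=
  measurable_fun setT F /\ forall z, `|F z| <= bd z.

(** The scalar Volterra integral to which every Duhamel estimate reduces. It is kept extended-real,
    so that estimates can be stated before its finiteness is known. *)
Definition Ith t0 t : \bar R :=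
  (\int[lebR]_(s in `]t0, t[) (Num.sqrt t / Num.sqrt (t - s) * theta s)%:E)%E.

Lemma integrable_source F : source F -> (STm n).-integrable setT (EFin \o F).
Proof.
move=> [mF Fb]; have := integrable_bd; apply: le_integrable => //.
  exact/measurable_EFinP.
by move=> z _; rewrite /= lee_fin (le_trans (Fb z))// ler_norm.
Qed.

Lemma measurable_KF F j x t (A : set R) : measurable (A : set TR) -> measurable_fun setT F ->
  (forall s, A s -> s < t) ->
  measurable_fun (fst @^-1` A : set (TR * 'rV[R]_n))
    (fun z => Kj j (x - z.2) (t - z.1) * F z).
Proof.
move=> mA mF At; apply: measurable_funM; last exact: measurable_funTS.
apply: (@measurable_Kj_shift R n _ _ snd fst measurable_snd measurable_fst j x t).
  exact: measurable_slab.
by move=> z; exact: At.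
Qed.

Lemma measurable_ith_kernel t0 t : measurable_fun (`]t0, t[%classic : set TR)
  (fun s : R => Num.sqrt t / Num.sqrt (t - s) * theta s).
Proof.
apply: measurable_funM; last exact: measurable_funTS measurable_theta.
apply: measurable_funM; first exact: measurable_cst.
apply: open_continuous_measurable_fun; first exact: interval_open.
by move=> s; rewrite inE/= in_itv/= => /andP[_ ?]; exact: continuous_sqrt_shift.
Qed.

Lemma source_slab_le F j x t0 t : source F -> 0 <= t0 -> t0 < t ->
  ((sg j t)%:E * \int[STm n]_(z in fst @^-1` `]t0, t[%classic)
      (`|Kj j (x - z.2) (t - z.1) * F z|)%:E <= cn%:E * Ith t0 t * (w x t)%:E)%E.
Proof.
move=> [mF Fb] t00 t0t; have cn0 := @cn_gt0 R n.
have mK : measurable_fun (fst @^-1` `]t0, t[%classic : set (TR * 'rV[R]_n))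
    (fun z => `|Kj j (x - z.2) (t - z.1) * F z|).
  apply: measurableT_comp => //; apply: measurable_KF => // s /=.
  by rewrite in_itv/= => /andP[].
rewrite -ge0_integralZl//; first last.
- by rewrite lee_fin sg_ge0.
- exact/measurable_EFinP.
- exact: measurable_slab.
have -> : (cn%:E * Ith t0 t = \int[lebR]_(s in `]t0, t[)
   (cn * (Num.sqrt t / Num.sqrt (t - s) * theta s))%:E)%E.
  rewrite /Ith -ge0_integralZl//.
  - by apply/measurable_EFinP; exact: measurable_ith_kernel.
  - by move=> s _; rewrite lee_fin mulr_ge0 ?divr_ge0.
  - by rewrite lee_fin ltW.
under eq_integral do rewrite -EFinM.
apply: integral_slab_le => //.
- by apply: measurable_funM => //; exact: measurable_cst.
- by move=> z _; rewrite mulr_ge0 ?sg_ge0.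
- by apply: measurable_funM; [exact: measurable_cst|exact: measurable_ith_kernel].
- by move=> s _; rewrite mulr_ge0 ?(ltW cn0)// mulr_ge0 ?divr_ge0.
- move=> s y /andP[s0 st] /=.
  have ts0 : 0 < t - s by rewrite subr_gt0.
  have tst : t - s <= t by rewrite gerBl ltW// (le_lt_trans t00).
  have h1 := sg_Kj_le j (x - y) ts0 tst; have h2 := Fb (s, y).
  rewrite normrM mulrA.
  have -> : cn * (Num.sqrt t / Num.sqrt (t - s) * theta s) * (Gk (x - y) (2 * (t - s)) * w y s) =
     (cn * (Num.sqrt t / Num.sqrt (t - s)) * Gk (x - y) (2 * (t - s))) * (theta s * w y s) by ring.
  by apply: ler_pM => //; rewrite mulr_ge0 ?sg_ge0.
Qed.

Lemma Ith_ge0 t0 t : (0 <= Ith t0 t)%E.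
Proof. by apply: integral_ge0 => s _; rewrite lee_fin mulr_ge0 ?divr_ge0. Qed.

(** Up to t / 2 the kernel is at most 2 and [theta] is integrable; beyond t / 2 the hypothesis
    [theta_near] applies. *)
Lemma Ith_lty t : 0 < t -> (Ith 0 t < +oo)%E.
Proof.
move=> t0; have t20 : 0 < t / 2 by rewrite divr_gt0.
have t2t : t / 2 < t by rewrite ltr_pdivrMr// ltr_pMr// ltr1n.
have spl : `]0%R, t[%classic = `]0%R, (t / 2)]%classic `|` `](t / 2), t[%classic :> set R.
  by rewrite -itv_bndbnd_setU ?bnd_simp// ltW.
rewrite /Ith spl ge0_integral_setU//=.
- apply: lte_add_pinfty; last first.
    by apply: le_lt_trans (theta_near t0 (lexx _) t2t) _; rewrite ltry.
  have far : (\int[lebR]_(s in `]0%R, (t / 2)%R]) (Num.sqrt t / Num.sqrt (t - s) * theta s)%:E <=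
      \int[lebR]_(s in `]0%R, (t / 2)%R]) (2%:E * (theta s)%:E))%E.
    apply: ge0_le_integral => //=.
    + by move=> s _; rewrite lee_fin mulr_ge0 ?divr_ge0.
    + apply/measurable_EFinP.
      apply: (@measurable_funS _ _ TR R `]0%R, t[%classic); first exact: measurable_itv.
        by rewrite spl; exact: subsetUl.
      exact: measurable_ith_kernel.
    + apply: measurable_funeM; apply/measurable_EFinP; exact: measurable_funTS measurable_theta.
    + move=> s; rewrite in_itv/= => /andP[s0 s1]; rewrite -EFinM lee_fin; apply: ler_wpM2r => //.
      rewrite ler_pdivrMr ?sqrtr_gt0; last by lra.
      rewrite -[leRHS]ger0_norm ?mulr_ge0// -sqrtr_sqr ler_wsqrtr//.
      by rewrite exprMn sqr_sqrtr; lra.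
  apply: le_lt_trans far _; rewrite ge0_integralZl//=; last 2 first.
  + apply/measurable_EFinP; exact: measurable_funTS measurable_theta.
  + by move=> s _; rewrite lee_fin.
  apply: lte_mul_pinfty => //.
  apply: (@le_lt_trans _ _ (\int[lebR]_s (theta s)%:E)%E).
    apply: ge0_subset_integral => //=; first exact: measurable_int itheta.
    by move=> s _; rewrite lee_fin.
  by rewrite ltey_eq (integrable_fin_num _ itheta).
- by rewrite -spl; apply/measurable_EFinP; exact: measurable_ith_kernel.
- by move=> s _; rewrite lee_fin mulr_ge0 ?divr_ge0.
- rewrite disj_set2E; apply/eqP; apply/seteqP; split => // s [] /=.
  by rewrite !in_itv/= => /andP[_ h1] /andP[h2 _]; move: (lt_le_trans h2 h1); rewrite ltxx.
Qed.

(** Read off from the weighted estimate: a positive weight times an infinite integral could not stay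
    below the finite right side. *)
Lemma integrable_KF F j x t : source F -> 0 < t ->
  (STm n).-integrable (fst @^-1` `]0%R, t[%classic)
    (fun z => (Kj j (x - z.2) (t - z.1) * F z)%:E).
Proof.
move=> sF t0; have sg0 := sg_gt0 j t0; apply/integrableP; split.
  apply/measurable_EFinP; apply: measurable_KF => //; first exact: sF.1.
  by move=> s /=; rewrite in_itv/= => /andP[].
have := source_slab_le j x sF (lexx 0) t0.
set I := (\int[_]_(_ in _) _)%E; move=> h; rewrite ltNge leye_eq; apply/negP => /eqP Ioo.
move: h; rewrite Ioo gt0_muley ?lte_fin// leye_eq => /eqP h.
have : (cn%:E * Ith 0 t * (w x t)%:E < +oo)%E.
  apply: lte_mul_pinfty; rewrite ?ltry//.
    by rewrite mule_ge0 ?Ith_ge0// lee_fin ltW// cn_gt0.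
  rewrite fin_numM// ge0_fin_numE ?Ith_ge0//; exact: Ith_lty.
by rewrite h ltxx.
Qed.

Definition slab (A : set R) : set (TR * 'rV[R]_n) := fst @^-1` A.

Lemma measurable_slab_itv (i : interval R) : measurable (slab [set` i]).
Proof. by apply: measurable_slab; exact: measurable_itv. Qed.

Definition duhamel F j x t : R := Jint (STm n) (slab `]0, t[) snd fst F j x t.

Definition duhamel_far F t1 j x t : R := Jint (STm n) (slab `]0, t1]) snd fst F j x t.

Definition duhamel_near F t1 j x t : R := Jint (STm n) (slab `]t1, t[) snd fst F j x t.

Lemma duhamel_split F t1 j x t : source F -> 0 <= t1 -> t1 < t ->
  duhamel F j x t = duhamel_far F t1 j x t + duhamel_near F t1 j x t.
Proof.
move=> sF t10 t1t; have t0 := le_lt_trans t10 t1t.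
have E : slab `]0, t[ = slab `]0, t1] `|` slab `]t1, t[.
  by rewrite /slab -preimage_setU -itv_bndbnd_setU ?bnd_simp.
have iK := integrable_KF j x sF t0.
rewrite /duhamel /Jint E Rintegral_setU//; [exact: measurable_slab_itv|exact: measurable_slab_itv| |].
  by rewrite -E.
rewrite disj_set2E; apply/eqP; apply/seteqP; split => // z [] /=.
by rewrite /slab /= !in_itv/= => /andP[_ h1] /andP[h2 _]; move: (lt_le_trans h2 h1); rewrite ltxx.
Qed.

Lemma duhamel_near_Ith F t1 j x t : source F -> 0 <= t1 -> t1 < t -> (Ith t1 t < +oo)%E ->
  ((sg j t * `|duhamel_near F t1 j x t|)%:E <= cn%:E * Ith t1 t * (w x t)%:E)%E.
Proof.
move=> sF t10 t1t Ioo.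
have h := source_slab_le j x sF t10 t1t; have sg0 := sg_gt0 j (le_lt_trans t10 t1t).
rewrite EFinM; apply: le_trans h; apply: lee_wpmul2l; first by rewrite lee_fin ltW.
apply: norm_Rintegral_le => //; first exact: measurable_slab_itv.
  by apply: measurable_KF => //; [exact: sF.1|move=> s /=; rewrite in_itv/= => /andP[]].
rewrite /slab.
have iK := integrable_KF j x sF (le_lt_trans t10 t1t).
have /integrableP[mK ] := iK.
apply: le_lt_trans; apply: ge0_subset_integral => //.
- exact: measurable_slab_itv.
- exact: measurable_slab_itv.
- apply/measurable_EFinP; apply: measurableT_comp => //; exact/measurable_EFinP.
- move=> z /=; rewrite !in_itv/= => /andP[h1 ->]; by rewrite (le_lt_trans t10 h1).
Qed.

Lemma duhamel_le F j x t : source F -> 0 < t ->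
  ((sg j t * `|duhamel F j x t|)%:E <= cn%:E * Ith 0 t * (w x t)%:E)%E.
Proof. by move=> sF t0; apply: (@duhamel_near_Ith F 0) => //; exact: Ith_lty. Qed.

Lemma duhamel_near_le F t1 j x t : source F -> 0 < t -> t / 2 <= t1 -> t1 < t ->
  sg j t * `|duhamel_near F t1 j x t| <=
  cn * (Cth * Num.sqrt (t - t1) * (1 + Num.sqrt (t / 2)) `^ (- (1 + 2 * a))) * w x t.
Proof.
move=> sF t0 tt1 t1t; have h := theta_near t0 tt1 t1t.
have t10 : 0 <= t1 by lra.
rewrite -lee_fin; apply: le_trans (duhamel_near_Ith j x sF t10 t1t _) _.
  by apply: le_lt_trans h _; rewrite ltry.
rewrite !EFinM; apply: lee_wpmul2r; first by rewrite lee_fin w_ge0.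
by apply: lee_wpmul2l; [rewrite lee_fin ltW// cn_gt0|rewrite -!EFinM].
Qed.

Hypothesis a0 : 0 < a.

Lemma duhamel_near_le1 F t1 j x t : source F -> 0 < t -> t / 2 <= t1 -> t1 < t ->
  sg j t * `|duhamel_near F t1 j x t| <= cn * Cth * w x t * Num.sqrt (t - t1).
Proof.
move=> sF t0 tt1 t1t; apply: le_trans (duhamel_near_le j x sF t0 tt1 t1t) _.
have h : (1 + Num.sqrt (t / 2)) `^ (- (1 + 2 * a)) <= 1.
  have h1 : 1 <= 1 + Num.sqrt (t / 2) by rewrite lerDl.
  have h2 : - (1 + 2 * a) <= 0 by rewrite oppr_le0 addr_ge0// mulr_ge0// ltW.
  by have := ler_powR h1 h2; rewrite powRr0.
have -> : cn * Cth * w x t * Num.sqrt (t - t1) = cn * (Cth * Num.sqrt (t - t1) * 1) * w x t by ring.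
apply: ler_wpM2r; first exact: w_ge0.
apply: ler_wpM2l; first by rewrite ltW// cn_gt0.
by apply: ler_wpM2l => //; rewrite mulr_ge0.
Qed.

Lemma source_bd : source bd.
Proof. by split; [exact: measurable_bd|move=> z; rewrite ger0_norm ?bd_ge0]. Qed.

Lemma far_sst t1 eta t : t1 + eta <= t ->
  forall z : TR * 'rV[R]_n, slab `]0, t1] z -> z.1 + eta <= t.
Proof. by move=> h z; rewrite /slab /= in_itv/= => /andP[_ ?]; lra. Qed.

Lemma integrable_far F t1 : source F -> (STm n).-integrable (slab `]0, t1]) (EFin \o F).
Proof.
move=> sF; apply: integrableS (integrable_source sF) => //; exact: measurable_slab_itv.
Qed.

(** The argument is 2 eta rather than eta because the length t' - t1 of the near slab reaches 2 eta
    when t' varies up to t + eta. Dividing by B + 1 covers B = 0. *)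
Lemma small_eta (B e m : R) : 0 <= B -> 0 < e -> 0 < m -> exists eta, [/\ 0 < eta, eta <= m & B * Num.sqrt (2 * eta) <= e].
Proof.
move=> B0 e0 m0; have B1 : 0 < B + 1 by lra.
exists (Num.min m ((e / (B + 1)) ^+ 2 / 2)); split.
- by rewrite lt_min m0/= divr_gt0// exprn_gt0// divr_gt0.
- by rewrite ge_min lexx.
have h : Num.sqrt (2 * Num.min m ((e / (B + 1)) ^+ 2 / 2)) <= e / (B + 1).
  rewrite -[leRHS]ger0_norm; last by rewrite divr_ge0 ?(ltW e0) ?(ltW B1).
  rewrite -sqrtr_sqr ler_wsqrtr// -ler_pdivlMl// mulrC ge_min lexx orbT//.
apply: le_trans (ler_wpM2l B0 h) _.
rewrite mulrA ler_pdivrMr// mulrC; apply: ler_wpM2l; lra.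
Qed.

(** One neighbourhood serves all sources below [bd]: the slab next to s = t contributes little by
    the bound with sqrt (t - t1), and on the rest the kernel difference is integrated against [bd]
    itself. This uniformity is what compactness needs. *)
Lemma duhamel_equicontinuous j x t (e : R) : 0 < t -> 0 < e ->
  \forall p \near (x, t), forall F, source F -> `|duhamel F j p.1 p.2 - duhamel F j x t| <= e.
Proof.
move=> t0 e0; have t20 : 0 < t / 2 by lra.
have sg2 := sg_gt0 j t20.
have cn0 := @cn_gt0 R n; have w0 := w_ge0 phi x t.
pose B := cn * Cth * (w x t + 1) / sg j (t / 2).
have B0 : 0 <= B.
  by rewrite divr_ge0 ?(ltW sg2)// !mulr_ge0 ?(ltW cn0)// addr_ge0.
have e3 : 0 < e / 3 by lra.
have t8 : 0 < t / 8 by lra.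
have [eta [eta0 etat Be]] := small_eta B0 e3 t8.
(* Since eta <= t / 8, this time lies in the second half of (0,s) for every s between t - eta / 2
   and t + eta, as the near estimate demands. *)
pose t1 := t - eta.
have t10 : 0 <= t1 by rewrite /t1; lra.
have near_bd F y s : source F -> t - eta / 2 < s -> s < t + eta -> w y s <= w x t + 1 ->
    `|duhamel_near F t1 j y s| <= e / 3.
  move=> sF s1 s2 ws; have s0 : 0 < s by lra.
  have h : s / 2 <= t1 by rewrite /t1; lra.
  have h' : t1 < s by rewrite /t1; lra.
  apply: le_trans _ Be.
  have h1 := duhamel_near_le1 j y sF s0 h h'.
  have h2 : sg j (t / 2) * `|duhamel_near F t1 j y s| <= cn * Cth * (w x t + 1) * Num.sqrt (2 * eta).
    apply: le_trans (le_trans _ h1) _.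
      apply: ler_wpM2r => //; rewrite /sg; case: (j) => // _; apply: ler_wsqrtr; lra.
    apply: ler_pM => //.
    + by rewrite !mulr_ge0 ?w_ge0 ?(ltW cn0).
    + by apply: ler_wpM2l => //; rewrite mulr_ge0// ltW.
    + by apply: ler_wsqrtr; rewrite /t1; lra.
  have -> : B * Num.sqrt (2 * eta) = (sg j (t / 2))^-1 * (cn * Cth * (w x t + 1) * Num.sqrt (2 * eta)).
    by rewrite /B; ring.
  by rewrite ler_pdivlMl.
have t1t : t1 + eta <= t by rewrite /t1; lra.
have sst := far_sst t1t.
have mS := measurable_slab_itv (`]0, t1]).
have hJ := @Jint_abs_cvg R n _ _ (STm n) (slab `]0, t1]) snd fst bd t eta mS measurable_snd
  measurable_fst (integrable_far t1 source_bd) eta0 sst j x.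
have hw := continuous_w iphi t0 (x := x).
have c2 : (fun p : 'rV[R]_n * R => p.2) @ (x, t) --> t by exact: cvg_snd.
have eta20 : 0 < eta / 2 by lra.
have tt : t - eta / 2 < t /\ t < t + eta by split; lra.
have wt : w x t <= w x t + 1 by rewrite lerDl.
near=> p => F sF.
have p2 : t - eta / 2 < p.2 /\ p.2 < t + eta.
  have h : `|t - p.2| < eta / 2.
    by near: p; move/cvgrPdist_lt : c2; apply; rewrite divr_gt0.
  by move: h; rewrite ltr_distlC => /andP[? ?]; split; lra.
have wp : w p.1 p.2 <= w x t + 1.
  have h : `|w x t - w p.1 p.2| <= 1.
    by near: p; move/cvgrPdist_le : hw; apply.
  by move: h; rewrite ler_distlC => /andP[? ?]; lra.
have far : `|duhamel_far F t1 j p.1 p.2 - duhamel_far F t1 j x t| <= e / 3.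
  have h : \int[STm n]_(z in slab `]0, t1]) (`|Kj j (p.1 - z.2) (p.2 - z.1) - Kj j (x - z.2) (t - z.1)| * `|bd z|) <= e / 3.
    have {}h : `|0 - \int[STm n]_(z in slab `]0, t1]) (`|Kj j (p.1 - z.2) (p.2 - z.1) - Kj j (x - z.2) (t - z.1)| * `|bd z|)| <= e / 3.
      by near: p; move/cvgrPdist_le : hJ; apply.
    by move: h; rewrite sub0r normrN; apply: le_trans; exact: ler_norm.
  apply: le_trans _ h.
  have ht z : slab `]0, t1] z -> z.1 + eta / 2 <= t by move=> /sst; lra.
  have hp z : slab `]0, t1] z -> z.1 + (eta / 2) / 2 <= p.2 by move=> /sst; lra.
  have ip := @integrable_Kj R n _ _ (STm n) (slab `]0, t1]) snd fst F (eta / 2) mS measurable_snd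
    measurable_fst (integrable_far t1 sF) eta20 j p.1 p.2 hp.
  have it := @integrable_Kj R n _ _ (STm n) (slab `]0, t1]) snd fst F eta mS measurable_snd
    measurable_fst (integrable_far t1 sF) eta0 j x t ht.
  have ip' := @integrable_Kj R n _ _ (STm n) (slab `]0, t1]) snd fst bd (eta / 2) mS measurable_snd
    measurable_fst (integrable_far t1 source_bd) eta20 j p.1 p.2 hp.
  have it' := @integrable_Kj R n _ _ (STm n) (slab `]0, t1]) snd fst bd eta mS measurable_snd
    measurable_fst (integrable_far t1 source_bd) eta0 j x t ht.
  rewrite /duhamel_far /Jint -RintegralB//.
  apply: le_trans (le_normr_Rintegral mS _) _.
    by have := integrableB mS ip it; apply: eq_integrable.
  apply: le_Rintegral => //.
  - have := integrable_norm (integrableB mS ip it); by apply: eq_integrable.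
  - have := integrable_norm (integrableB mS ip' it'); apply: eq_integrable => // z _ /=.
    by rewrite -mulrBl normrM.
  - move=> z _; rewrite -mulrBl normrM; apply: ler_wpM2l => //.
    by rewrite [leRHS]ger0_norm ?bd_ge0// sF.2.
have pt1 : t1 < p.2 by rewrite /t1; lra.
have tt1 : t1 < t by rewrite /t1; lra.
rewrite !(duhamel_split _ _ sF t10)//.
have n1 : `|duhamel_near F t1 j p.1 p.2| <= e / 3 by exact: (near_bd _ _ _ sF p2.1 p2.2 wp).
have n2 : `|duhamel_near F t1 j x t| <= e / 3 by exact: (near_bd _ _ _ sF tt.1 tt.2 wt).
have -> : duhamel_far F t1 j p.1 p.2 + duhamel_near F t1 j p.1 p.2 - (duhamel_far F t1 j x t + duhamel_near F t1 j x t) =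
  (duhamel_far F t1 j p.1 p.2 - duhamel_far F t1 j x t) + duhamel_near F t1 j p.1 p.2 - duhamel_near F t1 j x t by ring.
apply: le_trans (ler_normB _ _) _; apply: le_trans (lerD (ler_normD _ _) (lexx _)) _.
lra.
Unshelve. all: by end_near. Qed.

Lemma continuous_duhamel F j x t : source F -> 0 < t ->
  {for (x, t), continuous (fun p => duhamel F j p.1 p.2)}.
Proof.
move=> sF t0; apply/cvgrPdist_le => e e0.
have := @duhamel_equicontinuous j x t e t0 e0; apply: filterS => p h.
by rewrite distrC; exact: h.
Qed.

(** The singularity of the gradient kernel at s = t stands in the way of a fixed dominating
    function. The integrals over ]0, t1] are differentiable, and they approximate both the full
    integral and its formal derivative uniformly in x, because w(.,t) is bounded in space. *)
Lemma is_derive_duhamel F i x t : source F -> 0 < t ->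
  is_derive x (delta_mx ord0 i) (fun y => duhamel F None y t) (duhamel F (Some i) x t).
Proof.
move=> sF t0; apply: is_derive_along.
pose g (r : R) := duhamel F (Some i) (r *: delta_mx ord0 i + x) t.
have -> : duhamel F (Some i) x t = g 0 by rewrite /g scale0r add0r.
apply: is_derive_approx.
  apply: (@continuous_comp _ _ _ (fun r : R => (r *: delta_mx ord0 i + x, t))
    (fun p : 'rV[R]_n * R => duhamel F (Some i) p.1 p.2)); last exact: continuous_duhamel.
  apply: continuous_pair; last exact: cst_continuous.
  by apply: continuousD; [exact: scalel_continuous|exact: cst_continuous].
move=> e e0; have t8 : 0 < t / 8 by lra.
have cn0 := @cn_gt0 R n.
pose W := gam n (2 * t) * mass.
have W0 : 0 <= W by rewrite mulr_ge0 ?mass_ge0// ltW// gam_gt0// mulr_gt0.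
pose B := cn * Cth * W * (1 + (Num.sqrt t)^-1).
have B0 : 0 <= B.
  apply: mulr_ge0; last by rewrite addr_ge0// invr_ge0.
  by apply: mulr_ge0 => //; apply: mulr_ge0 => //; exact: ltW.
have [eta [eta0 etat Be]] := small_eta B0 e0 t8.
pose t1 := t - eta.
have t10 : 0 <= t1 by rewrite /t1; lra.
have tt1 : t1 < t by rewrite /t1; lra.
have near_bd j y : `|duhamel_near F t1 j y t| <= e.
  have h : t / 2 <= t1 by rewrite /t1; lra.
  have h1 := duhamel_near_le1 j y sF t0 h tt1.
  have sg0 := sg_gt0 j t0.
  apply: le_trans _ Be.
  have {}h1 : `|duhamel_near F t1 j y t| <= (sg j t)^-1 * (cn * Cth * w y t * Num.sqrt (t - t1)).
    by rewrite ler_pdivlMl.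
  apply: le_trans h1 _.
  have -> : B * Num.sqrt (2 * eta) = (1 + (Num.sqrt t)^-1) * (cn * Cth * W * Num.sqrt (2 * eta)).
    by rewrite /B; ring.
  apply: ler_pM => //.
  - by rewrite invr_ge0 ltW.
  - by rewrite !mulr_ge0 ?w_ge0 ?(ltW cn0).
  - case: (j) => [k|] /=; last by rewrite invr1 lerDl invr_ge0.
    by rewrite lerDr.
  - apply: ler_pM => //; first by rewrite !mulr_ge0 ?w_ge0 ?(ltW cn0).
      by apply: ler_wpM2l; [rewrite mulr_ge0// ltW|exact: w_le_gam].
    by apply: ler_wsqrtr; rewrite /t1; lra.
exists (fun r => duhamel_far F t1 None (r *: delta_mx ord0 i + x) t),
  (fun r => duhamel_far F t1 (Some i) (r *: delta_mx ord0 i + x) t); split.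
  move=> r; have t1t : t1 + eta <= t by rewrite /t1; lra.
  exact: (@is_derive_Jint R n _ _ (STm n) (slab `]0, t1]) snd fst F t eta (measurable_slab_itv _)
    measurable_snd measurable_fst (integrable_far t1 sF) eta0 (far_sst t1t)).
have near_eq j y : duhamel F j y t - duhamel_far F t1 j y t = duhamel_near F t1 j y t.
  by rewrite (duhamel_split _ _ sF t10)// addrC addKr.
by move=> r; rewrite /g !near_eq.
Qed.

End duhamel.

(** * Existence by delayed iteration *)

Section extraction.
Context {R : realType}.

Lemma ultra_cvg_bounded (G : set_system nat) (u : nat -> R) (B : R) : UltraFilter G ->
  (forall m, `|u m| <= B) -> exists l : R, u @ G --> l.
Proof.
move=> UG uB; have := @segment_compact R (- B) B => c.
have uG : (u @ G) `[- B, B]%classic.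
  apply: (@filterE _ G) => m; rewrite /= in_itv/= -ler_norml; exact: uB.
have [l [_ cl]] := c (u @ G) _ uG; exists l => U lU.
have [//|nU] := in_ultra_setVsetC (u @^-1` U) UG.
by have [y [/= nUy Uy]] := cl (~` U) U nU lU.
Qed.

Lemma limit_norm_le T (F : set_system T) {PF : ProperFilter F} (u : T -> R) (l B : R) :
  u @ F --> l -> (forall m, `|u m| <= B) -> `|l| <= B.
Proof.
move=> ul uB; apply/ler_addgt0Pr => e e0.
move/cvgrPdist_le : ul => /(_ e e0) /filter_ex[m hm].
have -> : l = (l - u m) + u m by rewrite subrK.
by apply: le_trans (ler_normD _ _) _; rewrite addrC lerD.
Qed.

(** An Arzela-Ascoli argument: the limit [v] is taken along an ultrafilter on the indices, which
    settles all points at once. By equicontinuity countably many points control the convergence, so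
    a genuine sequence following the ultrafilter can be selected, as dominated convergence
    requires. *)
Lemma pointwise_extraction (I : finType) (Q : countType) (X : topologicalType) (D : set X)
    (pt : Q -> X) (u : nat -> I -> X -> R) :
  (forall x B, D x -> nbhs x B -> exists c, B (pt c) /\ D (pt c)) ->
  (forall i x, D x -> exists B : R, forall m, `|u m i x| <= B) ->
  (forall i x (e : R), D x -> 0 < e -> \forall y \near x, forall m, `|u m i y - u m i x| <= e) ->
  exists (sigma : nat -> nat) (v : I -> X -> R), (forall k, (k <= sigma k)%N) /\
    forall i x, D x -> u (sigma k) i x @[k --> \oo] --> v i x.
Proof.
move=> dense bdd equi.
have [G [UG oG]] := ultraFilterLemma (F := \oo) _.
pose v i x : R := lim (u m i x @[m --> G]).
have uv i x : D x -> u m i x @[m --> G] --> v i x.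
  move=> Dx; have [B uB] := bdd i x Dx.
  have [l ul] := ultra_cvg_bounded UG uB.
  by apply/cvg_ex; exists l.
(* At stage k only the finitely many pairs with code below k are controlled, up to 1/(k+1); finitely
   many sets of an ultrafilter meet, and they meet every final segment. *)
have step k : exists m, (k <= m)%N /\ forall l : 'I_k, forall ic : I * Q, unpickle l = Some ic ->
    D (pt ic.2) -> `|v ic.1 (pt ic.2) - u m ic.1 (pt ic.2)| <= k.+1%:R^-1.
  have near1 : G (fun m => forall l : 'I_k, forall ic : I * Q, unpickle l = Some ic ->
      D (pt ic.2) -> `|v ic.1 (pt ic.2) - u m ic.1 (pt ic.2)| <= k.+1%:R^-1).
    apply: filter_forall => l; case E : (unpickle l) => [ic|]; last by apply: filterE.
    have [Dc|nDc] := pselect (D (pt ic.2)); last by apply: filterE => m ic' [<-].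
    have := uv ic.1 _ Dc; move/cvgrPdist_le => /(_ k.+1%:R^-1).
    rewrite invr_gt0 ltr0Sn => /(_ isT); apply: filterS => m hm ic' [<-] _.
    exact: hm.
  have near2 : G [set m | (k <= m)%N] by apply: oG; exists k.
  by have [m [h1 h2]] := filter_ex (filterI near1 near2); exists m.
have [sigma hs] := choice step.
exists sigma, v; split => [k|i x Dx]; first exact: (hs k).1.
apply/cvgrPdist_le => e e0; have e4 : 0 < e / 4 by rewrite divr_gt0.
have eq1 := equi i x _ Dx e4.
have [c [ec Dc]] := dense x _ Dx eq1.
have vc : `|v i (pt c) - v i x| <= e / 4.
  have h : u m i (pt c) - u m i x @[m --> G] --> v i (pt c) - v i x.
    by apply: cvgB; exact: uv.
  exact: limit_norm_le h ec.
have [N _ hN] := near_infty_natSinv_lt (PosNum e4).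
exists (maxn N (pickle (i, c)).+1) => // k /=; rewrite geq_max => /andP[Nk pk].
have hk := (hs k).2 (Ordinal pk) (i, c) (pickleK _) Dc.
have ek : k.+1%:R^-1 <= e / 4 := ltW (hN k Nk).
have em := ec (sigma k).
have -> : v i x - u (sigma k) i x = - (v i (pt c) - v i x) +
   (v i (pt c) - u (sigma k) i (pt c)) + (u (sigma k) i (pt c) - u (sigma k) i x) by ring.
apply: le_trans (ler_normD _ _) _; apply: le_trans (lerD (ler_normD _ _) (lexx _)) _.
rewrite normrN; apply: le_trans (lerD (lerD vc (le_trans hk ek)) em) _.
by have e5 : 0 < e := e0; lra.
Qed.

Lemma rational_dense n (x : 'rV[R]_n) (t : R) (B : set ('rV[R]_n * R)) : nbhs (x, t) B ->
  exists c : 'rV[rat]_n * rat, B (map_mx ratr c.1, ratr c.2).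
Proof.
move=> /nbhs_ballP[e /= e0 eB]; have [r xr] := rat_dense_rV x e0.
have /rat_in_itvoo[q] : t - e < t + e by lra.
rewrite in_itv/= => /andP[h1 h2]; exists (r, q); apply: eB; split => //=.
by rewrite /ball/= ltr_distlC h1 h2.
Qed.

End extraction.

(** * The weight that dominates the sources *)

Section weight.
Context {R : realType} (a : R) (C1 L m : R).
Hypotheses (a0 : 0 < a) (C10 : 0 < C1) (L0 : 0 < L) (m0 : 0 < m).
Implicit Types s t : R.
Local Notation lebR := (@lebesgue_measure R).
Local Notation TR := (measurableTypeR R).

(** The rate obtained for f when the function and its weighted derivatives are at most [Lamsc] times
    the majorant. Setting it to 0 at nonpositive times makes sources functions on the whole of
    space-time. *)
Definition theta s : R := if 0 < s then C1 * (hsc a s * Lamsc a L m s) else 0.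

(** A bound for the quotient of [theta] by [hsc], times the 4 of [integral_near_le]. *)
Definition Cth : R := C1 * (L * expR (m / a)) * 4.

Lemma thetaE s : 0 < s -> theta s = C1 * (hsc a s * Lamsc a L m s).
Proof. by rewrite /theta => ->. Qed.

Lemma theta_ge0 s : 0 <= theta s.
Proof.
rewrite /theta; case: ifP => // _.
by rewrite mulr_ge0 ?(ltW C10)// mulr_ge0 ?hsc_ge0 ?(ltW (Lamsc_gt0 _ _ _ L0)).
Qed.

Lemma theta_eq0 s : s <= 0 -> theta s = 0.
Proof. by rewrite leNgt /theta => /negbTE ->. Qed.

Lemma Cth_ge0 : 0 <= Cth.
Proof. by rewrite !mulr_ge0 ?expR_ge0 ?(ltW C10) ?(ltW L0). Qed.

Lemma theta_le s : theta s <= C1 * (L * expR (m / a)) * hsc a s.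
Proof.
have h0 : 0 <= C1 * (L * expR (m / a)) * hsc a s.
  by rewrite mulr_ge0 ?hsc_ge0// mulr_ge0 ?(ltW C10)// mulr_ge0 ?expR_ge0 ?(ltW L0).
rewrite /theta; case: ifP => // _.
rewrite -!mulrA; apply: ler_wpM2l; first exact: ltW.
rewrite mulrC mulrA; apply: ler_wpM2r; first exact: hsc_ge0.
exact: Lamsc_le (ltW m0).
Qed.

Lemma measurable_weight : measurable_fun setT (theta : TR -> R).
Proof.
have mP : measurable (`]0, +oo[%classic : set TR) by exact: measurable_itv.
have -> : theta = (fun s => C1 * (hsc a s * Lamsc a L m s)) \_ `]0, +oo[%classic.
  apply/funext => s; rewrite /theta /patch.
  by rewrite mem_setE/= in_itv/= andbT.
apply/(measurable_restrictT _ mP).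
apply: open_continuous_measurable_fun; first exact: interval_open.
move=> s; rewrite inE/= in_itv/= andbT => s0.
have h : {for s, continuous (fun s => C1 * (hsc a s * Lamsc a L m s))}.
  apply: continuousM; first exact: cst_continuous.
  by apply: continuousM; [exact: continuous_hsc|exact: continuous_Lamsc].
exact: h.
Qed.

Lemma integrable_weight : lebR.-integrable setT (EFin \o theta).
Proof.
have k0 : 0 <= C1 * (L * expR (m / a)).
  by rewrite mulr_ge0 ?(ltW C10)// mulr_ge0 ?expR_ge0 ?(ltW L0).
have mP : measurable (`]0, +oo[%classic : set TR) by exact: measurable_itv.
have mh : measurable_fun (`]0, +oo[%classic : set TR) (EFin \o hsc a).
  apply/measurable_EFinP; apply: open_continuous_measurable_fun; first exact: interval_open.
  by move=> s; rewrite inE/= in_itv/= andbT => s0; exact: continuous_hsc.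
apply/integrableP; split; first by apply/measurable_EFinP; exact: measurable_weight.
have -> : (\int[lebR]_s `|(EFin \o theta) s| = \int[lebR]_(s in `]0%R, +oo[) (theta s)%:E)%E.
  rewrite [RHS]integral_mkcond; apply: eq_integral => s _.
  rewrite /patch mem_setE/= in_itv/= andbT; have [s0|s0] := ltP 0 s.
    by rewrite ger0_norm ?theta_ge0.
  by rewrite theta_eq0// normr0.
apply: (@le_lt_trans _ _ (\int[lebR]_(s in `]0%R, +oo[) ((C1 * (L * expR (m / a)))%:E * (hsc a s)%:E)))%E.
  apply: ge0_le_integral => //.
  - by move=> s _; rewrite lee_fin theta_ge0.
  - apply/measurable_EFinP; exact: measurable_funTS measurable_weight.
  - exact: measurable_funeM.
  - by move=> s _; rewrite -EFinM lee_fin theta_le.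
rewrite ge0_integralZl//; last by move=> s _; rewrite lee_fin hsc_ge0.
have h := integral_hsc_le a0.
apply: lte_mul_pinfty; rewrite ?lee_fin//.
by apply: le_lt_trans h _; rewrite ltry.
Qed.

Lemma weight_near t0 t : 0 < t -> t / 2 <= t0 -> t0 < t ->
  (\int[lebR]_(s in `]t0, t[) (Num.sqrt t / Num.sqrt (t - s) * theta s)%:E <=
   (Cth * Num.sqrt (t - t0) * (1 + Num.sqrt (t / 2)) `^ (- (1 + 2 * a)))%:E)%E.
Proof.
move=> tp tt0 t0t; have h := integral_near_le a0 tp tt0 t0t.
have k0 : 0 <= C1 * (L * expR (m / a)).
  by rewrite mulr_ge0 ?(ltW C10)// mulr_ge0 ?expR_ge0 ?(ltW L0).
have t00 : 0 < t0 by lra.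
have mh : measurable_fun (`]t0, t[%classic : set TR) (fun s : R => Num.sqrt t / Num.sqrt (t - s) * hsc a s).
  apply: open_continuous_measurable_fun; first exact: interval_open.
  move=> s; rewrite inE/= in_itv/= => /andP[s1 s2].
  by apply: continuous_kernel_hsc => //; exact: lt_trans s1.
apply: (@le_trans _ _ (\int[lebR]_(s in `]t0, t[) ((C1 * (L * expR (m / a)))%:E *
    (Num.sqrt t / Num.sqrt (t - s) * hsc a s)%:E)))%E.
  apply: ge0_le_integral => //.
  - by move=> s _; rewrite lee_fin mulr_ge0 ?theta_ge0// divr_ge0.
  - apply/measurable_EFinP; apply: measurable_funM; last exact: measurable_funTS measurable_weight.
    apply: measurable_funM; first exact: measurable_cst.
    apply: open_continuous_measurable_fun; first exact: interval_open.
    by move=> s; rewrite inE/= in_itv/= => /andP[_ ?]; exact: continuous_sqrt_shift.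
  - by apply: measurable_funeM; exact/measurable_EFinP.
  - move=> s _; rewrite -EFinM lee_fin mulrCA; apply: ler_wpM2l; first by rewrite divr_ge0.
    exact: theta_le.
rewrite ge0_integralZl//; last 2 first.
- exact/measurable_EFinP.
- by move=> s _; rewrite lee_fin mulr_ge0 ?hsc_ge0// divr_ge0.
apply: le_trans (lee_wpmul2l _ h) _; first by rewrite lee_fin.
by rewrite -EFinM lee_fin /Cth le_eqVlt; apply/orP; left; apply/eqP; ring.
Qed.

Lemma Ith_weight t : 0 < t ->
  Ith theta 0 t = (C1%:E * \int[lebR]_(s in `]0%R, t[)
     (Num.sqrt t / Num.sqrt (t - s) * (hsc a s * Lamsc a L m s))%:E)%E.
Proof.
move=> t0; rewrite /Ith -ge0_integralZl//.
- apply: eq_integral => s; rewrite inE/= in_itv/= => /andP[s0 _].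
  by rewrite thetaE// -EFinM mulrCA.
- apply/measurable_EFinP; apply: open_continuous_measurable_fun; first exact: interval_open.
  by move=> s; rewrite inE/= in_itv/= => /andP[s1 s2]; exact: continuous_kernel_sc.
- move=> s _; rewrite lee_fin mulr_ge0 ?divr_ge0//.
  by rewrite mulr_ge0 ?hsc_ge0 ?(ltW (Lamsc_gt0 _ _ _ L0)).
- by rewrite lee_fin ltW.
Qed.

End weight.

Lemma continuous_row {R : realType} n (T : topologicalType) (g : 'I_n -> T -> R) (x : T) :
  (forall i, {for x, continuous (g i)}) ->
  {for x, continuous (fun y => \row_i g i y : 'rV[R]_n)}.
Proof.
move=> cg; apply/cvg_ballP => e e0.
have h : \forall y \near x, forall i, `|g i x - g i y| < e.
  apply: filter_forall => i; have := cg i; move/cvgrPdist_lt; exact.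
apply: filterS h => y hy; split => //= i j; rewrite !mxE; exact: hy.
Qed.

(** * The invariant bound, the delayed problems and their limit *)

Section fixed_point.
Context {R : realType} {n : nat} (phi : 'rV[R]_n -> R)
  (f : 'rV[R]_n -> R -> R -> 'rV[R]_n -> R) (C A L m : R).
Local Notation TR := (measurableTypeR R).
Local Notation cn := (@cn R n).
Local Notation w := (w phi).
Local Notation a := (A - 1).
Implicit Types (x y : 'rV[R]_n) (s t d : R) (j : option 'I_n) (U : option 'I_n -> 'rV[R]_n -> R -> R).
Hypothesis iphi : (leb n).-integrable setT (EFin \o phi).
Hypothesis cf : {within [set z : ('rV[R]_n * R) * (R * 'rV[R]_n) | 0 < z.1.2],
  continuous (fun z => f z.1.1 z.1.2 z.2.1 z.2.2)}.
Hypotheses (C0 : 0 < C) (A1 : 1 < A).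
Hypothesis fb : forall x t p q, 0 < t ->
  `|f x t p q| <= C * (1 + t) `^ (- A) * (`|p| + (1 + t) `^ (2^-1) * enorm q).

(** The factor 1 + 2 n adds the term in p to the Euclidean norm of a gradient whose coordinates may
    be twice the bound; the power of 2 comes from (1 + sqrt s)^2 <= 2 (1 + s). *)
Definition Cf : R := C * (1 + 2 * n%:R) * 2 `^ (A - 2^-1).

Local Notation C1 := (Cf * cn).
Local Notation theta := (theta a C1 L m).
Local Notation Lam := (Lamsc a L m).
Local Notation source := (source phi theta).

Hypotheses (L0 : 0 < L) (m0 : 0 < m).
Hypothesis supersol : forall t, 0 < t ->
  (cn%:E * (1 + C1%:E * \int[@lebesgue_measure R]_(s in `]0%R, t[)
     (Num.sqrt t / Num.sqrt (t - s) * (hsc a s * Lam s))%:E) <= (Lam t)%:E)%E.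

Lemma a_gt0 : 0 < a.
Proof. by rewrite subr_gt0. Qed.

Lemma Cf_gt0 : 0 < Cf.
Proof. by rewrite /Cf mulr_gt0 ?powR_gt0// mulr_gt0// ltr_pwDl. Qed.

Lemma C1_gt0 : 0 < C1.
Proof. by rewrite mulr_gt0 ?Cf_gt0 ?cn_gt0. Qed.

Lemma Lam_gt0 t : 0 < Lam t.
Proof. exact: Lamsc_gt0. Qed.

Let th_ge0 s : 0 <= theta s.
Proof. by apply: theta_ge0; [exact: C1_gt0|]. Qed.

Let th_eq0 := theta_eq0 a C1 L m.
Let ith := integrable_weight a_gt0 C1_gt0 L0 m0.

Let Cth0 : 0 <= Cth a C1 L m.
Proof. by apply: Cth_ge0; [exact: C1_gt0|]. Qed.

Let th_near := weight_near a_gt0 C1_gt0 L0 m0.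

(* [(1 + sqrt s)^2 <= 2 (1 + s)] turns the decay rate of [f] into the weight [hsc]. *)
Lemma decay_le_hsc s : 0 < s ->
  (1 + s) `^ (- A) * (Num.sqrt (1 + s) / Num.sqrt s) <= 2 `^ (A - 2^-1) * hsc a s.
Proof.
move=> s0; have s1 : 0 < 1 + s by lra.
have r0 := sqrt1_gt0 s.
rewrite hscE -(powR12_sqrt (ltW s1)).
have -> : (1 + s) `^ (- A) * ((1 + s) `^ 2^-1 / Num.sqrt s) =
    (Num.sqrt s)^-1 * (1 + s) `^ (- (A - 2^-1)).
  have -> : - (A - 2^-1) = - A + 2^-1 by ring.
  rewrite powRD; first by ring.
  by apply/implyP => _; rewrite gt_eqF.
rewrite mulrCA; apply: ler_wpM2l; first by rewrite invr_ge0.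
have -> : 1 + 2 * (A - 1) = 2 * (A - 2^-1) by field.
rewrite !powRN ler_pdivlMr ?powR_gt0// ler_pdivrMl ?powR_gt0// powRrM.
rewrite -powRM ?(ltW s1)//; apply: ge0_ler_powR; rewrite ?nnegrE ?powR_ge0 ?mulr_ge0 ?(ltW s1)//.
  by have A1' := A1; rewrite subr_ge0; apply: le_trans (ltW A1'); rewrite invf_le1// ler1n.
rewrite powR_mulrn ?(ltW r0)//.
have := sqr_sqrtr (ltW s0); have := sqr_ge0 (Num.sqrt s - 1); rewrite !expr2 => h1 h2; lra.
Qed.

(** The 2 in the bound on [q] is room for the delay: the gradient is taken at time s - d >= s / 2,
    where its natural bound has (s-d)^(-1/2) in place of s^(-1/2). *)
Lemma f_le s x (p : R) (q : 'rV[R]_n) (X : R) : 0 < s -> `|p| <= X ->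
  (forall i, Num.sqrt s * `|q ord0 i| <= 2 * X) -> `|f x s p q| <= Cf * hsc a s * X.
Proof.
move=> s0 pX qX; apply: le_trans (fb x p q s0) _.
have X0 : 0 <= X := le_trans (normr_ge0 p) pX.
have s1 : 0 < 1 + s by lra.
have r0 : 0 < Num.sqrt s by rewrite sqrtr_gt0.
have eq : enorm q <= n%:R * (2 * X / Num.sqrt s).
  apply: enorm_le; first by rewrite divr_ge0 ?mulr_ge0// ltW.
  by move=> i; rewrite ler_pdivlMr// mulrC.
pose rho := Num.sqrt (1 + s) / Num.sqrt s.
have rho1 : 1 <= rho by rewrite ler_pdivlMr// mul1r ler_wsqrtr// lerDr.
have h1 : `|p| + (1 + s) `^ 2^-1 * enorm q <= (1 + 2 * n%:R) * rho * X.
  rewrite powR12_sqrt ?(ltW s1)//.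
  have -> : (1 + 2 * n%:R) * rho * X = rho * X + Num.sqrt (1 + s) * (n%:R * (2 * X / Num.sqrt s)).
    by rewrite /rho; ring.
  apply: lerD; first by apply: le_trans pX _; rewrite ler_peMl.
  exact: ler_wpM2l.
apply: le_trans (ler_wpM2l _ h1) _; first by rewrite mulr_ge0 ?powR_ge0// ltW.
have h2 := decay_le_hsc s0; rewrite -/rho in h2.
have -> : C * (1 + s) `^ (- A) * ((1 + 2 * n%:R) * rho * X) =
  C * (1 + 2 * n%:R) * X * ((1 + s) `^ (- A) * rho) by ring.
have -> : Cf * hsc a s * X = C * (1 + 2 * n%:R) * X * (2 `^ (A - 2^-1) * hsc a s).
  by rewrite /Cf; ring.
by apply: ler_wpM2l => //; rewrite mulr_ge0// mulr_ge0 ?(ltW C0)// addr_ge0.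
Qed.

(** The invariant of the iteration. That the components [Some i] are derivatives of the component
    [None] is not part of it; this is established for the Duhamel formula at the end. *)
Definition admissible U : Prop := forall j x t, 0 < t ->
  {for (x, t), continuous (fun p => U j p.1 p.2)} /\ sg j t * `|U j x t| <= Lam t * w x t.

(* The threshold [2 d < s] keeps [s - d >= s / 2], so that the majorants at the times [s - d]
   and [s] are comparable; [d = 0] gives the nonlinearity itself. *)
Definition NL d U (z : TR * 'rV[R]_n) : R :=
  if 2 * d < z.1 then f z.2 z.1 (U None z.2 (z.1 - d)) (\row_i U (Some i) z.2 (z.1 - d)) else 0.

Lemma f_continuous x t p q : 0 < t ->
  {for ((x, t), (p, q)), continuous (fun z : ('rV[R]_n * R) * (R * 'rV[R]_n) =>
     f z.1.1 z.1.2 z.2.1 z.2.2)}.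
Proof.
move=> t0.
have oD : open [set z : ('rV[R]_n * R) * (R * 'rV[R]_n) | 0 < z.1.2].
  rewrite (_ : [set z | _] = (fun z : ('rV[R]_n * R) * (R * 'rV[R]_n) => z.1.2) @^-1` [set s : R | 0 < s])//.
  apply: open_comp; last exact: open_gt.
  move=> z _; apply: (@continuous_comp _ _ _ (fun z : ('rV[R]_n * R) * (R * 'rV[R]_n) => z.1) snd);
    [exact: cvg_fst|exact: cvg_snd].
have := cf; rewrite continuous_open_subspace// => h.
by apply: h; rewrite inE.
Qed.

(** The delay costs w(s - d) <= 2^(n/2) w(s), and this is the factor [cn] in the constant of the
    weight; [Lamsc] is nondecreasing and costs nothing. *)
Lemma source_NL d U : 0 <= d -> admissible U -> source (NL d U).
Proof.
move=> d0 aU; split.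
  have oD : open [set z : R * 'rV[R]_n | 2 * d < z.1].
    rewrite (_ : [set z | _] = fst @^-1` [set s : R | 2 * d < s])//.
    apply: open_comp; last exact: open_gt.
    by move=> z _; exact: cvg_fst.
  have mD : measurable ([set z | 2 * d < z.1 :> R] : set (TR * 'rV[R]_n)).
    rewrite (_ : [set z | _] = slab `]2 * d, +oo[); first exact: measurable_slab_itv.
    by apply/seteqP; split => z; rewrite /slab /= in_itv/= andbT.
  have -> : NL d U = (fun z => f z.2 z.1 (U None z.2 (z.1 - d)) (\row_i U (Some i) z.2 (z.1 - d)))
      \_ [set z | 2 * d < z.1].
    by apply/funext => z; rewrite /NL /patch mem_setE.
  apply/(measurable_restrictT _ mD).
  apply: (@continuous_on_measurable_RrV R n [set z | 2 * d < z.1]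
    (fun z => f z.2 z.1 (U None z.2 (z.1 - d)) (\row_i U (Some i) z.2 (z.1 - d)))) => //.
  move=> z /= dz; have z0 : 0 < z.1 by lra.
  have zd : 0 < z.1 - d by lra.
  have cU j : {for z, continuous (fun z : R * 'rV[R]_n => U j z.2 (z.1 - d))}.
    apply: (@continuous_comp _ _ _ (fun z : R * 'rV[R]_n => (z.2, z.1 - d))
      (fun p : 'rV[R]_n * R => U j p.1 p.2)); last exact: (aU j z.2 _ zd).1.
    apply: continuous_pair; first exact: cvg_snd.
    by apply: continuousB; [exact: cvg_fst|exact: cst_continuous].
  apply: (@continuous_comp _ _ _ (fun z : R * 'rV[R]_n =>
     ((z.2, z.1), (U None z.2 (z.1 - d), \row_i U (Some i) z.2 (z.1 - d))))
     (fun z : ('rV[R]_n * R) * (R * 'rV[R]_n) => f z.1.1 z.1.2 z.2.1 z.2.2)); last exact: f_continuous.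
  apply: continuous_pair.
    by apply: continuous_pair; [exact: cvg_snd|exact: cvg_fst].
  apply: continuous_pair; first exact: cU.
  exact: (continuous_row (fun i => cU (Some i))).
move=> z; rewrite /NL; case: ifP => dz; last by rewrite normr0 bd_ge0//; exact: th_ge0.
have z0 : 0 < z.1 by lra.
have zd : 0 < z.1 - d by lra.
have bU j : sg j (z.1 - d) * `|U j z.2 (z.1 - d)| <= cn * (Lam z.1 * w z.2 z.1).
  apply: le_trans (aU j z.2 _ zd).2 _.
  have h1 : Lam (z.1 - d) <= Lam z.1.
    by apply: Lamsc_nd; rewrite ?a_gt0// ?(ltW m0) ?(ltW zd)// gerBl.
  have zdz : z.1 - d <= z.1 by rewrite gerBl.
  have h2 := w_time iphi z.2 zd zdz.
  have h3 : (z.1 / (z.1 - d)) `^ (n%:R / 2) <= cn.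
    apply: ge0_ler_powR; rewrite ?nnegrE ?divr_ge0 ?(ltW z0) ?(ltW zd)//.
    by rewrite ler_pdivrMr//; lra.
  rewrite mulrCA; apply: ler_pM => //; rewrite ?w_ge0 ?(ltW (Lam_gt0 _))//.
  by apply: le_trans h2 _; apply: ler_wpM2r => //; exact: w_ge0.
have h := @f_le z.1 z.2 (U None z.2 (z.1 - d)) (\row_i U (Some i) z.2 (z.1 - d))
  (cn * (Lam z.1 * w z.2 z.1)) z0.
apply: le_trans (h _ _) _.
- by have := bU None; rewrite /= mul1r.
- move=> i; rewrite mxE; have := bU (Some i) => /= {}bU.
  have s2 : Num.sqrt z.1 <= 2 * Num.sqrt (z.1 - d).
    rewrite -[leRHS]ger0_norm ?mulr_ge0// -sqrtr_sqr ler_wsqrtr//.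
    by rewrite exprMn sqr_sqrtr ?(ltW zd)//; lra.
  apply: le_trans (ler_wpM2r _ s2) _ => //.
  by rewrite -mulrA; apply: ler_wpM2l.
- by rewrite /bd thetaE// le_eqVlt; apply/orP; left; apply/eqP; ring.
Qed.

Definition V (F : TR * 'rV[R]_n -> R) j x t : R := heat_flow phi j x t + duhamel F j x t.

(** The heat flow contributes cn w and the Duhamel integral cn w times the Volterra integral of the
    weight; that the sum stays below [Lam] w is exactly the supersolution property. *)
Lemma admissible_V F : source F -> admissible (V F).
Proof.
move=> sF j x t t0; split.
  apply: (@continuousD _ _ _ (fun p : 'rV[R]_n * R => heat_flow phi j p.1 p.2)
    (fun p : 'rV[R]_n * R => duhamel F j p.1 p.2)); first exact: continuous_heat_flow.
  by apply: (continuous_duhamel iphi th_ge0 th_eq0 ith Cth0 th_near a_gt0).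
have h1 := heat_flow_le iphi j x t0.
have h2 := duhamel_le iphi th_ge0 ith th_near j x sF t0.
have h3 := supersol t0.
rewrite -lee_fin; apply: (@le_trans _ _ (cn%:E * (1 + Ith theta 0 t) * (w x t)%:E)%E).
  rewrite ge0_muleDr ?Ith_ge0// ge0_muleDl ?mule_ge0 ?Ith_ge0 ?lee_fin ?(ltW cn_gt0)//.
  have h1' : ((sg j t * `|heat_flow phi j x t|)%:E <= cn%:E * 1 * (w x t)%:E)%E.
    by rewrite mule1 -EFinM lee_fin.
  apply: le_trans _ (leeD h1' h2); rewrite -EFinD lee_fin -mulrDr; apply: ler_wpM2l; first exact: sg_ge0.
  exact: ler_normD.
rewrite EFinM; apply: lee_wpmul2r; first by rewrite lee_fin w_ge0.
by apply: le_trans h3; rewrite Ith_weight// ?C1_gt0// a_gt0.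
Qed.

Fixpoint delayed d k : option 'I_n -> 'rV[R]_n -> R -> R :=
  if k is k'.+1 then V (NL d (delayed d k')) else fun _ _ _ => 0.

Lemma admissible_delayed d k : 0 <= d -> admissible (delayed d k).
Proof.
move=> d0; elim: k => [|k IH] /=; last by apply: admissible_V; exact: source_NL.
move=> j x t t0; split; first exact: cst_continuous.
by rewrite normr0 mulr0 mulr_ge0 ?w_ge0// ltW// Lam_gt0.
Qed.

(* The delay makes the iteration stationary on [0, k d] after [k] steps, so that no contraction
   is needed. *)
Lemma delayed_stable d k j x t : 0 < d -> 0 < t -> t <= k%:R * d ->
  delayed d k.+1 j x t = delayed d k j x t.
Proof.
move=> d0; elim: k j x t => [|k IH] j x t t0 tk; first by move: tk; rewrite mul0r leNgt t0.
rewrite [LHS]/= [RHS]/= /V; congr (_ + _).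
apply: eq_Rintegral => z; rewrite inE /slab /= in_itv/= => /andP[z0 zt].
congr (_ * _); rewrite /NL; case: ifP => // dz.
have zd0 : 0 < z.1 - d by lra.
have zdk : z.1 - d <= k%:R * d by move: tk; rewrite -natr1 mulrDl mul1r; lra.
have E i : delayed d k.+1 i z.2 (z.1 - d) = delayed d k i z.2 (z.1 - d) by exact: IH.
congr (f _ _ _ _); first exact: E.
by apply/rowP => i; rewrite !mxE; exact: E.
Qed.

(** With delay 1/(k+1), (k+1)^2 steps make the iteration stationary up to time k+1: the delay tends
    to 0 while the time horizon tends to infinity. One further step expresses [u_] as [V] of the
    source [F_]. *)
Let u_ k := delayed k.+1%:R^-1 (k.+1 ^ 2).+1.
Let F_ k := NL k.+1%:R^-1 (delayed k.+1%:R^-1 (k.+1 ^ 2)).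

Let dk_gt0 (k : nat) : 0 < k.+1%:R^-1 :> R.
Proof. by rewrite invr_gt0. Qed.

Let source_F k : source (F_ k).
Proof. by apply: source_NL; [exact: ltW|apply: admissible_delayed; exact: ltW]. Qed.

Let u_E k : u_ k = V (F_ k).
Proof. by []. Qed.

(** In this time range the iteration has become stationary, so that [u_ k] solves the delayed
    equation exactly. *)
Let F_E k (z : TR * 'rV[R]_n) : 2 * k.+1%:R^-1 < z.1 -> z.1 <= k.+1%:R ->
  F_ k z = f z.2 z.1 (u_ k None z.2 (z.1 - k.+1%:R^-1)) (\row_i u_ k (Some i) z.2 (z.1 - k.+1%:R^-1)).
Proof.
move=> h1 h2; have d0 := dk_gt0 k; rewrite /F_ /NL h1.
have z0 : 0 < z.1 - k.+1%:R^-1.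
  by rewrite subr_gt0; apply: le_lt_trans h1; rewrite ler_peMl ?(ltW d0)// ler1n.
have zk : z.1 - k.+1%:R^-1 <= (k.+1 ^ 2)%:R * k.+1%:R^-1.
  by rewrite natrX expr2 mulfK ?pnatr_eq0// lerBlDr (le_trans h2)// lerDl ltW.
have E j : u_ k j z.2 (z.1 - k.+1%:R^-1) = delayed k.+1%:R^-1 (k.+1 ^ 2) j z.2 (z.1 - k.+1%:R^-1).
  exact: delayed_stable.
congr (f _ _ _ _); first by rewrite E.
by apply/rowP => i; rewrite !mxE E.
Qed.

Let u_equicontinuous j (p : 'rV[R]_n * R) (e : R) : 0 < p.2 -> 0 < e ->
  \forall q \near p, forall k, `|u_ k j q.1 q.2 - u_ k j p.1 p.2| <= e.
Proof.
move=> p0 e0; have e2 : 0 < e / 2 by rewrite divr_gt0.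
have h1 := duhamel_equicontinuous iphi th_ge0 th_eq0 ith Cth0 th_near a_gt0 j p.1 p0 e2.
have := continuous_heat_flow iphi p0 (j := j) (x := p.1); move/cvgrPdist_le => /(_ _ e2) h2.
rewrite -surjective_pairing in h1 h2.
apply: filterS2 h1 h2 => q h1 h2 k; rewrite u_E /V.
have -> : heat_flow phi j q.1 q.2 + duhamel (F_ k) j q.1 q.2 - (heat_flow phi j p.1 p.2 + duhamel (F_ k) j p.1 p.2) =
  - (heat_flow phi j p.1 p.2 - heat_flow phi j q.1 q.2) + (duhamel (F_ k) j q.1 q.2 - duhamel (F_ k) j p.1 p.2) by ring.
apply: le_trans (ler_normD _ _) _; rewrite normrN.
by apply: le_trans (lerD h2 (h1 _ (source_F k))) _; rewrite -splitr.
Qed.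

(** The unknown is the source instead of the solution: it has an integrable majorant on space-time,
    and both the solution and its gradient are recovered from it by [V]. The equation holds at every
    point, not only almost everywhere. *)
Lemma exists_fixed_point : exists F, source F /\ F = NL 0 (V F).
Proof.
have oD : open [set p : 'rV[R]_n * R | 0 < p.2].
  rewrite (_ : [set p | _] = snd @^-1` [set s : R | 0 < s])//.
  apply: open_comp; last exact: open_gt.
  by move=> z _; exact: cvg_snd.
pose pt (c : 'rV[rat]_n * rat) : 'rV[R]_n * R := (map_mx ratr c.1, ratr c.2).
have dense (p : 'rV[R]_n * R) B : [set p : 'rV[R]_n * R | 0 < p.2] p -> nbhs p B ->
    exists c, B (pt c) /\ [set p : 'rV[R]_n * R | 0 < p.2] (pt c).
  case: p => x t p0 nB.
  have nD : nbhs (x, t) [set p : 'rV[R]_n * R | 0 < p.2] by exact: open_nbhs_nbhs.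
  by have [c [c1 c2]] := rational_dense (filterI nB nD); exists c.
have bdd j (p : 'rV[R]_n * R) : [set p : 'rV[R]_n * R | 0 < p.2] p ->
    exists B : R, forall k, `|u_ k j p.1 p.2| <= B.
  move=> p0; exists ((sg j p.2)^-1 * (Lam p.2 * w p.1 p.2)) => k.
  rewrite ler_pdivlMl ?sg_gt0//.
  exact: (admissible_V (source_F k) j p.1 p0).2.
have [sigma [v [sk uv]]] := pointwise_extraction dense bdd u_equicontinuous.
pose U j x t := v j (x, t).
(* Pointwise convergence of the sources: the functions and their derivatives converge,
   equicontinuity absorbs the vanishing shift in time, and f is continuous. *)
have Fcvg z : F_ (sigma k) z @[k --> \oo] --> NL 0 U z.
  have [z0|z0] := leP z.1 0.
    have E k : F_ (sigma k) z = NL 0 U z.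
      have d0 := dk_gt0 (sigma k).
      by rewrite /F_ /NL mulr0 !ifF//; apply/negbTE; rewrite -leNgt// (le_trans z0)// mulr_ge0// ltW.
    by under eq_cvg do rewrite E; exact: cvg_cst.
  rewrite /NL mulr0 z0 subr0.
  have dcvg : (sigma k).+1%:R^-1 @[k --> \oo] --> (0 : R).
    apply/cvgrPdist_lt => e e0; have [N _ hN] := near_infty_natSinv_lt (PosNum e0).
    exists N => // k /= Nk; rewrite sub0r normrN gtr0_norm//.
    by apply: hN => /=; apply: leq_trans (sk k).
  have ucvg j : u_ (sigma k) j z.2 (z.1 - (sigma k).+1%:R^-1) @[k --> \oo] --> U j z.2 z.1.
    apply/cvgrPdist_le => e e0; have e2 : 0 < e / 2 by rewrite divr_gt0.
    have c2 : z.1 - (sigma k).+1%:R^-1 @[k --> \oo] --> (z.1 : R).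
      rewrite -[X in _ --> X]subr0; apply: cvgB => //; exact: cvg_cst.
    have pc : (z.2, z.1 - (sigma k).+1%:R^-1) @[k --> \oo] --> ((z.2, z.1) : 'rV[R]_n * R).
      exact: (cvg_pair (cvg_cst z.2) c2).
    have h1 : \forall k \near \oo, forall l, `|u_ l j z.2 (z.1 - (sigma k).+1%:R^-1) -
        u_ l j z.2 z.1| <= e / 2 := pc _ (@u_equicontinuous j (z.2, z.1) _ z0 e2).
    have := uv j (z.2, z.1) z0; move/cvgrPdist_le => /(_ _ e2) h2.
    apply: filterS2 h1 h2 => k h1 h2.
    have {}h1 := h1 (sigma k); rewrite /= in h1 h2.
    have -> : U j z.2 z.1 - u_ (sigma k) j z.2 (z.1 - (sigma k).+1%:R^-1) =
      (v j (z.2, z.1) - u_ (sigma k) j z.2 z.1) -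
      (u_ (sigma k) j z.2 (z.1 - (sigma k).+1%:R^-1) - u_ (sigma k) j z.2 z.1) by rewrite /U; ring.
    by apply: le_trans (ler_normB _ _) _; apply: le_trans (lerD h2 h1) _; rewrite -splitr.
  have rcvg : \row_i u_ (sigma k) (Some i) z.2 (z.1 - (sigma k).+1%:R^-1) @[k --> \oo] -->
      (\row_i U (Some i) z.2 z.1 : 'rV[R]_n).
    apply/cvg_ballP => e e0.
    have h : \forall k \near \oo, forall i, `|U (Some i) z.2 z.1 -
        u_ (sigma k) (Some i) z.2 (z.1 - (sigma k).+1%:R^-1)| < e.
      apply: filter_forall => i; have := ucvg (Some i); move/cvgrPdist_lt; exact.
    apply: filterS h => y hy; split => //= i j; rewrite !mxE; exact: hy.
  have E : \forall k \near \oo, F_ (sigma k) z =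
     f z.2 z.1 (u_ (sigma k) None z.2 (z.1 - (sigma k).+1%:R^-1))
      (\row_i u_ (sigma k) (Some i) z.2 (z.1 - (sigma k).+1%:R^-1)).
    have z4 : 0 < z.1 / 2 by rewrite divr_gt0.
    have h1 : \forall k \near \oo, (sigma k).+1%:R^-1 < z.1 / 2.
      have := dcvg; move/cvgrPdist_lt => /(_ _ z4); apply: filterS => k.
      by rewrite sub0r normrN gtr0_norm.
    have h2 : \forall k \near \oo, z.1 <= (sigma k).+1%:R.
      have zi : 0 < (z.1 : R)^-1 by rewrite invr_gt0.
      have [N _ hN] := near_infty_natSinv_lt (PosNum zi).
      exists N => // k /= Nk.
      have := hN (sigma k) (leq_trans Nk (sk k)).
      by rewrite /= ltf_pV2 ?posrE// => /ltW.
    by apply: filterS2 h1 h2 => k h1 h2; apply: F_E => //; rewrite mulrC -ltr_pdivlMr.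
  have p1 : (u_ (sigma k) None z.2 (z.1 - (sigma k).+1%:R^-1),
      \row_i u_ (sigma k) (Some i) z.2 (z.1 - (sigma k).+1%:R^-1)) @[k --> \oo] -->
      ((U None z.2 z.1, \row_i U (Some i) z.2 z.1) : R * 'rV[R]_n).
    exact: (cvg_pair (ucvg None) rcvg).
  have p2 : (((z.2, z.1) : 'rV[R]_n * R), (u_ (sigma k) None z.2 (z.1 - (sigma k).+1%:R^-1),
      \row_i u_ (sigma k) (Some i) z.2 (z.1 - (sigma k).+1%:R^-1))) @[k --> \oo] -->
      (((z.2, z.1), (U None z.2 z.1, \row_i U (Some i) z.2 z.1)) :
        ('rV[R]_n * R) * (R * 'rV[R]_n)).
    exact: (cvg_pair (cvg_cst ((z.2, z.1) : 'rV[R]_n * R)) p1).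
  have := cvg_comp _ _ p2 (@f_continuous z.2 z.1 (U None z.2 z.1) (\row_i U (Some i) z.2 z.1) z0).
  apply: cvg_trans; apply: near_eq_cvg.
  by apply: filterS E => k ->.
have sF : source (NL 0 U).
  split.
    apply: (@measurable_fun_cvg _ _ _ setT (fun k => F_ (sigma k))) => [k|z _].
      exact: (source_F (sigma k)).1.
    exact: Fcvg.
  by move=> z; exact: (limit_norm_le (Fcvg z) (fun k => (source_F (sigma k)).2 z)).
(* The Duhamel formula passes to the limit by dominated convergence, all sources being below
   [bd]. *)
have UE j x t : 0 < t -> U j x t = V (NL 0 U) j x t.
  move=> t0; apply: (@cvg_unique _ (@norm_hausdorff _ R) _ _ _ _ (uv j (x, t) t0)).
  rewrite /V /=.
  apply: cvgD; first exact: cvg_cst.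
  apply: (@Rintegral_dominated_cvg _ _ _ _ _ (measurable_slab_itv _)
    (fun k z => Kj j (x - z.2) (t - z.1) * F_ (sigma k) z) _
    (fun z => `|Kj j (x - z.2) (t - z.1) * bd phi theta z|)).
  - move=> k; apply: measurable_KF => //; first exact: (source_F (sigma k)).1.
    by move=> s /=; rewrite in_itv/= => /andP[].
  - by move=> z _; apply: cvgM; [exact: cvg_cst|exact: Fcvg].
  - have sb : source (bd phi theta) by apply: source_bd; [|exact: th_ge0|exact: th_eq0|exact: ith].
    exact: integrable_norm (integrable_KF iphi th_ge0 ith th_near j x sb t0).
  - move=> k z _; rewrite normrM [leRHS]normrM; apply: ler_wpM2l => //.
    by apply: le_trans ((source_F (sigma k)).2 z) _; exact: ler_norm.
exists (NL 0 U); split => //.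
move: UE; set G := V (NL 0 U) => UE.
apply/funext => z; rewrite /NL mulr0 subr0; case: ifP => // z0.
congr (f _ _ _ _); first exact: UE.
by apply/rowP => i; rewrite !mxE; exact: UE.
Qed.

End fixed_point.

(** * Large-time comparison of heat kernels *)

Section kernel_distance.
Context {R : realType} {n : nat}.
Implicit Types (x y z xi : 'rV[R]_n) (s t : R).

(** Pointwise |p - q| <= (p - c q) + (1 - c) q, and each of the two nonnegative terms has integral 1
    - c. *)
Lemma density_dist_le (p q : 'rV[R]_n -> R) (c : R) :
  measurable_fun setT p -> measurable_fun setT q -> (forall y, 0 <= p y) -> (forall y, 0 <= q y) ->
  (\int[leb n]_y (p y)%:E = 1)%E -> (\int[leb n]_y (q y)%:E = 1)%E ->
  c <= 1 -> (forall y, c * q y <= p y) ->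
  (\int[leb n]_y (`|p y - q y|)%:E <= (2 * (1 - c))%:E)%E.
Proof.
move=> mp mq p0 q0 p1 q1 c1 cqp.
have ip : (leb n).-integrable setT (EFin \o p).
  apply/integrableP; split; first exact/measurable_EFinP.
  rewrite (eq_integral (EFin \o p)) ?p1 ?ltry// => y _.
  by rewrite /= ger0_norm.
have iq : (leb n).-integrable setT (EFin \o q).
  apply/integrableP; split; first exact/measurable_EFinP.
  rewrite (eq_integral (EFin \o q)) ?q1 ?ltry// => y _.
  by rewrite /= ger0_norm.
have iZ := integrableZl measurableT (1 - 2 * c) iq.
apply: (@le_trans _ _ (\int[leb n]_y ((p y)%:E + (1 - 2 * c)%:E * (q y)%:E))%E).
  apply: ge0_le_integral => //.
  - apply/measurable_EFinP; apply: measurableT_comp => //; exact: measurable_funB.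
  - apply: emeasurable_funD; first exact/measurable_EFinP.
    by apply: measurable_funeM; exact/measurable_EFinP.
  - move=> y _; rewrite -EFinM -EFinD lee_fin; have := cqp y; have := q0 y => h1 h2.
    have h3 : 0 <= (1 - c) * q y by rewrite mulr_ge0// subr_ge0.
    by rewrite ler_norml; apply/andP; split; nra.
rewrite integralD//= integralZl// p1 q1 mule1 -EFinD lee_fin; lra.
Qed.

(* The times are shifted by [t / 4], the part of the heat flow used for smoothing: see
   [Kj_semigroup]. *)
Definition kdist xi s t : \bar R :=
  (\int[leb n]_y (`|Gk (y - xi) (3 * t / 4 - s) - Gk y (3 * t / 4 + 1)|)%:E)%E.

Lemma kdist_ge0 xi s t : (0 <= kdist xi s t)%E.
Proof. by apply: integral_ge0 => y _; rewrite lee_fin. Qed.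

Lemma integral_Gk0 t : 0 < t -> (\int[leb n]_y (Gk y t)%:E = 1)%E.
Proof. by move=> t0; rewrite -(integral_Gk (0 : 'rV[R]_n) t0); apply: eq_integral => y _; rewrite subr0. Qed.

Lemma measurable_Gk0 t : 0 < t -> measurable_fun setT (fun y : 'rV[R]_n => Gk y t).
Proof.
move=> t0; have := measurable_Gk (0 : 'rV[R]_n) t0.
by rewrite (_ : (fun y => _) = (fun y => Gk y t))//; apply/funext => y; rewrite subr0.
Qed.

Lemma kdist_le2 xi s t : 0 < t -> s <= t / 2 -> (kdist xi s t <= 2%:E)%E.
Proof.
move=> t0 st; have h1 : 0 < 3 * t / 4 - s by lra.
have h2 : 0 < 3 * t / 4 + 1 by lra.
have := @density_dist_le (fun y => Gk (y - xi) (3 * t / 4 - s)) (fun y => Gk y (3 * t / 4 + 1)) 0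
  (measurable_Gk _ h1) (measurable_Gk0 h2) (fun y => Gk_ge0 _ _) (fun y => Gk_ge0 _ _)
  (integral_Gk _ h1) (integral_Gk0 h2) ler01.
rewrite subr0 mulr1; apply => y.
by rewrite mul0r Gk_ge0.
Qed.

Lemma powRN_ge (c d : R) : 0 <= c -> 0 <= d -> 1 - c * d <= (1 + d) `^ (- c).
Proof.
move=> c0 d0; rewrite /powR gt_eqF ?ltr_wpDr//.
apply: le_trans (expR_ge1Dx _).
rewrite lerD2l mulNr lerN2; apply: ler_wpM2l => //.
by apply: le_trans (le_ln1Dx _) _ => //; apply: lt_le_trans d0; rewrite ltrN10.
Qed.

(* Both densities dominate [Gk y (tau / (1 + e))] up to a factor close to one; the choice
   [e = t^(-1/2)] balances the two errors. *)
Lemma kdist_le xi s t : 1 <= t -> 0 <= s -> s <= t / 2 ->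
  (kdist xi s t <= ((2 * (n%:R / 2 + 2 * enorm xi ^+ 2) + 8 * (n%:R / 2) * (3 + s)) / Num.sqrt t)%:E)%E.
Proof.
move=> t1 s0 st; have t0 : 0 < t by lra.
set c := n%:R / 2; have c0 : 0 <= c by rewrite /c divr_ge0.
pose e : R := (Num.sqrt t)^-1; have st0 : 0 < Num.sqrt t by rewrite sqrtr_gt0.
have e0 : 0 < e by rewrite invr_gt0.
have e1 : e <= 1 by rewrite invf_le1// -sqrtr1 ler_wsqrtr.
have te : t * e ^+ 2 = 1.
  by rewrite /e exprVn sqr_sqrtr ?(ltW t0)// divff// gt_eqF.
pose tau := 3 * t / 4 - s; pose T := 3 * t / 4 + 1; pose r := tau / (1 + e).
have tau4 : t / 4 <= tau by rewrite /tau; lra.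
have tau0 : 0 < tau by lra.
have T0 : 0 < T by rewrite /T; lra.
have ee : 0 < 1 + e by lra.
have r0 : 0 < r by rewrite divr_gt0.
have rT : r <= T.
  rewrite /r ler_pdivrMr//; have : 0 <= T * e by rewrite mulr_ge0 ?(ltW T0)// ltW.
  by rewrite mulrDr mulr1 /tau /T; lra.
pose q : R := (1 + e^-1) * enorm xi ^+ 2 / (4 * tau).
have q0 : 0 <= q.
  apply: divr_ge0; last by rewrite mulr_ge0// ltW.
  by rewrite mulr_ge0 ?sqr_ge0// addr_ge0// invr_ge0 ltW.
pose a := (1 + e) `^ (- c) * expR (- q).
have aE : a = expR (- (c * ln (1 + e)) - q).
  by rewrite expRD /a /powR gt_eqF// mulNr.
have lne : 0 <= ln (1 + e) by rewrite ln_ge0// lerDl ltW.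
have a1 : a <= 1.
  by rewrite aE -[leRHS]expR0 ler_expR subr_le0; apply: le_trans q0; rewrite oppr_le0 mulr_ge0.
have ale : 1 - c * e - q <= a.
  rewrite aE; apply: le_trans (expR_ge1Dx _).
  have : c * ln (1 + e) <= c * e.
    by apply: ler_wpM2l => //; apply: le_ln1Dx; apply: lt_trans e0; rewrite ltrN10.
  lra.
(* With this [d] the ratio r / T is 1 / (1 + d), so that [powRN_ge] bounds its power from below by 1
   - c d. *)
pose d := (T - r) / r.
have d0 : 0 <= d by rewrite divr_ge0 ?(ltW r0)// subr_ge0.
have rTd : r / T = (1 + d)^-1.
  by rewrite /d; field; rewrite !gt_eqF//=; have -> : r + (T - r) = T by ring.
pose b := (1 + d) `^ (- c).
have bE : b = (r / T) `^ c.
  by rewrite rTd -powR_inv1 ?addr_ge0// -powRrM mulN1r.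
have b1 : b <= 1.
  have d1 : 1 <= 1 + d by rewrite lerDl.
  by have := ler_powR d1 (_ : - c <= 0); rewrite powRr0 oppr_le0; apply.
have ble : 1 - c * d <= b by exact: powRN_ge.
have tau' : tau = r * (1 + e) by rewrite /r divfK// gt_eqF.
have h1 : (\int[leb n]_y (`|Gk (y - xi) tau - Gk y r|)%:E <= (2 * (1 - a))%:E)%E.
  apply: density_dist_le => //.
  - exact: measurable_Gk.
  - exact: measurable_Gk0.
  - by move=> y; exact: Gk_ge0.
  - by move=> y; exact: Gk_ge0.
  - exact: integral_Gk.
  - exact: integral_Gk0.
  - move=> y; have := Gk_shift_ge y xi tau0 e0; rewrite -/c -/r; apply: le_trans.
    by rewrite /a /q !mulNr.
have h2 : (\int[leb n]_y (`|Gk y T - Gk y r|)%:E <= (2 * (1 - b))%:E)%E.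
  apply: density_dist_le => //.
  - exact: measurable_Gk0.
  - exact: measurable_Gk0.
  - by move=> y; exact: Gk_ge0.
  - by move=> y; exact: Gk_ge0.
  - exact: integral_Gk0.
  - exact: integral_Gk0.
  - by move=> y; rewrite bE; exact: Gk_time.
have m1 : measurable_fun setT (fun y => (`|Gk (y - xi) tau - Gk y r|)%:E).
  apply/measurable_EFinP; apply: measurableT_comp => //.
  by apply: measurable_funB; [exact: measurable_Gk|exact: measurable_Gk0].
have m2 : measurable_fun setT (fun y : 'rV[R]_n => (`|Gk y T - Gk y r|)%:E).
  apply/measurable_EFinP; apply: measurableT_comp => //.
  by apply: measurable_funB; exact: measurable_Gk0.
apply: (@le_trans _ _ (\int[leb n]_y ((`|Gk (y - xi) tau - Gk y r|)%:E + (`|Gk y T - Gk y r|)%:E))%E).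
  apply: ge0_le_integral => //.
  - apply/measurable_EFinP; apply: measurableT_comp => //.
    by apply: measurable_funB; [exact: measurable_Gk|exact: measurable_Gk0].
  - exact: emeasurable_funD.
  - move=> y _; rewrite -EFinD lee_fin -/tau -/T [`|Gk y T - _|]distrC.
    have -> : Gk (y - xi) tau - Gk y T = (Gk (y - xi) tau - Gk y r) + (Gk y r - Gk y T) by ring.
    exact: ler_normD.
rewrite ge0_integralD//; apply: le_trans (leeD h1 h2) _.
rewrite -EFinD lee_fin -/e.
have ti : t^-1 = e ^+ 2 by apply: (mulfI (lt0r_neq0 t0)); rewrite te divff// gt_eqF.
set X := enorm xi ^+ 2; have X0 : 0 <= X by exact: sqr_ge0.
have tau_inv : tau^-1 <= 4 * e ^+ 2.
  have -> : 4 * e ^+ 2 = (t / 4)^-1 by rewrite -ti invf_div.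
  by rewrite lef_pV2 ?posrE// divr_gt0.
have e2e : e ^+ 2 <= e by rewrite expr2 ger_pMr.
have qle : q <= 2 * X * e.
  have -> : q = (1 + e^-1) * X / 4 * tau^-1 by rewrite /q -/X invfM !mulrA.
  apply: (@le_trans _ _ ((1 + e^-1) * X / 4 * (4 * e ^+ 2))).
    apply: ler_wpM2l => //; apply: divr_ge0 => //.
    by rewrite mulr_ge0// addr_ge0// invr_ge0 ltW.
  have -> : (1 + e^-1) * X / 4 * (4 * e ^+ 2) = (e ^+ 2 + e) * X by field; rewrite gt_eqF.
  have -> : 2 * X * e = (e + e) * X by ring.
  by apply: ler_wpM2r => //; rewrite lerD2r.
(* Here T is of order t and 1/tau of order e^2 = 1/t: the term T e / tau is of order e, and (1 + s)
   / tau is of smaller order, uniformly after multiplication by 3 + s. *)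
have dle : d <= 4 * (3 + s) * e.
  have -> : d = (1 + s + T * e) * tau^-1.
    rewrite /d tau'; have -> : 1 + s + T * e = T * (1 + e) - r * (1 + e).
      by rewrite -tau' /T /tau; ring.
    by field; rewrite !gt_eqF.
  have Te0 : 0 <= T * e by rewrite mulr_ge0 ?(ltW T0)// ltW.
  apply: (@le_trans _ _ ((1 + s + T * e) * (4 * e ^+ 2))).
    by apply: ler_wpM2l => //; lra.
  have -> : (1 + s + T * e) * (4 * e ^+ 2) = (4 * (1 + s) + 4 * e) * e ^+ 2 + 3 * e * (t * e ^+ 2).
    by rewrite /T; field.
  rewrite te mulr1; have e00 := ltW e0.
  have : (4 * (1 + s) + 4 * e) * e ^+ 2 <= (4 * (1 + s) + 4) * e.
    by apply: ler_pM => //; rewrite ?sqr_ge0//; nra.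
  nra.
have cd : c * d <= c * (4 * (3 + s) * e) by exact: ler_wpM2l.
have -> : (2 * (c + 2 * X) + 8 * c * (3 + s)) * e = 2 * (c * e + 2 * X * e) + 2 * (c * (4 * (3 + s) * e)).
  by ring.
lra.
Qed.

End kernel_distance.

(** * The semigroup law for the derivatives of the kernel *)

Section kernel_smoothing.
Context {R : realType} {n : nat}.
Implicit Types (x y z xi : 'rV[R]_n) (s t a b : R) (j : option 'I_n).

Lemma integrable_Gk_shift z b : 0 < b -> (leb n).-integrable setT (fun y => (Gk (y - z) b)%:E).
Proof.
move=> b0; apply/integrableP; split; first by apply/measurable_EFinP; exact: measurable_Gk.
rewrite (eq_integral (fun y => (Gk (y - z) b)%:E)) ?integral_Gk ?ltry// => y _.
by rewrite /= ger0_norm ?Gk_ge0.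
Qed.

Let J j z a b x : R := Jint (leb n) setT id (fun=> 0) (fun y => Gk (y - z) b) j x a.

Lemma JintE j z a b x : J j z a b x = \int[leb n]_y (Kj j (x - y) a * Gk (y - z) b).
Proof. by apply: eq_Rintegral => y _; rewrite subr0. Qed.

(** For a derivative, both sides of the law for the kernel are differentiated in x, the left one
    under the integral sign. *)
Lemma Kj_semigroup j x z a b : 0 < a -> 0 < b ->
  \int[leb n]_y (Kj j (x - y) a * Gk (y - z) b) = Kj j (x - z) (a + b).
Proof.
move=> a0 b0; have ab : 0 < a + b by rewrite addr_gt0.
have JN y : J None z a b y = Kj None (y - z) (a + b).
  rewrite JintE KjE /Rintegral; under eq_integral do rewrite KjE.
  by rewrite integral_Gk_semigroup.
rewrite -JintE; case: j => [i|]; last exact: JN.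
have d1 := @is_derive_Jint R n _ _ (leb n) setT id (fun=> 0) (fun y => Gk (y - z) b) a a measurableT
  (@measurable_id _ _ _) (@measurable_cst _ _ _ _ _ _) (integrable_Gk_shift z b0) a0.
have {}d1 := d1 (fun y _ => _) i x 0.
have aa : 0 + a <= a by rewrite add0r.
have {}d1 := d1 aa.
have d2 := is_derive_Kj i (x - z) 0 ab.
have E : (fun h : R => Kj None (h *: delta_mx ord0 i + (x - z)) (a + b)) =
   (fun h : R => Jint (leb n) setT id (fun=> 0) (fun y => Gk (y - z) b) None (h *: delta_mx ord0 i + x) a).
  by apply/funext => h; rewrite addrA -[RHS]/(J None z a b _) JN.
rewrite E in d2.
have := @derive_val _ _ _ _ _ _ _ d1; have := @derive_val _ _ _ _ _ _ _ d2 => -> /esym.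
by rewrite !scale0r !add0r.
Qed.

End kernel_smoothing.

Lemma measurable_smear_pair {R : realType} {n : nat} d (Z : measurableType d)
    (yy : Z -> 'rV[R]_n) (ss : Z -> R) (t : R) :
  measurable_fun setT yy -> measurable_fun setT (ss : Z -> measurableTypeR R) ->
  0 < t -> (forall z, ss z <= t / 2) ->
  measurable_fun setT (fun p : 'rV[R]_n * Z =>
    Gk (p.1 - yy p.2) (3 * t / 4 - ss p.2) - Gk p.1 (3 * t / 4 + 1)).
Proof.
move=> myy mss t0 sst.
have tau_gt0 z : 0 < 3 * t / 4 - ss z by have := sst z; lra.
have T_gt0 : 0 < 3 * t / 4 + 1 by lra.
apply: measurable_funB; last exact: measurableT_comp (measurable_Gk0 T_gt0) measurable_fst.
have m1 : measurable_fun setT (fun p : 'rV[R]_n * Z => yy p.2 - p.1).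
  apply: measurable_rV => i.
  rewrite (_ : (fun p => _) = (fun p : 'rV[R]_n * Z => yy p.2 ord0 i - p.1 ord0 i)); last first.
    by apply/funext => p; rewrite !mxE.
  apply: measurable_funB; last exact: measurableT_comp (measurable_coord i) measurable_fst.
  exact: measurableT_comp (measurableT_comp (measurable_coord i) myy) measurable_snd.
have m2 : measurable_fun setT ((fun p : 'rV[R]_n * Z => ss p.2) : 'rV[R]_n * Z -> measurableTypeR R).
  exact: measurableT_comp mss measurable_snd.
have := @measurable_Kj_shift R n _ _ _ _ m1 m2 None 0 (3 * t / 4) setT measurableT.
rewrite (_ : (fun p => _) = (fun p => Gk (p.1 - yy p.2) (3 * t / 4 - ss p.2))); last first.
  by apply/funext => p; rewrite KjE sub0r opprB.
by apply => p _; have := tau_gt0 p.2; rewrite subr_gt0.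
Qed.

(** * Superpositions of kernel differences *)

Section far_field.
Context {R : realType} {n : nat} d (Z : measurableType d)
  (m : {sigma_finite_measure set Z -> \bar R}).
Local Notation TR := (measurableTypeR R).
Local Notation cn := (@cn R n).
Variables (yy : Z -> 'rV[R]_n) (ss : Z -> R) (psi : Z -> R) (t : R).
Hypotheses (myy : measurable_fun setT yy) (mss : measurable_fun setT (ss : Z -> TR)).
Hypotheses (ipsi : m.-integrable setT (EFin \o psi)) (t0 : 0 < t).
Hypothesis sst : forall z, ss z <= t / 2.
Implicit Types (x y : 'rV[R]_n) (j : option 'I_n).

Let dd (p : 'rV[R]_n * Z) : R :=
  Gk (p.1 - yy p.2) (3 * t / 4 - ss p.2) - Gk p.1 (3 * t / 4 + 1).

Let tau_gt0 z : 0 < 3 * t / 4 - ss z.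
Proof. by have t0' : 0 < t := t0; have h := sst z; lra. Qed.

Let T_gt0 : 0 < 3 * t / 4 + 1.
Proof. by have t0' : 0 < t := t0; lra. Qed.

Let mpsi : measurable_fun setT psi.
Proof. by apply/measurable_EFinP; exact: measurable_int ipsi. Qed.

Let mdd : measurable_fun setT dd.
Proof. exact: measurable_smear_pair. Qed.

(** What is left of a superposition of kernel differences once the smoothing part of the heat flow
    is taken out; its total integral is the [psi]-weighted average of [kdist]. *)
Definition smear y : \bar R := (\int[m]_z (`|dd (y, z)| * `|psi z|)%:E)%E.

Let mddpsi : measurable_fun setT (fun p => (`|dd p| * `|psi p.2|)%:E).
Proof.
apply/measurable_EFinP; apply: measurable_funM; first exact: measurableT_comp.
by apply: measurableT_comp => //; exact: measurableT_comp mpsi measurable_snd.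
Qed.

Lemma smear_ge0 y : (0 <= smear y)%E.
Proof. by apply: integral_ge0 => z _; rewrite lee_fin mulr_ge0. Qed.

Lemma measurable_smear : measurable_fun setT smear.
Proof.
by apply: (measurable_fun_fubini_tonelli_F _ mddpsi) => p; rewrite lee_fin mulr_ge0.
Qed.

Lemma integral_smear : (\int[leb n]_y smear y = \int[m]_z (kdist (yy z) (ss z) t * `|psi z|%:E))%E.
Proof.
rewrite (fubini_tonelli _ mddpsi); last by move=> p; rewrite lee_fin mulr_ge0.
apply: eq_integral => z _; rewrite -ge0_integralZr//.
  apply/measurable_EFinP; apply: measurableT_comp => //.
  by apply: measurable_funB; [exact: measurable_Gk|exact: measurable_Gk0].
Qed.

Let diff j x z : R := Kj j (x - yy z) (t - ss z) - Kj j x (1 + t).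

(** Both kernels share a final stretch of length t / 4 of the heat flow. It takes the derivative and
    its singular weight, leaving a difference of unit-mass kernels; the 2 in the constant is sqrt t
    / sqrt (t/4). *)
Let diff_le j x z : ((sg j t * `|diff j x z|)%:E <=
  (2 * cn)%:E * \int[leb n]_y (Gk (x - y) (t / 2) * `|dd (y, z)|)%:E)%E.
Proof.
have t0' : 0 < t := t0.
have t4 : 0 < t / 4 by lra.
have cn0 := @cn_gt0 R n; have sg0 := sg_gt0 j t0.
have iK xi b : 0 < b -> (leb n).-integrable setT (fun y => (Kj j (x - y) (t / 4) * Gk (y - xi) b)%:E).
  move=> b0; have h := @integrable_Kj R n _ _ (leb n) setT id (fun=> 0) (fun y => Gk (y - xi) b) (t / 4)
    measurableT (@measurable_id _ _ _) (@measurable_cst _ _ _ _ _ _) (integrable_Gk_shift xi b0) t4 j x (t / 4).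
  have {}h := h (fun z _ => _).
  have tt : 0 + t / 4 / 2 <= t / 4 by lra.
  by have := h tt; apply: eq_integrable => // y _; rewrite subr0.
have E : diff j x z = \int[leb n]_y (Kj j (x - y) (t / 4) * dd (y, z)).
  rewrite /diff.
  have -> : t - ss z = t / 4 + (3 * t / 4 - ss z) by lra.
  have -> : 1 + t = t / 4 + (3 * t / 4 + 1) by lra.
  rewrite -{2}[x]subr0 -!Kj_semigroup// -RintegralB//; [|exact: iK|exact: iK].
  by apply: eq_Rintegral => y _; rewrite /dd /= subr0 mulrBr.
have iD : (leb n).-integrable setT (fun y => (Kj j (x - y) (t / 4) * dd (y, z))%:E).
  have := integrableB measurableT (iK (yy z) _ (tau_gt0 z)) (iK 0 _ T_gt0).
  by apply: eq_integrable => // y _; rewrite /= subr0 mulrBr.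
have mD := measurable_int _ iD.
have mdz : measurable_fun setT (fun y => dd (y, z)) by exact: measurableT_comp mdd (pair2_measurable z).
rewrite EFinM E EFin_normr_Rintegral//.
apply: le_trans (lee_wpmul2l _ (le_abse_integral _ _ mD)) _; rewrite ?lee_fin ?(ltW sg0)//.
rewrite -!ge0_integralZl//.
- apply: ge0_le_integral => //.
  + by move=> y _; rewrite mule_ge0// lee_fin ltW.
  + by apply: measurable_funeM; exact: measurableT_comp.
  + apply: measurable_funeM; apply/measurable_EFinP; apply: measurable_funM.
      by apply: measurable_GkN; lra.
    exact: measurableT_comp.
  + move=> y _; rewrite -!EFinM lee_fin normrM mulrA [leRHS]mulrA; apply: ler_wpM2r => //.
    have t4t : t / 4 <= t by lra.
    have := sg_Kj_le j (x - y) t4 t4t.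
    have -> : Num.sqrt t / Num.sqrt (t / 4) = 2.
      have -> : t = 2 ^+ 2 * (t / 4) by field.
      rewrite sqrtrM ?sqr_ge0// sqrtr_sqr ger0_norm// [_ ^+ 2 * (t / 4)](_ : _ = t); last by field.
      by rewrite mulfK// gt_eqF// sqrtr_gt0.
    have -> : 2 * (t / 4) = t / 2 by field.
    by rewrite [cn * 2]mulrC.
- apply/measurable_EFinP; apply: measurable_funM; last exact: measurableT_comp.
  by apply: measurable_GkN; lra.
- by move=> y _; rewrite lee_fin mulr_ge0 ?Gk_ge0.
- by rewrite lee_fin mulr_ge0// ltW.
- exact: measurableT_comp mD.
- by rewrite lee_fin ltW.
Qed.

(** The preceding estimate is integrated against |psi|; Tonelli then moves the smoothing kernel
    outside, so that one function of y carries all the smallness. *)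
Lemma far_field_le j x : ((sg j t * `|\int[m]_z (diff j x z * psi z)|)%:E <=
  (2 * cn)%:E * \int[leb n]_y ((Gk (x - y) (t / 2))%:E * smear y))%E.
Proof.
have cn0 := @cn_gt0 R n; have sg0 := sg_gt0 j t0.
have t0' : 0 < t := t0.
have t1 : 0 < 1 + t by lra.
have t4 : 0 < t / 4 by lra.
have sst' z : setT z -> ss z + t / 4 / 2 <= t by have := sst z; lra.
have iK : m.-integrable setT (fun z => (Kj j (x - yy z) (t - ss z) * psi z)%:E).
  exact: (@integrable_Kj R n _ _ m setT yy ss psi (t / 4) measurableT myy mss ipsi t4 j x t sst').
have iD : m.-integrable setT (fun z => (diff j x z * psi z)%:E).
  have := integrableB measurableT iK (integrableZl measurableT (Kj j x (1 + t)) ipsi).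
  by apply: eq_integrable => // z _; rewrite /= /diff mulrBl.
rewrite EFinM EFin_normr_Rintegral//; have mD := measurable_int _ iD.
apply: le_trans (lee_wpmul2l _ (le_abse_integral _ _ mD)) _; rewrite ?lee_fin ?(ltW sg0)//.
have mGd : measurable_fun setT (fun p : 'rV[R]_n * Z => (Gk (x - p.1) (t / 2) * (`|dd p| * `|psi p.2|))%:E).
  apply/measurable_EFinP; apply: measurable_funM.
    have mG : measurable_fun setT (fun y => Gk (x - y) (t / 2)) by apply: measurable_GkN; lra.
    exact: (measurableT_comp mG measurable_fst).
  exact/measurable_EFinP.
have -> : (\int[leb n]_y ((Gk (x - y) (t / 2))%:E * smear y) =
    \int[m]_z \int[leb n]_y (Gk (x - y) (t / 2) * (`|dd (y, z)| * `|psi z|))%:E)%E.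
  rewrite -(fubini_tonelli _ mGd); last by move=> p; rewrite lee_fin mulr_ge0 ?Gk_ge0// mulr_ge0.
  apply: eq_integral => y _; rewrite /smear -ge0_integralZl//.
  - by apply: measurableT_comp mddpsi (pair1_measurable y).
  - by rewrite lee_fin Gk_ge0.
have mI : measurable_fun setT (fun z => \int[leb n]_y (Gk (x - y) (t / 2) * (`|dd (y, z)| * `|psi z|))%:E)%E.
  by apply: (measurable_fun_fubini_tonelli_G _ mGd) => p; rewrite lee_fin mulr_ge0 ?Gk_ge0// mulr_ge0.
rewrite -!ge0_integralZl//.
- apply: ge0_le_integral => //.
  + by move=> z _; rewrite mule_ge0// lee_fin ltW.
  + by apply: measurable_funeM; exact: measurableT_comp.
  + exact: measurable_funeM.
  + move=> z _; rewrite /= normrM EFinM muleA -EFinM.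
    under eq_integral do rewrite mulrA EFinM.
    have mGz : measurable_fun setT (fun y => (Gk (x - y) (t / 2) * `|dd (y, z)|)%:E).
      apply/measurable_EFinP; apply: measurable_funM; first by apply: measurable_GkN; lra.
      by apply: measurableT_comp => //; exact: measurableT_comp mdd (pair2_measurable z).
    rewrite ge0_integralZr//; last by move=> y _; rewrite lee_fin mulr_ge0 ?Gk_ge0.
    by rewrite [leLHS]EFinM muleA; apply: lee_wpmul2r; [rewrite lee_fin|exact: diff_le].
- by move=> z _; apply: integral_ge0 => y _; rewrite lee_fin mulr_ge0 ?Gk_ge0// mulr_ge0.
- by rewrite lee_fin mulr_ge0// ltW.
- exact: measurableT_comp mD.
- by rewrite lee_fin ltW.
Qed.

End far_field.

(** * Norms *)

Section dominated.
Context {R : realType} {n : nat}.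
Implicit Types (x y z : 'rV[R]_n) (t e c : R) (P h : 'rV[R]_n -> R).

(* Heat-kernel-like size at time [t]: [P] is at most [e] in [L^1] and [e t^(-n/2)] in the
   sup norm; interpolation gives all the other [L^q] norms. *)
Definition dominated t e P := [/\ measurable_fun setT P,
  forall x, 0 <= P x, forall x, P x <= e * t `^ (- (n%:R / 2)) &
  (\int[leb n]_x (P x)%:E <= e%:E)%E].

Lemma dominated_le t e e' P : e <= e' -> dominated t e P -> dominated t e' P.
Proof.
move=> ee [mP P0 Ps Pi]; split => //.
- move=> x; apply: le_trans (Ps x) _; apply: ler_wpM2r => //; exact: powR_ge0.
- by apply: le_trans Pi _; rewrite lee_fin.
Qed.

Lemma dominatedD t e1 e2 P1 P2 : dominated t e1 P1 -> dominated t e2 P2 ->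
  dominated t (e1 + e2) (fun x => P1 x + P2 x).
Proof.
move=> [m1 p1 s1 i1] [m2 p2 s2 i2]; split.
- exact: measurable_funD.
- by move=> x; rewrite addr_ge0.
- by move=> x; rewrite mulrDl lerD.
- under eq_integral do rewrite EFinD.
  rewrite ge0_integralD//.
  + by rewrite EFinD; exact: leeD.
  + by move=> x _; rewrite lee_fin.
  + exact/measurable_EFinP.
  + by move=> x _; rewrite lee_fin.
  + exact/measurable_EFinP.
Qed.

Lemma dominatedZ t c e P : 0 <= c -> dominated t e P -> dominated t (c * e) (fun x => c * P x).
Proof.
move=> c0 [mP p sP iP]; split.
- by apply: measurable_funM => //; exact: measurable_cst.
- by move=> x; rewrite mulr_ge0.
- by move=> x; rewrite -mulrA; apply: ler_wpM2l.
- under eq_integral do rewrite EFinM.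
  rewrite ge0_integralZl//.
  + by rewrite EFinM; apply: lee_wpmul2l; rewrite ?lee_fin.
  + exact/measurable_EFinP.
  + by move=> x _; rewrite lee_fin.
Qed.

Lemma gam_le_powR k t : 0 < t -> 1 <= 4 * pi * k -> gam n (k * t) <= t `^ (- (n%:R / 2)).
Proof.
move=> t0 k1; have n0 : 0 <= n%:R / 2 :> R by rewrite divr_ge0.
have kt : t <= 4 * pi * (k * t) by rewrite mulrA ler_peMl// ltW.
rewrite /gam !powRN lef_pV2 ?posrE ?powR_gt0//; last exact: lt_le_trans kt.
by apply: ge0_ler_powR; rewrite ?nnegrE ?(ltW t0)// (le_trans (ltW t0)).
Qed.

Lemma pi4_ge1 (k : R) : 2^-1 <= k -> 1 <= 4 * pi * k.
Proof. by move=> k2; have := @pi_ge2 R; nra. Qed.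

Lemma Lqnorm_ge0 (q : \bar R) h : (0 <= Lqnorm q h)%E.
Proof.
case: q => [r| |] /=; first exact: poweR_ge0.
  by apply: (@le_trans _ _ (`|h 0|)%:E); [rewrite lee_fin|apply: ereal_sup_ubound; exists 0].
by apply: (@le_trans _ _ (`|h 0|)%:E); [rewrite lee_fin|apply: ereal_sup_ubound; exists 0].
Qed.

Lemma Lqnorm_dominated (q : \bar R) t e P h : (1 <= q)%E -> 0 < t -> 0 < e ->
  measurable_fun setT h -> (forall x, `|h x| <= P x) -> dominated t e P ->
  ((t `^ (n%:R / 2 * (1 - qinv q)))%:E * Lqnorm q h <= e%:E)%E.
Proof.
move=> q1 t0 e0 mh hP [mP P0 Ps Pi].
set tau := t `^ (- (n%:R / 2)) in Ps *.
have tau0 : 0 < tau by rewrite powR_gt0.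
have hs x : `|h x| <= e * tau by exact: le_trans (hP x) (Ps x).
case: q q1 => [r| |//]; last first.
  move=> _ /=; rewrite subr0 mulr1.
  have s1 : (ereal_sup (range (fun x => (`|h x|)%:E)) <= (e * tau)%:E)%E.
    by apply: ge_ereal_sup => _ [x _ <-]; rewrite lee_fin.
  apply: le_trans (lee_wpmul2l _ s1) _; first by rewrite lee_fin powR_ge0.
  rewrite -EFinM lee_fin mulrCA -powRD; first by rewrite subrr powRr0 mulr1.
  by apply/implyP => _; rewrite gt_eqF.
rewrite lee_fin => r1 /=; have r0 : 0 < r by lra.
have mhr : measurable_fun setT (fun x => (`|h x| `^ r)%:E).
  apply/measurable_EFinP; apply: measurableT_comp (measurable_powR _) _.
  exact: measurableT_comp.
rewrite intRNE//.
(* Interpolation: one factor |h| is kept under the integral, the remaining power r - 1 is estimated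
   by the sup bound. *)
have pw x : `|h x| `^ r <= (e * tau) `^ (r - 1) * P x.
  have -> : `|h x| `^ r = `|h x| `^ (r - 1) * `|h x|.
    have [->|h0] := eqVneq (`|h x|) 0; first by rewrite mulr0 powR0// gt_eqF.
    by rewrite -{3}[`|h x|]powRr1// -powRD ?subrK// h0 implybT.
  apply: ler_pM; rewrite ?powR_ge0//.
  apply: ge0_ler_powR; rewrite ?nnegrE ?subr_ge0// mulr_ge0// ltW//.
have int : (\int[leb n]_x (`|h x| `^ r)%:E <= (e `^ r * tau `^ (r - 1))%:E)%E.
  apply: (@le_trans _ _ (\int[leb n]_x (((e * tau) `^ (r - 1))%:E * (P x)%:E))%E).
    apply: ge0_le_integral => //.
    - by apply: measurable_funeM; exact/measurable_EFinP.
    - by move=> x _; rewrite -EFinM lee_fin.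
  rewrite ge0_integralZl//.
  - apply: le_trans (lee_wpmul2l _ Pi) _; first by rewrite lee_fin powR_ge0.
    rewrite -EFinM lee_fin powRM ?(ltW e0) ?(ltW tau0)// mulrAC -{2}[e]powRr1 ?(ltW e0)//.
    by rewrite -powRD ?subrK// gt_eqF// implybT.
  - exact/measurable_EFinP.
  - by move=> x _; rewrite lee_fin.
  - by rewrite lee_fin powR_ge0.
have ri0 : 0 <= r^-1 by rewrite invr_ge0 ltW.
have int' : (poweR (\int[leb n]_x (`|h x| `^ r)%:E) r^-1 <= (e * tau `^ (1 - r^-1))%:E)%E.
  apply: (@le_trans _ _ (poweR (e `^ r * tau `^ (r - 1))%:E r^-1)).
    apply: gt0_ler_poweR => //.
    - by rewrite in_itv/= leey andbT; apply: integral_ge0 => x _; rewrite lee_fin powR_ge0.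
    - by rewrite in_itv/= leey andbT lee_fin mulr_ge0 ?powR_ge0.
  have rr : r / r = 1 by rewrite divff// gt_eqF.
  have E1 : (e `^ r) `^ r^-1 = e by rewrite -powRrM rr powRr1// ltW.
  have E2 : (tau `^ (r - 1)) `^ r^-1 = tau `^ (1 - r^-1) by rewrite -powRrM mulrBl rr mul1r.
  rewrite poweR_EFin lee_fin powRM; [|exact: powR_ge0|exact: powR_ge0].
  by rewrite E1 E2.
apply: le_trans (lee_wpmul2l _ int') _; first by rewrite lee_fin powR_ge0.
rewrite -EFinM lee_fin mulrCA /tau -powRrM -powRD.
  by rewrite mulNr subrr powRr0 mulr1.
by apply/implyP => _; rewrite gt_eqF.
Qed.

Lemma dominated_Gk t : 0 < t -> dominated t 1 (fun x => Gk x (2 * (1 + t))).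
Proof.
move=> t0; have t1 : 0 < 2 * (1 + t) by lra.
split.
- exact: measurable_Gk0.
- by move=> x; exact: Gk_ge0.
- move=> x; rewrite mul1r; apply: le_trans (Gk_le_gam _ t1) _.
  apply: (@le_trans _ _ (gam n (1 * t))); first by apply: gam_ni; lra.
  by apply: gam_le_powR => //; apply: pi4_ge1; lra.
- by rewrite integral_Gk0.
Qed.

Lemma dominated_w (phi : 'rV[R]_n -> R) t : (leb n).-integrable setT (EFin \o phi) -> 0 < t ->
  dominated t (mass phi) (fun x => w phi x t).
Proof.
move=> iphi t0; split.
- exact: measurable_w.
- by move=> x; exact: w_ge0.
- move=> x; apply: le_trans (w_le_gam iphi x t0) _; rewrite mulrC; apply: ler_wpM2l.
    exact: mass_ge0.
  by apply: gam_le_powR => //; apply: pi4_ge1; lra.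
- by rewrite integral_w.
Qed.

(** The endpoint cases of Young's inequality: convolution with a kernel of mass one keeps the L^1
    size, and the peak of that kernel gives the sup bound of order t^(-n/2). *)
Lemma dominated_smear (S : 'rV[R]_n -> \bar R) t e : 0 < t -> measurable_fun setT S ->
  (forall y, 0 <= S y)%E -> (\int[leb n]_y S y <= e%:E)%E ->
  exists P, dominated t e P /\ forall x, (\int[leb n]_y ((Gk (x - y) (t / 2))%:E * S y) = (P x)%:E)%E.
Proof.
move=> t0 mS S0 Se; have t2 : 0 < t / 2 by lra.
have mGx x : measurable_fun setT (fun y => (Gk (x - y) (t / 2))%:E * S y)%E.
  by apply: emeasurable_funM => //; apply/measurable_EFinP; exact: measurable_GkN.
have GS0 x y : (0 <= (Gk (x - y) (t / 2))%:E * S y)%E by rewrite mule_ge0// lee_fin Gk_ge0.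
have sup x : (\int[leb n]_y ((Gk (x - y) (t / 2))%:E * S y) <= (e * t `^ (- (n%:R / 2)))%:E)%E.
  apply: (@le_trans _ _ (\int[leb n]_y ((t `^ (- (n%:R / 2)))%:E * S y))%E).
    apply: ge0_le_integral => //.
    - exact: measurable_funeM.
    - move=> y _; apply: lee_wpmul2r => //; rewrite lee_fin.
      apply: le_trans (Gk_le_gam _ t2) _; rewrite mulrC.
      by apply: gam_le_powR => //; exact: pi4_ge1.
  rewrite ge0_integralZl//; last by rewrite lee_fin powR_ge0.
  by rewrite [X in (_ <= X%:E)%E]mulrC EFinM; apply: lee_wpmul2l => //; rewrite lee_fin powR_ge0.
have fin x : (\int[leb n]_y ((Gk (x - y) (t / 2))%:E * S y))%E \is a fin_num.
  rewrite ge0_fin_numE; first by apply: le_lt_trans (sup x) _; rewrite ltry.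
  exact: integral_ge0.
have mG : measurable_fun setT (fun p : 'rV[R]_n * 'rV[R]_n => (Gk (p.1 - p.2) (t / 2))%:E * S p.2)%E.
  apply: emeasurable_funM; first by apply/measurable_EFinP; exact: measurable_Gk_diff.
  exact: measurableT_comp mS measurable_snd.
exists (fun x => fine (\int[leb n]_y ((Gk (x - y) (t / 2))%:E * S y))%E); split; last first.
  by move=> x; rewrite fineK.
split.
- apply: measurableT_comp => //.
  by apply: (measurable_fun_fubini_tonelli_F _ mG) => p; exact: GS0.
- by move=> x; apply: fine_ge0; exact: integral_ge0.
- by move=> x; rewrite -lee_fin fineK.
- under eq_integral do rewrite fineK//.
  rewrite (fubini_tonelli _ mG); last by move=> p; exact: GS0.
  apply: le_trans _ Se; rewrite le_eqVlt; apply/orP; left; apply/eqP.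
  apply: eq_integral => y _ /=; rewrite ge0_integralZr ?integral_Gk ?mul1e//.
  + by apply/measurable_EFinP; exact: measurable_Gk.
  + by move=> x _; rewrite lee_fin Gk_ge0.
Qed.

End dominated.

(** * Weighted norms *)

Section moments.
Context {R : realType} {n : nat}.
Implicit Types (x y z : 'rV[R]_n) (t l : R).

(** Take r = |z| and B = 8 (l + 1), so that (1 + r)^2 <= 2 B (1 + t) exp(r^2 / (B t)). Raised to the
    power l / 2, the exponent becomes l / (l + 1) times r^2 / (16 t), which the spare Gaussian of
    [Gk_half] at time 2 t absorbs. Using l + 1 rather than l covers l = 0. *)
Lemma moment_Gk_le l t z : 0 <= l -> 0 < t ->
  (1 + enorm z) `^ l * Gk z (2 * t) <=
  (16 * (l + 1)) `^ (l / 2) * 2 `^ (n%:R / 2) * ((1 + t) `^ (l / 2) * Gk z (4 * t)).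
Proof.
move=> l0 t0; set r := enorm z; have r0 : 0 <= r by exact: enorm_ge0.
have t2 : 0 < 2 * t by lra.
have l2 : 0 <= l / 2 by rewrite divr_ge0.
rewrite (Gk_half z t2) (_ : 2 * (2 * t) = 4 * t); last by ring.
have -> : (8 * (2 * t) = 16 * t) by ring.
have [B [BE B0]] : exists B : R, B = 8 * (l + 1) /\ 0 < B.
  by exists (8 * (l + 1)); split => //; lra.
pose X := r ^+ 2 / (B * t).
have X0 : 0 <= X by rewrite divr_ge0 ?sqr_ge0// mulr_ge0 ?(ltW B0) ?(ltW t0).
have t1 : 0 < 1 + t by lra.
have sq : (1 + r) ^+ 2 <= 2 * B * (1 + t) * expR X.
  have h1 : 1 + X <= expR X := expR_ge1Dx X.
  apply: le_trans (ler_wpM2l _ h1); last by rewrite !mulr_ge0 ?(ltW B0) ?(ltW t1).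
  have rX : r ^+ 2 = X * (B * t) by rewrite /X divfK// gt_eqF// mulr_gt0.
  have B1 : 1 <= B by rewrite BE; lra.
  have h2 : (1 + r) ^+ 2 <= 2 * (1 + r ^+ 2).
    by have := sqr_ge0 (r - 1); rewrite !expr2 => ?; lra.
  apply: le_trans h2 _; rewrite rX.
  have h3 : 0 <= B * X by rewrite mulr_ge0// ltW.
  have h4 : 0 <= B * t by rewrite mulr_ge0// ltW.
  nra.
have pw : (1 + r) `^ l <= (2 * B * (1 + t)) `^ (l / 2) * expR (X * (l / 2)).
  have -> : l = 2 * (l / 2) by field.
  rewrite powRrM powR_mulrn ?addr_ge0// expRM -powRM ?expR_ge0//; last first.
    by rewrite !mulr_ge0 ?(ltW B0) ?(ltW t1).
  rewrite [2 * (l / 2)](_ : _ = l); last by field.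
  by apply: ge0_ler_powR; rewrite ?nnegrE ?sqr_ge0// !mulr_ge0 ?expR_ge0 ?(ltW B0) ?(ltW t1).
have ex : expR (X * (l / 2)) * expR (- r ^+ 2 / (16 * t)) <= 1.
  rewrite -expRD -[leRHS]expR0 ler_expR.
  have -> : X * (l / 2) = l / (l + 1) * (r ^+ 2 / (16 * t)).
    by rewrite /X BE; field; rewrite !gt_eqF//; lra.
  rewrite mulNr subr_le0 ler_piMl ?divr_ge0 ?sqr_ge0 ?mulr_ge0 ?(ltW t0)//.
  by rewrite ler_pdivrMr ?mul1r; lra.
apply: le_trans (ler_wpM2r _ pw) _; first by rewrite mulr_ge0 ?Gk_ge0// mulr_ge0 ?powR_ge0 ?expR_ge0.
rewrite [leLHS](_ : _ = (2 * B * (1 + t)) `^ (l / 2) * 2 `^ (n%:R / 2) * Gk z (4 * t) *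
  (expR (X * (l / 2)) * expR (- r ^+ 2 / (16 * t)))); last by ring.
apply: le_trans (ler_piMr _ ex) _; first by rewrite mulr_ge0 ?Gk_ge0// mulr_ge0 ?powR_ge0.
rewrite powRM ?(ltW t1)//; last by rewrite mulr_ge0// ltW.
have -> : 2 * B = 16 * (l + 1) by rewrite BE; ring.
by rewrite le_eqVlt; apply/orP; left; apply/eqP; ring.
Qed.

Lemma measurable_weight_enorm l : measurable_fun setT (fun x : 'rV[R]_n => (1 + enorm x) `^ l).
Proof.
apply: measurableT_comp (measurable_powR _) _; apply: measurable_funD; first exact: measurable_cst.
apply: continuous_on_measurable_rV; first exact: openT.
by move=> x _; exact: continuous_enorm.
Qed.

Lemma integral_moment_w (phi : 'rV[R]_n -> R) l t : (leb n).-integrable setT (EFin \o phi) ->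
  0 <= l -> 0 < t ->
  (\int[leb n]_x ((1 + enorm x) `^ l * w phi x t)%:E <=
   ((16 * (l + 1)) `^ (l / 2) * 2 `^ (n%:R / 2) * (1 + t) `^ (l / 2))%:E *
   \int[leb n]_y ((1 + enorm y) `^ l * `|phi y|)%:E)%E.
Proof.
move=> iphi l0 t0; have t2 : 0 < 2 * t by lra.
have t4 : 0 < 4 * t by lra.
set K := (16 * (l + 1)) `^ (l / 2) * 2 `^ (n%:R / 2) * (1 + t) `^ (l / 2).
have K0 : 0 <= K by rewrite !mulr_ge0 ?powR_ge0.
have mW := measurable_weight_enorm l.
have inner y : (\int[leb n]_x ((1 + enorm x) `^ l * Gk (x - y) (2 * t))%:E <=
    (K * (1 + enorm y) `^ l)%:E)%E.
  apply: (@le_trans _ _ (\int[leb n]_x ((K * (1 + enorm y) `^ l)%:E * (Gk (x - y) (4 * t))%:E))%E).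
    apply: ge0_le_integral => //.
    - by move=> x _; rewrite lee_fin mulr_ge0 ?powR_ge0 ?Gk_ge0.
    - apply/measurable_EFinP; apply: measurable_funM => //; exact: measurable_Gk.
    - apply: measurable_funeM; apply/measurable_EFinP; exact: measurable_Gk.
    - move=> x _; rewrite -EFinM lee_fin.
      (* The weight is submultiplicative, 1 + |x| <= (1 + |y|) (1 + |x - y|); this separates the
         moment of the datum from the moment of the kernel. *)
      have h : (1 + enorm x) `^ l <= (1 + enorm y) `^ l * (1 + enorm (x - y)) `^ l.
        rewrite -powRM ?addr_ge0 ?enorm_ge0//.
        apply: ge0_ler_powR; rewrite ?nnegrE ?mulr_ge0 ?addr_ge0 ?enorm_ge0//.
        have := enormD (x - y) y; rewrite subrK => h.
        have := mulr_ge0 (enorm_ge0 y) (enorm_ge0 (x - y)); lra.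
      apply: le_trans (ler_wpM2r _ h) _; first exact: Gk_ge0.
      have h2 := @moment_Gk_le l t (x - y) l0 t0.
      rewrite -mulrA; apply: le_trans (ler_wpM2l _ h2) _; first exact: powR_ge0.
      by rewrite /K le_eqVlt; apply/orP; left; apply/eqP; ring.
  rewrite ge0_integralZl//.
  - by rewrite integral_Gk ?mule1.
  - by apply/measurable_EFinP; exact: measurable_Gk.
  - by move=> x _; rewrite lee_fin Gk_ge0.
  - by rewrite lee_fin mulr_ge0 ?powR_ge0.
have mphi := measurable_absphi iphi.
rewrite (integral_wM iphi (g := fun x => (1 + enorm x) `^ l) t0)//; last by move=> x; exact: powR_ge0.
rewrite -ge0_integralZl//; last 2 first.
- by apply/measurable_EFinP; exact: measurable_funM.
- by move=> y _; rewrite lee_fin mulr_ge0 ?powR_ge0.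
have mG : measurable_fun setT (fun p : 'rV[R]_n * 'rV[R]_n =>
    ((1 + enorm p.1) `^ l * Gk (p.1 - p.2) (2 * t))%:E).
  apply/measurable_EFinP; apply: measurable_funM; last exact: measurable_Gk_diff.
  exact: measurableT_comp mW measurable_fst.
apply: ge0_le_integral => //.
- by move=> y _; rewrite mule_ge0// ?lee_fin//; apply: integral_ge0 => x _; rewrite lee_fin mulr_ge0 ?powR_ge0 ?Gk_ge0.
- apply: emeasurable_funM; last exact/measurable_EFinP.
  by apply: (measurable_fun_fubini_tonelli_G _ mG) => p; rewrite lee_fin mulr_ge0 ?powR_ge0 ?Gk_ge0.
- by apply: measurable_funeM; apply/measurable_EFinP; exact: measurable_funM.
- move=> y _; rewrite -EFinM mulrA EFinM; apply: lee_wpmul2r; first by rewrite lee_fin.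
  exact: inner.
Qed.

Lemma wnorm_le (phi : 'rV[R]_n -> R) (K l : R) : (leb n).-integrable setT (EFin \o phi) ->
  (wnorm K phi < +oo)%E -> 0 <= l -> l <= K ->
  exists B : R, forall (c t : R) (h : 'rV[R]_n -> R), 0 <= c -> 0 < t -> measurable_fun setT h ->
    (forall x, `|h x| <= c * w phi x t) -> (wnorm l h <= (c * (B * (1 + t) `^ (l / 2)))%:E)%E.
Proof.
move=> iphi wK l0 lK; have mphi := measurable_absphi iphi.
have mW k := @measurable_weight_enorm k.
have fphi : (\int[leb n]_y ((1 + enorm y) `^ l * `|phi y|)%:E < +oo)%E.
  apply: le_lt_trans wK; rewrite /wnorm intRNE.
  - apply: ge0_le_integral => //.
    + by move=> y _; rewrite lee_fin mulr_ge0 ?powR_ge0.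
    + by apply/measurable_EFinP; exact: measurable_funM.
    + by apply/measurable_EFinP; exact: measurable_funM.
    + move=> y _; rewrite lee_fin; apply: ler_wpM2r => //.
      by apply: ler_powR => //; rewrite lerDl enorm_ge0.
  - by apply/measurable_EFinP; exact: measurable_funM.
  - by move=> y; rewrite lee_fin mulr_ge0 ?powR_ge0.
have I0 : (0 <= \int[leb n]_y ((1 + enorm y) `^ l * `|phi y|)%:E)%E.
  by apply: integral_ge0 => y _; rewrite lee_fin mulr_ge0 ?powR_ge0.
pose I := fine (\int[leb n]_y ((1 + enorm y) `^ l * `|phi y|)%:E)%E.
have IE : (I%:E = \int[leb n]_y ((1 + enorm y) `^ l * `|phi y|)%:E)%E.
  by rewrite /I fineK// ge0_fin_numE.
exists ((16 * (l + 1)) `^ (l / 2) * 2 `^ (n%:R / 2) * I).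
move=> c t h c0 t0 mh hw.
rewrite /wnorm intRNE; last 2 first.
- apply/measurable_EFinP; apply: measurable_funM => //; exact: measurableT_comp.
- by move=> y; rewrite lee_fin mulr_ge0 ?powR_ge0.
apply: (@le_trans _ _ (\int[leb n]_x (c%:E * ((1 + enorm x) `^ l * w phi x t)%:E))%E).
  apply: ge0_le_integral => //.
  - by move=> y _; rewrite lee_fin mulr_ge0 ?powR_ge0.
  - apply/measurable_EFinP; apply: measurable_funM => //; exact: measurableT_comp.
  - apply: measurable_funeM; apply/measurable_EFinP; apply: measurable_funM => //; exact: measurable_w.
  - move=> x _; rewrite -EFinM lee_fin mulrCA; apply: ler_wpM2l; [exact: powR_ge0|exact: hw].
rewrite ge0_integralZl//; last 2 first.
- apply/measurable_EFinP; apply: measurable_funM => //; exact: measurable_w.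
- by move=> y _; rewrite lee_fin mulr_ge0 ?powR_ge0 ?w_ge0.
apply: le_trans (lee_wpmul2l _ (integral_moment_w iphi l0 t0)) _; first by rewrite lee_fin.
rewrite -IE -!EFinM lee_fin le_eqVlt; apply/orP; left; apply/eqP; ring.
Qed.

End moments.

(** * Asymptotics *)

(** Brings limits at infinity to sequences, for dominated convergence; the sequences may be assumed
    to exceed k + 1, which yields explicit rates. *)
Lemma near_pinfty_sequential {R : realType} (E : R -> R) (e : R) : 0 < e ->
  (forall u : nat -> R, (forall k, k.+1%:R <= u k) -> E (u k) @[k --> \oo] --> (0 : R)) ->
  \forall t \near +oo%R, `|E t| <= e.
Proof.
move=> e0 H; apply: contrapT => nH.
have bad (k : nat) : exists t : R, k.+1%:R <= t /\ e < `|E t|.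
  apply: contrapT => nb; apply: nH.
  have kt : \forall t \near +oo%R, k.+1%:R <= t :> R by exact: nbhs_pinfty_ge.
  apply: filterS kt => t kt; rewrite leNgt; apply/negP => et; apply: nb.
  by exists t.
have [u hu] := choice bad.
have := H u (fun k => (hu k).1); move/cvgrPdist_le => /(_ e e0)[N _ hN].
have := hN N (leqnn N); rewrite /= sub0r normrN leNgt => /negP; apply.
exact: (hu N).2.
Qed.

Section kdist_limit.
Context {R : realType} {n : nat} d (Z : measurableType d)
  (m : {sigma_finite_measure set Z -> \bar R}).
Local Notation TR := (measurableTypeR R).
Variables (yy : Z -> 'rV[R]_n) (ss psi : R -> Z -> R) (s0 psi0 : Z -> R).
Hypotheses (myy : measurable_fun setT yy) (mss : forall t, measurable_fun setT (ss t : Z -> TR)).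
Hypotheses (mpsi : forall t, measurable_fun setT (psi t)) (ipsi0 : m.-integrable setT (EFin \o psi0)).
Hypotheses (ss_ge0 : forall t z, 0 <= ss t z) (ss_le : forall t z, ss t z <= s0 z).
Hypotheses (psi_le : forall t z, `|psi t z| <= `|psi0 z|).
Hypothesis (ss_half : forall t z, 1 <= t -> ss t z <= t / 2).

Lemma integrable_majorized t : m.-integrable setT (EFin \o psi t).
Proof.
apply: (le_integrable measurableT _ _ ipsi0); first exact/measurable_EFinP.
by move=> z _ /=; rewrite lee_fin.
Qed.

Lemma measurable_kdist t : 1 <= t ->
  measurable_fun setT (fun z => kdist (yy z) (ss t z) t * `|psi t z|%:E)%E.
Proof.
move=> t1; have t0 : 0 < t := lt_le_trans ltr01 t1.
have mT : 0 < 3 * t / 4 + 1 by lra.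
have tau0 z : 0 < 3 * t / 4 - ss t z by have := ss_half z t1; lra.
apply: emeasurable_funM; last by apply/measurable_EFinP; exact: measurableT_comp.
have h := @measurable_smear_pair R n _ Z yy (ss t) t myy (mss t) t0 (fun z => ss_half z t1).
apply: (measurable_fun_fubini_tonelli_G (m1 := leb n) (fun p : 'rV[R]_n * Z =>
  (`|Gk (p.1 - yy p.2) (3 * t / 4 - ss t p.2) - Gk p.1 (3 * t / 4 + 1)|)%:E)).
  by apply/measurable_EFinP; exact: measurableT_comp.
by move=> p; rewrite lee_fin.
Qed.

(** For each z the distance tends to 0 like t^(-1/2), with a constant depending on the position and
    time of z, and it never exceeds 2. Dominated convergence thus needs no moment of [psi0]. The
    data depend on t because the source will be cut at t / 2. *)
Lemma kdist_integral_near0 (e : R) : 0 < e ->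
  \forall t \near +oo%R, (\int[m]_z (kdist (yy z) (ss t z) t * `|psi t z|%:E) <= e%:E)%E.
Proof.
move=> e0.
pose g t z : R := fine (kdist (yy z) (ss t z) t) * `|psi t z|.
have kfin t z : 1 <= t -> kdist (yy z) (ss t z) t \is a fin_num.
  move=> t1; rewrite ge0_fin_numE ?kdist_ge0//.
  apply: le_lt_trans (kdist_le2 _ _ (ss_half z t1)) _; last exact: ltry.
  exact: lt_le_trans t1.
have gE t z : 1 <= t -> (g t z)%:E = (kdist (yy z) (ss t z) t * `|psi t z|%:E)%E.
  by move=> t1; rewrite EFinM fineK// kfin.
have g0 t z : 0 <= g t z by rewrite mulr_ge0// fine_ge0// kdist_ge0.
have mg t : 1 <= t -> measurable_fun setT (g t).
  move=> t1; apply/measurable_EFinP; have := measurable_kdist t1.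
  by apply: eq_measurable_fun => z _; rewrite /= gE.
have gb t z : 1 <= t -> g t z <= 2 * `|psi0 z|.
  move=> t1; apply: ler_pM => //; first by rewrite fine_ge0// kdist_ge0.
  rewrite -lee_fin fineK ?kfin//; apply: kdist_le2; last exact: ss_half.
  exact: lt_le_trans t1.
have ib : m.-integrable setT (EFin \o (fun z => 2 * `|psi0 z|)).
  have := @integrableZl _ _ _ m setT measurableT 2 _ (integrable_norm ipsi0).
  by apply: eq_integrable.
have h : \forall t \near +oo%R, `|\int[m]_z g t z| <= e.
  apply: near_pinfty_sequential => // u hu.
  have u1 k : 1 <= u k by apply: le_trans (hu k); rewrite ler1n.
  rewrite [X in _ --> X](_ : 0 = \int[m]_z 0); last first.
    by rewrite /Rintegral integral0.
  apply: (Rintegral_dominated_cvg measurableT _ _ ib).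
  - by move=> k; exact: mg.
  - move=> z _.
    pose B := (2 * (n%:R / 2 + 2 * enorm (yy z) ^+ 2) + 8 * (n%:R / 2) * (3 + s0 z)) * `|psi0 z|.
    have B0 : 0 <= 8 * (n%:R / 2) :> R by rewrite mulr_ge0// divr_ge0.
    have up k : g (u k) z <= B / Num.sqrt k.+1%:R.
      have k0 : 0 < Num.sqrt k.+1%:R :> R by rewrite sqrtr_gt0.
      have k1 := kdist_le (yy z) (u1 k) (ss_ge0 (u k) z) (ss_half z (u1 k)).
      rewrite -(fineK (kfin _ _ (u1 k))) lee_fin in k1.
      rewrite /B mulrAC; apply: ler_pM => //; first by rewrite fine_ge0// kdist_ge0.
      apply: le_trans k1 _; apply: ler_pM.
      + apply: addr_ge0; first by rewrite mulr_ge0// addr_ge0 ?divr_ge0// mulr_ge0// sqr_ge0.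
        by rewrite mulr_ge0// addr_ge0.
      + by rewrite invr_ge0.
      + by rewrite lerD2l; apply: ler_wpM2l => //; rewrite lerD2l.
      + have uk : 0 < u k := lt_le_trans ltr01 (u1 k).
        by rewrite lef_pV2 ?posrE ?sqrtr_gt0//; exact: ler_wsqrtr.
    apply: (@squeeze_cvgr _ _ _ _ (fun=> 0) (fun k => B / Num.sqrt k.+1%:R)).
    + by apply: nearW => k; rewrite g0 up.
    + exact: cvg_cst.
    + rewrite -[X in _ --> X](mulr0 B); apply: cvgM; first exact: cvg_cst.
      have -> : (fun k : nat => (Num.sqrt k.+1%:R)^-1 : R) = (fun k => Num.sqrt k.+1%:R^-1).
        by apply/funext => k; rewrite sqrtrV.
      rewrite -[X in _ --> X](sqrtr0 R); apply: continuous_cvg; first exact: sqrt_continuous.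
      exact: cvg_harmonic.
  - by move=> k z _; rewrite ger0_norm ?g0 ?gb.
have ge1 : \forall t \near +oo%R, 1 <= t :> R by exact: nbhs_pinfty_ge.
apply: filterS2 h ge1 => t ht t1.
have ig : m.-integrable setT (EFin \o g t).
  apply: (le_integrable measurableT _ _ ib); first by apply/measurable_EFinP; exact: mg.
  by move=> z _ /=; rewrite lee_fin ger0_norm ?g0// (le_trans (gb _ _ t1))// ler_norm.
have -> : (\int[m]_z (kdist (yy z) (ss t z) t * `|psi t z|%:E) = \int[m]_z (g t z)%:E)%E.
  by apply: eq_integral => z _; rewrite gE.
rewrite -[leLHS]fineK; last exact: integrable_fin_num ig.
by rewrite lee_fin; apply: le_trans (ler_norm _) _.
Qed.

End kdist_limit.

Section asymptotics.
Context {R : realType} {n : nat} (phi : 'rV[R]_n -> R).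
Local Notation TR := (measurableTypeR R).
Local Notation cn := (@cn R n).
Local Notation lebR := (@lebesgue_measure R).
Hypothesis iphi : (leb n).-integrable setT (EFin \o phi).
Variables (theta : R -> R) (a Cth : R).
Hypothesis theta_ge0 : forall s : R, 0 <= theta s.
Hypothesis theta_eq0 : forall s : R, s <= 0 -> theta s = 0.
Hypothesis itheta : lebR.-integrable setT (EFin \o theta).
Hypothesis Cth0 : 0 <= Cth.
Hypothesis theta_near : forall t0 t : R, 0 < t -> t / 2 <= t0 -> t0 < t ->
  (\int[lebR]_(s in `]t0, t[) (Num.sqrt t / Num.sqrt (t - s) * theta s)%:E <=
   (Cth * Num.sqrt (t - t0) * (1 + Num.sqrt (t / 2)) `^ (- (1 + 2 * a)))%:E)%E.
Hypothesis a0 : 0 < a.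
Variable F : TR * 'rV[R]_n -> R.
Hypothesis sF : source phi theta F.
Implicit Types (x y : 'rV[R]_n) (s t e : R) (j : option 'I_n).

Definition limit_mass : R := \int[leb n]_y phi y + \int[STm n]_z F z.

Lemma source_eq0 z : z.1 <= 0 -> F z = 0.
Proof.
move=> z0; apply/normr0_eq0/eqP; rewrite eq_le normr_ge0 andbT.
by apply: le_trans (sF.2 z) _; rewrite /bd theta_eq0// mul0r.
Qed.

Let early t := slab (n := n) `]0, t / 2].
Let trunc t := F \_ (early t).
(** Source times are replaced by 0 where the truncated source vanishes; the kernels then have
    positive times at every point of space-time and the estimates of the far field apply without
    restricting the domain. *)
Let tm t : TR * 'rV[R]_n -> R := (fun z => z.1) \_ (early t).

Let mE t : measurable (early t).
Proof. exact: measurable_slab_itv. Qed.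

Let iF : (STm n).-integrable setT (EFin \o F).
Proof. exact: (integrable_source iphi theta_ge0 theta_eq0 itheta sF). Qed.

Let mtrunc t : measurable_fun setT (trunc t).
Proof. by apply/(measurable_restrictT _ (mE t)); exact: measurable_funTS sF.1. Qed.

Let mtm t : measurable_fun setT (tm t : _ -> TR).
Proof. by apply/(measurable_restrictT _ (mE t)); exact: measurable_funTS measurable_fst. Qed.

Let trunc_le t z : `|trunc t z| <= `|F z|.
Proof. by rewrite /trunc /patch; case: ifP => // _; rewrite normr0. Qed.

Let tm_ge0 t z : 0 <= tm t z.
Proof. by rewrite /tm /patch; case: ifPn => //; rewrite inE /early /slab /= in_itv/= => /andP[/ltW]. Qed.

Let tm_le t z : tm t z <= `|z.1|.
Proof. by rewrite /tm /patch; case: ifP => _ /=; [exact: (@ler_norm R)|exact: normr_ge0]. Qed.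

Let tm_half t z : 1 <= t -> tm t z <= t / 2.
Proof.
move=> t1; rewrite /tm /patch; case: ifPn => [|_]; last by rewrite divr_ge0// (le_trans ler01).
by rewrite inE /early /slab /= in_itv/= => /andP[].
Qed.

Let itrunc t : (STm n).-integrable setT (EFin \o trunc t).
Proof. exact: (integrable_majorized mtrunc iF trunc_le). Qed.

Lemma tail_near0 e : 0 < e -> \forall t \near +oo%R, `|\int[STm n]_z (F z - trunc t z)| <= e.
Proof.
move=> e0; apply: near_pinfty_sequential => // u hu.
rewrite [X in _ --> X](_ : 0 = \int[STm n]_z 0); last first.
  by rewrite /Rintegral integral0.
have ib : (STm n).-integrable setT (EFin \o (fun z => 2 * `|F z|)).
  have := @integrableZl _ _ _ (STm n) setT measurableT 2 _ (integrable_norm iF).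
  by apply: eq_integrable.
apply: (Rintegral_dominated_cvg measurableT _ _ ib).
- by move=> k; apply: measurable_funB; [exact: sF.1|exact: mtrunc].
- move=> z _; have [z0|z0] := leP z.1 0.
    rewrite (_ : (fun k => _) = fun=> 0); first exact: cvg_cst.
    apply/funext => k; apply/normr0_eq0/eqP; rewrite eq_le normr_ge0 andbT.
    apply: le_trans (ler_normB _ _) _; apply: le_trans (lerD (lexx _) (trunc_le _ _)) _.
    by rewrite source_eq0// normr0 addr0.
  apply: (@cvg_trans _ ((fun=> (0 : R)) @ \oo)); last exact: cvg_cst.
  apply: near_eq_cvg; have [N Nz] : exists N : nat, 2 * z.1 <= N%:R.
    by exists (Num.bound (2 * z.1)); exact/ltW/archi_boundP/mulr_ge0/ltW.
  exists N => // k /= Nk; rewrite /trunc /patch mem_set ?subrr//.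
  rewrite /early /slab /= in_itv/= z0/= ler_pdivlMr// mulrC (le_trans Nz)//.
  by apply: le_trans (hu k); rewrite ler_nat (leq_trans Nk).
- move=> k z _; apply: le_trans (ler_normB _ _) _.
  by rewrite mulrDl mul1r lerD.
Qed.

(** The four terms are the datum, the source before t / 2, the source between t / 2 and t, and the
    part of the limit mass that has not been emitted by time t / 2. The first two are superpositions
    of kernel differences; [t - 0] gives the first the same form as the second. *)
Lemma V_sub_mass j x t : 1 <= t ->
  V phi F j x t - limit_mass * Kj j x (1 + t) =
  \int[leb n]_y ((Kj j (x - y) (t - 0) - Kj j x (1 + t)) * phi y) +
  \int[STm n]_z ((Kj j (x - z.2) (t - tm t z) - Kj j x (1 + t)) * trunc t z) +
  duhamel_near F (t / 2) j x t - Kj j x (1 + t) * \int[STm n]_z (F z - trunc t z).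
Proof.
move=> t1; have t0 : 0 < t := lt_le_trans ltr01 t1.
have t20 : 0 <= t / 2 by rewrite divr_ge0// ltW.
have t2t : t / 2 < t by lra.
have iK1 := heat_flow_integrable iphi j x t0.
have iK2 := integrableZl measurableT (Kj j x (1 + t)) iphi.
have E1 : \int[leb n]_y ((Kj j (x - y) (t - 0) - Kj j x (1 + t)) * phi y) =
    heat_flow phi j x t - Kj j x (1 + t) * \int[leb n]_y phi y.
  rewrite -RintegralZl// /heat_flow -lock -RintegralB//.
  by apply: eq_Rintegral => y _; rewrite subr0 mulrBl.
have t4 : 0 < t / 4 by lra.
have sst z : setT z -> tm t z + t / 4 / 2 <= t by have := tm_half z t1; lra.
have iK3 : (STm n).-integrable setT (fun z => (Kj j (x - z.2) (t - tm t z) * trunc t z)%:E).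
  exact: (@integrable_Kj R n _ _ (STm n) setT snd (tm t) (trunc t) (t / 4) measurableT
    measurable_snd (mtm t) (itrunc t) t4 j x t sst).
have iK4 := integrableZl measurableT (Kj j x (1 + t)) (itrunc t).
have E2 : \int[STm n]_z ((Kj j (x - z.2) (t - tm t z) - Kj j x (1 + t)) * trunc t z) =
    duhamel_far F (t / 2) j x t - Kj j x (1 + t) * \int[STm n]_z trunc t z.
  rewrite -RintegralZl// /duhamel_far /Jint (Rintegral_mkcond _ (slab _)) -RintegralB//; last first.
    move: iK3; apply: eq_integrable => // z _ /=; congr EFin.
    rewrite /trunc /tm /patch; case: ifP => //; by rewrite mulr0.
  apply: eq_Rintegral => z _; rewrite mulrBl; congr (_ - _).
  by rewrite /trunc /tm /patch; case: ifP => //; rewrite mulr0.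
rewrite E1 E2 RintegralB//.
rewrite /V (duhamel_split iphi theta_ge0 itheta theta_near j x sF t20 t2t) /limit_mass.
by ring.
Qed.

(** With r = sqrt (t / 2) the expression is at most a constant times (1 + r)^(-2a), which tends to 0
    since a > 0. *)
Lemma near_factor_small e : 0 < e ->
  \forall t \near +oo%R, cn * (Cth * Num.sqrt (t - t / 2) * (1 + Num.sqrt (t / 2)) `^ (- (1 + 2 * a))) <= e.
Proof.
move=> e0; have cn0 := @cn_gt0 R n.
have k0 : 0 < cn * (Cth + 1) by rewrite mulr_gt0// ltr_wpDl.
pose e' := e / (cn * (Cth + 1)); have e'0 : 0 < e' by rewrite divr_gt0.
(* [Y] solves Y^(-2a) = e', and 1 + sqrt (t / 2) exceeds it once t >= 2 Y^2. *)
pose Y := e' `^ (- (2 * a)^-1); have Y0 : 0 < Y by rewrite powR_gt0.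
have a2 : 0 < 2 * a by rewrite mulr_gt0.
have tY : \forall t \near +oo%R, 2 * Y ^+ 2 <= t :> R by apply: nbhs_pinfty_ge; exact: num_real.
apply: filterS tY => t tY; have t0 : 0 <= t by apply: le_trans tY; rewrite mulr_ge0 ?sqr_ge0.
have -> : t - t / 2 = t / 2 by field.
set r := Num.sqrt (t / 2); have r0 : 0 <= r by exact: sqrtr_ge0.
have Yr : Y <= 1 + r.
  apply: (@le_trans _ _ r); last by rewrite lerDr.
  rewrite -[leLHS]ger0_norm ?(ltW Y0)// -sqrtr_sqr ler_wsqrtr//.
  by rewrite ler_pdivlMr// mulrC.
have h : r * (1 + r) `^ (- (1 + 2 * a)) <= e'.
  have r1 : 0 < 1 + r by rewrite ltr_wpDr.
  apply: (@le_trans _ _ ((1 + r) * (1 + r) `^ (- (1 + 2 * a)))).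
    by apply: ler_wpM2r; rewrite ?powR_ge0// lerDr.
  rewrite -{1}[1 + r]powRr1 ?(ltW r1)// -powRD; last by apply/implyP => _; rewrite gt_eqF.
  have -> : 1 + - (1 + 2 * a) = - (2 * a) by ring.
  have -> : e' = Y `^ (- (2 * a)).
    by rewrite /Y -powRrM mulrNN mulVf ?gt_eqF// powRr1// ltW.
  rewrite !powRN lef_pV2 ?posrE ?powR_gt0//.
  by apply: ge0_ler_powR; rewrite ?nnegrE ?(ltW a2) ?(ltW Y0) ?(ltW r1).
apply: (@le_trans _ _ (cn * (Cth + 1) * e')).
  rewrite -!mulrA; apply: ler_wpM2l; first exact: ltW.
  apply: ler_pM => //; first by rewrite mulr_ge0// powR_ge0.
  by rewrite lerDl.
by rewrite /e' mulrCA divff ?mulr1// gt_eqF.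
Qed.

(** A single majorant bounds the error of the function and the weighted errors of all its
    derivatives, with smallness in L^1 and in the sup norm; every limit in (iii) is then read off
    from it. *)
Lemma asymptotic_dominated e : 0 < e -> \forall t \near +oo%R, exists P, dominated t e P /\
  forall j x, sg j t * `|V phi F j x t - limit_mass * Kj j x (1 + t)| <= P x.
Proof.
move=> e0; have cn0 := @cn_gt0 R n; have m0 := mass_ge0 phi.
(* Error budget: the two far-field terms cost 2 cn times e / (8 cn) each, together e / 2; the source
   near s = t and the tail cost at most e / 4 each. Adding 1 to the mass covers a zero datum. *)
have e8 : 0 < e / (8 * cn) by rewrite divr_gt0// mulr_gt0.
have e4m : 0 < e / (4 * (mass phi + 1)) by rewrite divr_gt0// mulr_gt0// ltr_wpDl.
have e4 : 0 < e / (4 * cn) by rewrite divr_gt0// mulr_gt0.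
have n1 := @kdist_integral_near0 R n _ _ (leb n) id (fun _ _ => 0) (fun=> phi) (fun=> 0) phi
  (@measurable_id _ _ _) (fun _ => @measurable_cst _ _ _ _ _ _) (fun=> measurable_phi iphi) iphi
  (fun _ _ => lexx 0) (fun _ _ => lexx 0) (fun _ _ => lexx _) _ _ e8.
have n2 := @kdist_integral_near0 R n _ _ (STm n) snd tm trunc (fun z => `|z.1|) F
  measurable_snd mtm mtrunc iF tm_ge0 tm_le trunc_le tm_half _ e8.
have n3 := near_factor_small e4m.
have n4 := tail_near0 e4.
have n5 : \forall t \near +oo%R, 1 <= t :> R by exact: nbhs_pinfty_ge.
have {}n1 := n1 _; near=> t.
have t1 : 1 <= t by near: t.
have t0 : 0 < t := lt_le_trans ltr01 t1.
have h1 : (\int[leb n]_z (kdist z 0 t * `|phi z|%:E) <= (e / (8 * cn))%:E)%E.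
  near: t; apply: n1 => t _ t1; by rewrite divr_ge0// (le_trans ler01).
have h2 : (\int[STm n]_z (kdist z.2 (tm t z) t * `|trunc t z|%:E) <= (e / (8 * cn))%:E)%E.
  by near: t.
have h3 : cn * (Cth * Num.sqrt (t - t / 2) * (1 + Num.sqrt (t / 2)) `^ (- (1 + 2 * a))) <=
    e / (4 * (mass phi + 1)) by near: t.
have h4 : `|\int[STm n]_z (F z - trunc t z)| <= e / (4 * cn) by near: t.
have ss0 (z : 'rV[R]_n) : 0 <= t / 2 by rewrite divr_ge0// ltW.
have [P1 [dP1 P1E]] := dominated_smear t0
  (@measurable_smear R n _ _ (leb n) id (fun=> 0) phi t (@measurable_id _ _ _)
    (@measurable_cst _ _ _ _ _ _) iphi t0 ss0)
  (fun y => smear_ge0 _ _ _ _ _ _)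
  (eq_ind_r (fun v => (v <= _)%E) h1 (@integral_smear R n _ _ (leb n) id (fun=> 0) phi t
    (@measurable_id _ _ _) (@measurable_cst _ _ _ _ _ _) iphi t0 ss0)).
have [P2 [dP2 P2E]] := dominated_smear t0
  (@measurable_smear R n _ _ (STm n) snd (tm t) (trunc t) t measurable_snd
    (mtm t) (itrunc t) t0 (fun z => tm_half z t1))
  (fun y => smear_ge0 _ _ _ _ _ _)
  (eq_ind_r (fun v => (v <= _)%E) h2 (@integral_smear R n _ _ (STm n) snd (tm t) (trunc t) t
    measurable_snd (mtm t) (itrunc t) t0 (fun z => tm_half z t1))).
exists (fun x => (2 * cn * (P1 x + P2 x) + e / (4 * (mass phi + 1)) * w phi x t) +
   e / (4 * cn) * cn * Gk x (2 * (1 + t))).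
split.
  have c2 : 0 <= 2 * cn by rewrite mulr_ge0// ltW.
  have c4 : 0 <= e / (4 * cn) * cn by rewrite mulr_ge0// ltW.
  have dom := dominatedD (dominatedD (dominatedZ c2 (dominatedD dP1 dP2))
    (dominatedZ (ltW e4m) (dominated_w iphi t0))) (dominatedZ c4 (dominated_Gk t0)).
  apply: dominated_le dom.
  have -> : 2 * cn * (e / (8 * cn) + e / (8 * cn)) = e / 2 by field; rewrite gt_eqF.
  have -> : e / (4 * cn) * cn * 1 = e / 4 by field; rewrite gt_eqF.
  have mle : e / (4 * (mass phi + 1)) * mass phi <= e / 4.
    have m1 : 0 < mass phi + 1 by rewrite ltr_wpDl.
    have -> : e / (4 * (mass phi + 1)) * mass phi = e / 4 * (mass phi / (mass phi + 1)).
      by field; rewrite gt_eqF.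
    by rewrite ler_piMr ?divr_ge0 ?(ltW e0)// ler_pdivrMr// mul1r lerDl.
  rewrite [leRHS](_ : e = e / 2 + e / 4 + e / 4); last by field.
  by rewrite lerD2r lerD2l.
move=> j x; rewrite V_sub_mass//.
set T1 := \int[_]_y _; set T2 := \int[_]_z _; set T3 := duhamel_near _ _ _ _ _; set T4 := _ * \int[_]_z _.
have sg0 := sg_ge0 j t.
have b1 : sg j t * `|T1| <= 2 * cn * P1 x.
  rewrite -lee_fin; have := @far_field_le R n _ _ (leb n) id (fun=> 0) phi t (@measurable_id _ _ _)
    (@measurable_cst _ _ _ _ _ _) iphi t0 ss0 j x.
  by rewrite P1E.
have b2 : sg j t * `|T2| <= 2 * cn * P2 x.
  rewrite -lee_fin; have := @far_field_le R n _ _ (STm n) snd (tm t) (trunc t) t measurable_snd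
    (mtm t) (itrunc t) t0 (fun z => tm_half z t1) j x.
  by rewrite P2E.
have b3 : sg j t * `|T3| <= e / (4 * (mass phi + 1)) * w phi x t.
  have t2t : t / 2 < t by rewrite ltr_pdivrMr// ltr_pMr// ltr1n.
  have := duhamel_near_le iphi theta_ge0 itheta theta_near j x sF t0 (lexx _) t2t.
  by move=> /le_trans; apply; apply: ler_wpM2r => //; exact: w_ge0.
have b4 : sg j t * `|T4| <= e / (4 * cn) * cn * Gk x (2 * (1 + t)).
  rewrite /T4 normrM mulrA mulrC -[leRHS]mulrA; apply: ler_pM => //; first by rewrite mulr_ge0.
  have t10 : 0 < 1 + t by rewrite addr_gt0.
  have := sg_Kj_le j x t10 (lexx _); rewrite divff ?gt_eqF ?sqrtr_gt0// mulr1; apply: le_trans.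
  apply: ler_wpM2r => //; case: (j) => //= _; by apply: ler_wsqrtr; rewrite lerDr.
apply: (@le_trans _ _ (sg j t * (`|T1| + `|T2| + `|T3| + `|T4|))).
  apply: ler_wpM2l => //; apply: le_trans (ler_normB _ _) _; rewrite lerD2r.
  by apply: le_trans (ler_normD _ _) _; rewrite lerD2r; exact: ler_normD.
rewrite [leLHS](_ : _ = sg j t * `|T1| + sg j t * `|T2| + sg j t * `|T3| + sg j t * `|T4|); last by ring.
apply: lerD => //; apply: lerD => //.
by rewrite mulrDr; exact: lerD.
Unshelve. all: by end_near. Qed.

End asymptotics.

(** * Properties of the solution *)

Section solution.
Context {R : realType} {n : nat} (phi : 'rV[R]_n -> R).
Local Notation TR := (measurableTypeR R).
Local Notation lebR := (@lebesgue_measure R).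
Hypothesis iphi : (leb n).-integrable setT (EFin \o phi).
Variables (theta : R -> R) (a Cth : R).
Hypothesis theta_ge0 : forall s : R, 0 <= theta s.
Hypothesis theta_eq0 : forall s : R, s <= 0 -> theta s = 0.
Hypothesis itheta : lebR.-integrable setT (EFin \o theta).
Hypothesis Cth0 : 0 <= Cth.
Hypothesis theta_near : forall t0 t : R, 0 < t -> t / 2 <= t0 -> t0 < t ->
  (\int[lebR]_(s in `]t0, t[) (Num.sqrt t / Num.sqrt (t - s) * theta s)%:E <=
   (Cth * Num.sqrt (t - t0) * (1 + Num.sqrt (t / 2)) `^ (- (1 + 2 * a)))%:E)%E.
Hypothesis a0 : 0 < a.
Variable F : TR * 'rV[R]_n -> R.
Hypothesis sF : source phi theta F.
Variable B : R.
Hypothesis B0 : 0 <= B.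
Hypothesis V_le : forall j x (t : R), 0 < t -> sg j t * `|V phi F j x t| <= B * w phi x t.
Implicit Types (x y : 'rV[R]_n) (s t e : R) (j : option 'I_n).

Local Notation u := (fun x t => V phi F None x t).
Local Notation M := (limit_mass phi F).

Let iF : (STm n).-integrable setT (EFin \o F).
Proof. exact: (integrable_source iphi theta_ge0 theta_eq0 itheta sF). Qed.

Lemma is_derive_V i x t : 0 < t ->
  is_derive x (delta_mx ord0 i) (fun y => u y t) (V phi F (Some i) x t).
Proof.
move=> t0; rewrite /V.
have d1 := is_derive_heat_flow iphi i x t0.
have d2 := is_derive_duhamel iphi theta_ge0 theta_eq0 itheta Cth0 theta_near a0 i x sF t0.
exact: is_deriveD.
Qed.

Lemma gradx_V x t : 0 < t -> gradx (fun y => u y t) x = \row_i V phi F (Some i) x t.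
Proof.
move=> t0; apply/rowP => i; rewrite !mxE.
by have d := is_derive_V i x t0; rewrite derive_val.
Qed.

Lemma has_partials_V x t : 0 < t -> has_partials (fun y => u y t) x.
Proof. by move=> t0 i; have d := is_derive_V i x t0; exact: ex_derive. Qed.

Lemma continuous_V j x t : 0 < t -> {for (x, t), continuous (fun p => V phi F j p.1 p.2)}.
Proof.
move=> t0.
apply: (@continuousD _ _ _ (fun p : 'rV[R]_n * R => heat_flow phi j p.1 p.2)
  (fun p : 'rV[R]_n * R => duhamel F j p.1 p.2)); first exact: continuous_heat_flow.
by apply: (continuous_duhamel iphi theta_ge0 theta_eq0 itheta Cth0 theta_near a0).
Qed.

Lemma continuous_V_space j x t : 0 < t -> {for x, continuous (fun y => V phi F j y t)}.
Proof.
move=> t0; apply: (@continuous_comp _ _ _ (fun y : 'rV[R]_n => (y, t))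
  (fun p : 'rV[R]_n * R => V phi F j p.1 p.2)); last exact: continuous_V.
by apply: continuous_pair; [exact: cvg_id|exact: cst_continuous].
Qed.

Lemma measurable_V j t : 0 < t -> measurable_fun setT (fun x => V phi F j x t).
Proof.
move=> t0; apply: continuous_on_measurable_rV; first exact: openT.
by move=> x _; exact: continuous_V_space.
Qed.

Lemma measurable_enorm_row (g : 'I_n -> 'rV[R]_n -> R) :
  (forall i x, {for x, continuous (g i)}) ->
  measurable_fun setT (fun x => enorm (\row_i g i x)).
Proof.
move=> cg; apply: continuous_on_measurable_rV; first exact: openT.
move=> x _; apply: (@continuous_comp _ _ _ (fun x => \row_i g i x) (@enorm R n)).
  exact: (continuous_row (fun i => cg i x)).
exact: continuous_enorm.
Qed.

Lemma measurable_grad t : 0 < t ->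
  measurable_fun setT (fun x => enorm (gradx (fun y => u y t) x)).
Proof.
move=> t0; rewrite (_ : (fun x => _) = (fun x => enorm (\row_i V phi F (Some i) x t))).
  by apply: measurable_enorm_row => i x; exact: continuous_V_space.
by apply/funext => x; rewrite gradx_V.
Qed.

Lemma u_le x t : 0 < t -> `|u x t| <= B * w phi x t.
Proof. by move=> t0; have := V_le None x t0; rewrite /= mul1r. Qed.

Lemma enorm_row_le (v : 'rV[R]_n) t (P : R) : 0 < t -> 0 <= P ->
  (forall i, Num.sqrt t * `|v ord0 i| <= P) -> enorm v <= n%:R / Num.sqrt t * P.
Proof.
move=> t0 P0 vP; have st : 0 < Num.sqrt t by rewrite sqrtr_gt0.
have -> : n%:R / Num.sqrt t * P = n%:R * (P / Num.sqrt t) by ring.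
apply: enorm_le; first by rewrite divr_ge0// ltW.
by move=> i; rewrite ler_pdivlMr// mulrC.
Qed.

Lemma grad_le x t : 0 < t ->
  enorm (gradx (fun y => u y t) x) <= n%:R / Num.sqrt t * B * w phi x t.
Proof.
move=> t0; rewrite gradx_V// -mulrA; apply: enorm_row_le => //.
  by rewrite mulr_ge0// w_ge0.
by move=> i; rewrite mxE; exact: (V_le (Some i)).
Qed.

(** The added 1 makes the size positive also for a zero datum, as [Lqnorm_dominated] requires. *)
Let E1 := B * mass phi + 1.

Let E1_gt0 : 0 < E1.
Proof. by rewrite ltr_wpDl// mulr_ge0// mass_ge0. Qed.

Lemma Lqnorm_u q t : (1 <= q)%E -> 0 < t ->
  ((t `^ (n%:R / 2 * (1 - qinv q)))%:E * Lqnorm q (fun x => u x t) <= E1%:E)%E.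
Proof.
move=> q1 t0; apply: (Lqnorm_dominated q1 t0 E1_gt0 (measurable_V None t0) (fun x => u_le x t0)).
apply: (@dominated_le _ _ _ (B * mass phi)); first by rewrite lerDl.
by apply: dominatedZ => //; exact: dominated_w.
Qed.

Lemma Lqnorm_grad q t : (1 <= q)%E -> 0 < t ->
  ((t `^ (n%:R / 2 * (1 - qinv q)))%:E * Lqnorm q (fun x => enorm (gradx (fun y => u y t) x)) <=
   ((n%:R + 1) / Num.sqrt t * E1)%:E)%E.
Proof.
move=> q1 t0; have st : 0 < Num.sqrt t by rewrite sqrtr_gt0.
have nt0 : 0 <= n%:R / Num.sqrt t by rewrite divr_ge0// ltW.
have e0 : 0 < (n%:R + 1) / Num.sqrt t * E1 by rewrite mulr_gt0// divr_gt0// ltr_wpDl.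
apply: (@Lqnorm_dominated R n q t _ (fun x => n%:R / Num.sqrt t * (B * w phi x t))) => //.
- exact: measurable_grad.
- by move=> x; rewrite ger0_norm ?enorm_ge0// mulrA; exact: grad_le.
- apply: (@dominated_le _ _ _ (n%:R / Num.sqrt t * (B * mass phi))); last first.
    by apply: dominatedZ => //; apply: dominatedZ => //; exact: dominated_w.
  apply: ler_pM => //; first by rewrite mulr_ge0// mass_ge0.
    by apply: ler_wpM2r; rewrite ?invr_ge0 ?(ltW st)// lerDl.
  by rewrite lerDl.
Qed.

Lemma decay_Lq q : (1 <= q)%E -> exists B' : R, forall t : R, 0 < t ->
  ((t `^ (n%:R / 2 * (1 - qinv q)))%:E * (Lqnorm q (fun x => u x t) +
    (t `^ (2^-1))%:E * Lqnorm q (fun x => enorm (gradx (fun y => u y t) x))) <= B'%:E)%E.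
Proof.
move=> q1; exists (E1 + (n%:R + 1) * E1) => t t0.
have st : 0 < Num.sqrt t by rewrite sqrtr_gt0.
rewrite powR12_sqrt ?(ltW t0)// ge0_muleDr ?Lqnorm_ge0//; last first.
  by rewrite mule_ge0 ?Lqnorm_ge0// lee_fin.
rewrite EFinD; apply: leeD; first exact: Lqnorm_u.
rewrite muleCA.
apply: le_trans (lee_wpmul2l _ (Lqnorm_grad q1 t0)) _; first by rewrite lee_fin.
by rewrite -EFinM lee_fin mulrA mulrCA divff ?mulr1// gt_eqF.
Qed.

Lemma moments_bounded (K l : R) : (wnorm K phi < +oo)%E -> 0 <= l <= K ->
  exists B' : R, forall t : R, 0 < t ->
  (((1 + t) `^ (- (l / 2)))%:E * (wnorm l (fun x => u x t) +
    (t `^ (2^-1))%:E * wnorm l (fun x => enorm (gradx (fun y => u y t) x))) <= B'%:E)%E.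
Proof.
move=> wK /andP[l0 lK]; have [D hD] := wnorm_le iphi wK l0 lK.
exists (B * D + n%:R * B * D) => t t0.
have st : 0 < Num.sqrt t by rewrite sqrtr_gt0.
have nt0 : 0 <= n%:R / Num.sqrt t * B by rewrite mulr_ge0// divr_ge0// ltW.
have h1 := hD B t (fun x => u x t) B0 t0 (measurable_V None t0) (fun x => u_le x t0).
have h2 := hD _ t (fun x => enorm (gradx (fun y => u y t) x)) nt0 t0 (measurable_grad t0)
  (fun x => eq_ind_r (fun v => v <= _) (grad_le x t0) (ger0_norm (enorm_ge0 _))).
rewrite powR12_sqrt ?(ltW t0)//.
have s0 : (0 <= (Num.sqrt t)%:E)%E by rewrite lee_fin.
have h3 := leeD h1 (lee_wpmul2l s0 h2); rewrite -EFinM -EFinD in h3.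
apply: le_trans (lee_wpmul2l _ h3) _; first by rewrite lee_fin powR_ge0.
rewrite -EFinM lee_fin powRN le_eqVlt; apply/orP; left; apply/eqP.
by field; rewrite !gt_eqF// powR_gt0// addr_gt0.
Qed.

Lemma locally_bounded (b c : R) : 0 < b -> b <= c -> exists B' : R, forall t, b <= t <= c ->
  (Lqnorm 1%E (fun x => u x t) + Lqnorm 1%E (fun x => enorm (gradx (fun y => u y t) x)) <= B'%:E)%E.
Proof.
move=> b0 bc; exists (E1 + (n%:R + 1) / Num.sqrt b * E1) => t /andP[bt _].
have t0 : 0 < t := lt_le_trans b0 bt.
have sb : 0 < Num.sqrt b by rewrite sqrtr_gt0.
rewrite EFinD; apply: leeD.
  by have := Lqnorm_u (lexx 1%E) t0; rewrite /qinv invr1 subrr mulr0 powRr0 mul1e.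
have := Lqnorm_grad (lexx 1%E) t0; rewrite /qinv invr1 subrr mulr0 powRr0 mul1e.
move=> /le_trans; apply; rewrite lee_fin; apply: ler_wpM2r; first exact: ltW.
apply: ler_wpM2l; first by rewrite addr_ge0.
by rewrite lef_pV2 ?posrE ?sqrtr_gt0// ler_wsqrtr.
Qed.

Lemma within_continuous_u : {within [set z : 'rV[R]_n * R | 0 < z.2], continuous (fun z => u z.1 z.2)}.
Proof.
apply: continuous_in_subspaceT => -[x t]; rewrite inE /= => t0.
exact: continuous_V.
Qed.

Lemma within_continuous_grad : {within [set z : 'rV[R]_n * R | 0 < z.2],
  continuous (fun z => gradx (fun y => u y z.2) z.1)}.
Proof.
have h : {within [set z : 'rV[R]_n * R | 0 < z.2],
    continuous (fun z : 'rV[R]_n * R => \row_i V phi F (Some i) z.1 z.2 : 'rV[R]_n)}.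
  apply: continuous_in_subspaceT => -[x t]; rewrite inE /= => t0.
  by apply: continuous_row => i; exact: continuous_V.
apply: (subspace_eq_continuous _ h) => -[x t]; rewrite inE /= => t0.
by apply/esym; exact: gradx_V.
Qed.

Variable f : 'rV[R]_n -> R -> R -> 'rV[R]_n -> R.
Hypothesis FE : forall z : TR * 'rV[R]_n, 0 < z.1 ->
  F z = f z.2 z.1 (V phi F None z.2 z.1) (\row_i V phi F (Some i) z.2 z.1).

Lemma F_gradx s y : 0 < s -> f y s (u y s) (gradx (fun x => u x s) y) = F (s, y).
Proof. by move=> s0; rewrite gradx_V// FE. Qed.

(** Passes from the iterated integrals of the statement to integrals over slabs of space-time; the
    two integrands need to agree only at the times in [A]. *)
Lemma intRN_slab (A : set TR) (G : TR * 'rV[R]_n -> R) (g : R -> 'rV[R]_n -> R) :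
  measurable A -> measurable_fun (slab A) G -> (forall z, A z.1 -> 0 <= G z) ->
  (forall s y, A s -> g s y = G (s, y)) ->
  (\int[lebR]_(s in A) intRN (fun y => (g s y)%:E) = \int[STm n]_(z in slab A) (G z)%:E)%E.
Proof.
move=> mA mG G0 gG; have mS : measurable (slab A : set (TR * 'rV[R]_n)) by exact: measurable_slab.
rewrite integral_STm_slab//; last exact/measurable_EFinP.
have mGr : measurable_fun setT ((EFin \o G) \_ (slab A)).
  by apply/(measurable_restrictT _ mS); exact/measurable_EFinP.
apply: eq_integral => s; rewrite inE => As.
rewrite (_ : (fun y => (g s y)%:E) = (fun y => (G (s, y))%:E)); last first.
  by apply/funext => y; rewrite gG.
rewrite intRNE//; last by move=> y; rewrite lee_fin; exact: G0.
apply: (eq_measurable_fun _ _ (measurableT_comp mGr (pair1_measurable s))) => y _.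
by rewrite /= /patch mem_set.
Qed.

Lemma integral_slab_sub (A : set TR) (h : TR * 'rV[R]_n -> R) (g : R -> 'rV[R]_n -> R) :
  measurable A -> (STm n).-integrable (slab A) (EFin \o h) ->
  (forall s y, A s -> g s y = h (s, y)) ->
  ((\int[lebR]_(s in A) intRN (fun y => (Num.max (g s y) 0)%:E)) -
   (\int[lebR]_(s in A) intRN (fun y => (Num.max (- g s y) 0)%:E)) =
   (\int[STm n]_(z in slab A) h z)%R%:E)%E.
Proof.
move=> mA ih gh; have mh : measurable_fun (slab A) h by apply/measurable_EFinP; exact: measurable_int ih.
rewrite (@intRN_slab A (fun z => Num.max (h z) 0))//; last 3 first.
- exact: measurable_maxr.
- by move=> z _; rewrite le_max lexx orbT.
- by move=> s y As; rewrite gh.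
rewrite (@intRN_slab A (fun z => Num.max (- h z) 0))//; last 3 first.
- by apply: measurable_maxr => //; exact: measurableT_comp.
- by move=> z _; rewrite le_max lexx orbT.
- by move=> s y As; rewrite gh.
have mS : measurable (slab A : set (TR * 'rV[R]_n)) by exact: measurable_slab.
rewrite /Rintegral fineK; last exact: (integrable_fin_num mS ih).
rewrite [RHS]integralE; congr (_ - _)%E; apply: eq_integral => z _.
  by rewrite funeposE /= EFin_max.
by rewrite funenegE /= EFin_max.
Qed.

Lemma itv_oo_set (t : R) : [set s : R | 0 < s < t] = `]0, t[%classic.
Proof. by apply/seteqP; split => s; rewrite /= in_itv. Qed.

Lemma itv_oy_set : [set s : R | 0 < s] = `]0, +oo[%classic.
Proof. by apply/seteqP; split => s; rewrite /= in_itv/= andbT. Qed.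

Lemma integrable_abs_lty d (Z : measurableType d) (m : {measure set Z -> \bar R}) (D : set Z) (h : Z -> R) :
  m.-integrable D (EFin \o h) -> (\int[m]_(z in D) (`|h z|)%:E < +oo)%E.
Proof. by move=> /integrableP[_]. Qed.

Lemma sintRN_EFin (h : 'rV[R]_n -> R) : (leb n).-integrable setT (EFin \o h) ->
  sintRN h = (\int[leb n]_y h y)%:E.
Proof.
move=> ih; rewrite sintRNE// /Rintegral fineK//; exact: integrable_fin_num ih.
Qed.

Lemma mild_formula x t : 0 < t ->
  let H := fun s xi => Gk (x - xi) (t - s) * f xi s (u xi s) (gradx (fun y => u y s) xi) in
  (intRN (fun xi => (`|Gk (x - xi) t * phi xi|)%R%:E) < +oo)%E /\
  (\int[lebR]_(s in [set s : R | (0 < s < t)%R]) intRN (fun xi => (`|H s xi|)%R%:E) < +oo)%E /\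
  ((u x t)%:E = sintRN (fun xi => (Gk (x - xi) t * phi xi)%R)
    + ((\int[lebR]_(s in [set s : R | (0 < s < t)%R]) intRN (fun xi => (Num.max (H s xi) 0)%R%:E))
     - (\int[lebR]_(s in [set s : R | (0 < s < t)%R]) intRN (fun xi => (Num.max (- H s xi) 0)%R%:E))))%E.
Proof.
move=> t0 H.
have iS : (leb n).-integrable setT (EFin \o (fun xi => Gk (x - xi) t * phi xi)).
  by have := heat_flow_integrable iphi None x t0; apply: eq_integrable => // y _; rewrite KjE.
have iD : (STm n).-integrable (slab `]0, t[) (EFin \o (fun z => Kj None (x - z.2) (t - z.1) * F z)).
  exact: (integrable_KF iphi theta_ge0 itheta theta_near None x sF t0).
have HE s y : [set s : R | 0 < s < t] s -> H s y = Kj None (x - y) (t - s) * F (s, y).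
  by move=> /= /andP[s0 _]; rewrite /H F_gradx// KjE.
have mA : measurable ([set s : R | 0 < s < t] : set TR).
  by rewrite itv_oo_set; exact: measurable_itv.
have mS := measurable_int _ iS.
split; last split.
- rewrite intRNE; [exact: integrable_abs_lty iS| |by move=> y; rewrite lee_fin].
  by apply/measurable_EFinP; apply: measurableT_comp => //; exact/measurable_EFinP.
- rewrite (@intRN_slab _ (fun z => `|Kj None (x - z.2) (t - z.1) * F z|))//.
  + by rewrite itv_oo_set; exact: integrable_abs_lty iD.
  + rewrite itv_oo_set; apply: measurableT_comp => //.
    by apply/measurable_EFinP; exact: measurable_int iD.
  + by move=> s y /HE ->.
- rewrite (@integral_slab_sub _ (fun z => Kj None (x - z.2) (t - z.1) * F z))//.
  rewrite sintRN_EFin// -EFinD itv_oo_set /V; congr (_ + _)%:E.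
  by rewrite /heat_flow -lock; apply: eq_Rintegral => y _; rewrite KjE.
Qed.

Lemma mild_solution_u : mild_solution f phi u.
Proof.
split; first exact: locally_bounded.
(* The Duhamel formula holds at every point with t > 0, so the exceptional set is empty. *)
exists set0; split; first exact: sigma_algebra0.
split; last by move=> x t t0 _; exact: mild_formula.
apply: integral0_eq => t _; rewrite (_ : (fun x => _) = (fun x : 'rV[R]_n => 0%E)).
  by rewrite intRNE// ?integral0//.
by apply/funext => x; rewrite indicE in_set0.
Qed.

Lemma source_mass : (\int[lebR]_(t in [set t : R | (0 < t)%R])
    intRN (fun x => `|f x t (u x t) (gradx (fun y => u y t) x)|%:E) < +oo)%E /\
  (M%:E = sintRN phi
    + ((\int[lebR]_(t in [set t : R | (0 < t)%R])
          intRN (fun x => (Num.max (f x t (u x t) (gradx (fun y => u y t) x)) 0)%:E))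
     - (\int[lebR]_(t in [set t : R | (0 < t)%R])
          intRN (fun x => (Num.max (- f x t (u x t) (gradx (fun y => u y t) x)) 0)%:E))))%E.
Proof.
have mA : measurable ([set s : R | 0 < s] : set TR) by rewrite itv_oy_set; exact: measurable_itv.
have iFA : (STm n).-integrable (slab [set s : R | 0 < s]) (EFin \o F).
  by apply: integrableS iF => //; exact: measurable_slab.
have fE s y : [set s : R | 0 < s] s -> f y s (u y s) (gradx (fun x => u x s) y) = F (s, y).
  exact: F_gradx.
split.
  rewrite (@intRN_slab _ (fun z => `|F z|))//.
  - exact: integrable_abs_lty iFA.
  - by apply: measurableT_comp => //; exact: measurable_funTS sF.1.
  - by move=> s y /fE ->.
rewrite (@integral_slab_sub _ F)// sintRN_EFin// -EFinD /limit_mass; congr (_ + _)%:E.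
rewrite [RHS]Rintegral_mkcond; apply: eq_Rintegral => z _; rewrite /patch.
case: ifPn => // z0; rewrite (source_eq0 theta_eq0 sF)// leNgt; apply/negP => z1.
by move: z0; rewrite notin_setE; apply.
Qed.

Lemma cvge0_small (X : R -> \bar R) : (forall t, (0 <= X t)%E) ->
  (forall e, 0 < e -> \forall t \near +oo%R, (X t <= e%:E)%E) -> X t @[t --> +oo%R] --> 0%E.
Proof.
move=> X0 Xe; apply/fine_cvgP; split.
  have := Xe 1 ltr01; apply: filterS => t h; rewrite ge0_fin_numE//.
  by apply: le_lt_trans h _; rewrite ltry.
apply/cvgrPdist_le => e e0; have := Xe e e0; apply: filterS => t h.
rewrite /= sub0r normrN ger0_norm ?fine_ge0//.
rewrite -lee_fin fineK// ge0_fin_numE//.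
by apply: le_lt_trans h _; rewrite ltry.
Qed.

Lemma continuous_Kj_space j x t : 0 < t -> {for x, continuous (fun y : 'rV[R]_n => Kj j y t)}.
Proof.
move=> t0; apply: (@continuous_comp _ _ _ (fun y : 'rV[R]_n => (y, t))
  (fun p : 'rV[R]_n * R => Kj j p.1 p.2)); last exact: continuous_Kj.
by apply: continuous_pair; [exact: cvg_id|exact: cst_continuous].
Qed.

Lemma gradx_gk x t : 0 < 1 + t -> gradx (fun y => gk y t) x = \row_i Kj (Some i) x (1 + t).
Proof.
move=> t1; apply/rowP => i; rewrite !mxE.
have d : is_derive x (delta_mx ord0 i) (fun y : 'rV[R]_n => gk y t) (Kj (Some i) x (1 + t)).
  apply: is_derive_along; have := is_derive_Kj i x 0 t1; rewrite scale0r add0r.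
  by under eq_fun do rewrite KjE.
by rewrite derive_val.
Qed.

Let D j x t := V phi F j x t - M * Kj j x (1 + t).

Let continuous_D j x t : 0 < t -> {for x, continuous (fun y => D j y t)}.
Proof.
move=> t0; apply: continuousB; first exact: continuous_V_space.
apply: continuousM; first exact: cst_continuous.
by apply: continuous_Kj_space; rewrite addr_gt0.
Qed.

Let asym := asymptotic_dominated iphi theta_ge0 theta_eq0 itheta Cth0 theta_near a0 sF.

(** The kernel has mass one, so M minus the mass of u(t) is minus the integral of the error [D],
    which the L^1 bound of the majorant makes small. *)
Lemma mass_cvg : sintRN (fun x => u x t) @[t --> +oo%R] --> M%:E.
Proof.
have ge1 : \forall t \near +oo%R, 1 <= t :> R by exact: nbhs_pinfty_ge.
have iu t : 0 < t -> (leb n).-integrable setT (EFin \o (fun x => u x t)).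
  move=> t0; have iw : (leb n).-integrable setT (EFin \o (fun x => w phi x t)).
    apply/integrableP; split; first by apply/measurable_EFinP; exact: measurable_w.
    rewrite (eq_integral (fun x => (w phi x t)%:E)); first by rewrite integral_w// ltry.
    by move=> x _; rewrite /= ger0_norm// w_ge0.
  apply: (le_integrable measurableT _ _ (integrableZl measurableT B iw)).
    by apply/measurable_EFinP; exact: measurable_V.
  by move=> x _; rewrite /= lee_fin (le_trans (u_le x t0))// ler_norm.
apply/fine_cvgP; split.
  apply: filterS ge1 => t t1; rewrite sintRN_EFin//; apply: iu; exact: lt_le_trans t1.
apply/cvgrPdist_le => e e0; have := asym e0 => h.
apply: filterS2 h ge1 => t [P [[mP P0 _ iP] DP]] t1 /=.
have t0 : 0 < t := lt_le_trans ltr01 t1.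
have t10 : 0 < 1 + t by rewrite addr_gt0.
rewrite sintRN_EFin /=; last exact: iu.
have ig := integrableZl measurableT M (integrable_Gk_shift (0 : 'rV[R]_n) t10).
have iD : (leb n).-integrable setT (EFin \o (fun x => D None x t)).
  have := integrableB measurableT (iu t t0) ig; apply: eq_integrable => // x _ /=.
  by rewrite /D KjE subr0.
have -> : M - \int[leb n]_x u x t = - \int[leb n]_x D None x t.
  rewrite /D RintegralB//; last 2 first.
  - exact: iu.
  - by move: ig; apply: eq_integrable => // x _ /=; rewrite KjE subr0.
  rewrite RintegralZl//; last first.
    have := integrable_Gk_shift (0 : 'rV[R]_n) t10.
    by apply: eq_integrable => // x _ /=; rewrite KjE subr0.
  rewrite [X in M * X](_ : _ = 1) ?mulr1 ?opprB//.
  rewrite /Rintegral; under eq_integral do rewrite KjE.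
  by rewrite integral_Gk0.
rewrite normrN -lee_fin; apply: norm_Rintegral_le => //; last by rewrite ltry.
  by apply/measurable_EFinP; exact: measurable_int iD.
apply: le_trans _ iP; apply: ge0_le_integral => //.
- by apply/measurable_EFinP; apply: measurableT_comp => //; apply/measurable_EFinP; exact: measurable_int iD.
- exact/measurable_EFinP.
- by move=> x _; rewrite lee_fin; have := DP None x; rewrite /= mul1r.
Qed.

Lemma asymptotic_Lq q : (1 <= q)%E ->
  ((t `^ (n%:R / 2 * (1 - qinv q)))%:E * Lqnorm q (fun x => (u x t - M * gk x t)%R))%E
    @[t --> +oo%R] --> 0%E.
Proof.
move=> q1; apply: cvge0_small => [t|e e0].
  by rewrite mule_ge0 ?Lqnorm_ge0// lee_fin powR_ge0.
have ge1 : \forall t \near +oo%R, 1 <= t :> R by exact: nbhs_pinfty_ge.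
apply: filterS2 (asym e0) ge1 => t [P [dP DP]] t1.
have t0 : 0 < t := lt_le_trans ltr01 t1.
rewrite (_ : (fun x => u x t - M * gk x t) = (fun x => D None x t)); last first.
  by apply/funext => x; rewrite /D KjE.
apply: (Lqnorm_dominated q1 t0 e0 _ _ dP).
  apply: continuous_on_measurable_rV; first exact: openT.
  by move=> x _; exact: continuous_D.
by move=> x; have := DP None x; rewrite /= mul1r.
Qed.

Lemma asymptotic_grad_Lq q : (1 <= q)%E ->
  ((t `^ (n%:R / 2 * (1 - qinv q) + 2^-1))%:E *
    Lqnorm q (fun x => enorm (gradx (fun y => u y t) x - M *: gradx (fun y => gk y t) x)%R))%E
    @[t --> +oo%R] --> 0%E.
Proof.
move=> q1; apply: cvge0_small => [t|e e0].
  by rewrite mule_ge0 ?Lqnorm_ge0// lee_fin powR_ge0.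
have n10 : 0 < n%:R + 1 :> R by rewrite ltr_wpDl.
(* Passing from coordinates to the Euclidean norm costs a factor n; dividing by n + 1 avoids a zero
   denominator. *)
have e1 : 0 < e / (n%:R + 1) by rewrite divr_gt0.
have ge1 : \forall t \near +oo%R, 1 <= t :> R by exact: nbhs_pinfty_ge.
apply: filterS2 (asym e1) ge1 => t [P [dP DP]] t1.
have t0 : 0 < t := lt_le_trans ltr01 t1.
have st : 0 < Num.sqrt t by rewrite sqrtr_gt0.
have nt0 : 0 <= n%:R / Num.sqrt t by rewrite divr_ge0// ltW.
rewrite (_ : (fun x => enorm _) = (fun x => enorm (\row_i D (Some i) x t))); last first.
  apply/funext => x; rewrite gradx_V// gradx_gk ?addr_gt0//; congr enorm.
  by apply/rowP => i; rewrite !mxE.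
rewrite powRD; last by apply/implyP => _; rewrite gt_eqF.
rewrite powR12_sqrt ?(ltW t0)// EFinM -muleA muleCA.
have es : 0 < e / Num.sqrt t by rewrite divr_gt0.
have dP' : dominated t (e / Num.sqrt t) (fun x => n%:R / Num.sqrt t * P x).
  apply: dominated_le (dominatedZ nt0 dP).
  have -> : n%:R / Num.sqrt t * (e / (n%:R + 1)) = e / Num.sqrt t * (n%:R / (n%:R + 1)) by ring.
  by rewrite ler_piMr ?(ltW es)// ler_pdivrMr// mul1r lerDl.
have h := Lqnorm_dominated q1 t0 es _ _ dP'.
apply: le_trans (lee_wpmul2l _ (h _ _ _)) _.
- by rewrite lee_fin.
- by apply: measurable_enorm_row => i x; exact: continuous_D.
- move=> x; rewrite ger0_norm ?enorm_ge0//; apply: enorm_row_le => //; first by have [_ P0 _ _] := dP.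
  by move=> i; rewrite mxE; exact: (DP (Some i)).
- by rewrite -EFinM lee_fin mulrCA divff ?mulr1// gt_eqF.
Qed.

End solution.

Theorem theorem3p1 (R : realType) (N : nat) (K : R)
    (phi : 'rV[R]_N -> R) (f : 'rV[R]_N -> R -> R -> 'rV[R]_N -> R)
    (C A : R) :
  (1 <= N)%N -> 0 <= K ->
  (* phi in L^1_K (a Borel representative of the L^1 class) *)
  borel_fun phi -> (wnorm K phi < +oo)%E ->
  (* f continuous on R^N x (0,oo) x R x R^N *)
  {within [set z : ('rV[R]_N * R) * (R * 'rV[R]_N) | 0 < z.1.2],
     continuous (fun z => f z.1.1 z.1.2 z.2.1 z.2.2)} ->
  0 < C -> 1 < A ->
  (forall x t p q, 0 < t ->
     `|f x t p q| <= C * (1 + t) `^ (- A) * (`|p| + (1 + t) `^ (2^-1) * enorm q)) ->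
  exists u : 'rV[R]_N -> R -> R,
    (* u is a solution of the Cauchy problem *)
    mild_solution f phi u /\
    (* (i) u and grad u exist and are continuous on R^N x (0,oo) *)
    (forall x t, 0 < t -> has_partials (fun y => u y t) x) /\
    {within [set z : 'rV[R]_N * R | 0 < z.2], continuous (fun z => u z.1 z.2)} /\
    {within [set z : 'rV[R]_N * R | 0 < z.2],
       continuous (fun z => gradx (fun y => u y z.2) z.1)} /\
    (* (ii) *)
    (forall q : \bar R, (1 <= q)%E -> exists B : R, forall t : R, 0 < t ->
       ((t `^ ((N%:R / 2 * (1 - qinv q)) : R))%:E *
          (Lqnorm q (fun x => u x t)
           + (t `^ (2^-1))%:E * Lqnorm q (fun x => enorm (gradx (fun y => u y t) x)))
        <= B%:E)%E) /\
    (forall l : R, 0 <= l <= K -> exists B : R, forall t : R, 0 < t ->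
       (((1 + t) `^ (- (l / 2)))%:E *
          (wnorm l (fun x => u x t)
           + (t `^ (2^-1))%:E * wnorm l (fun x => enorm (gradx (fun y => u y t) x)))
        <= B%:E)%E) /\
    (* (iii) *)
    (exists M : R,
       sintRN (fun x => u x t) @[t --> +oo%R] --> M%:E /\
       (\int[@lebesgue_measure R]_(t in [set t : R | (0 < t)%R])
          intRN (fun x => `|f x t (u x t) (gradx (fun y => u y t) x)|%:E) < +oo)%E /\
       (M%:E = sintRN phi
         + ((\int[@lebesgue_measure R]_(t in [set t : R | (0 < t)%R])
               intRN (fun x =>
                 (Num.max (f x t (u x t) (gradx (fun y => u y t) x)) 0)%:E))
          - (\int[@lebesgue_measure R]_(t in [set t : R | (0 < t)%R])
               intRN (fun x =>
                 (Num.max (- f x t (u x t) (gradx (fun y => u y t) x)) 0)%:E))))%E /\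
       (forall q : \bar R, (1 <= q)%E ->
          ((t `^ ((N%:R / 2 * (1 - qinv q)) : R))%:E
             * Lqnorm q (fun x => (u x t - M * gk x t)%R))%E @[t --> +oo%R] --> 0%E /\
          ((t `^ ((N%:R / 2 * (1 - qinv q) + 2^-1) : R))%:E
             * Lqnorm q (fun x =>
                 enorm (gradx (fun y => u y t) x - M *: gradx (fun y => gk y t) x)%R))%E
            @[t --> +oo%R] --> 0%E)).
Proof.
move=> _ K0 bphi wK cf C0 A1 fb.
have mphi : measurable_fun setT phi.
  by move=> _ Y mY; rewrite setTI; exact: bphi.
(* Since K >= 0 the weight is at least 1, so the weighted norm controls the L^1 norm. *)
have iphi : (leb N).-integrable setT (EFin \o phi).
  apply/integrableP; split; first exact/measurable_EFinP.
  apply: le_lt_trans wK; rewrite /wnorm intRNE; last 2 first.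
  - apply/measurable_EFinP; apply: measurable_funM; first exact: measurable_weight_enorm.
    exact: measurableT_comp.
  - by move=> x; rewrite lee_fin mulr_ge0 ?powR_ge0.
  apply: ge0_le_integral => //.
  - by apply/measurable_EFinP; exact: measurableT_comp.
  - apply/measurable_EFinP; apply: measurable_funM; first exact: measurable_weight_enorm.
    exact: measurableT_comp.
  - move=> x _; rewrite lee_fin ler_peMl//.
    have e1 : 1 <= 1 + enorm x by rewrite lerDl enorm_ge0.
    by have := ler_powR e1 K0; rewrite powRr0.
have a0 : 0 < A - 1 by rewrite subr_gt0.
have cn0 := @cn_gt0 R N.
have C1_0 : 0 < Cf (n := N) C A * @cn R N by exact: C1_gt0.
(* [L] and [m] depend on the dimension, [C] and [A] alone: the datum enters the estimates only
   through its majorant. *)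
have [L [m [L0 m0 super]]] := supersolution a0 cn0 C1_0.
have [F [sF FE]] := exists_fixed_point iphi cf C0 A1 fb L0 m0 super.
pose th := theta (A - 1) (Cf (n := N) C A * @cn R N) L m.
have th_ge0 s : 0 <= th s by exact: theta_ge0.
have th_eq0 s : s <= 0 -> th s = 0 by exact: theta_eq0.
have ith := integrable_weight a0 C1_0 L0 m0.
have Cth0 : 0 <= Cth (A - 1) (Cf (n := N) C A * @cn R N) L m by exact: Cth_ge0.
have th_near := weight_near a0 C1_0 L0 m0.
(* An upper bound of [Lamsc] over all times, finite because the antiderivative of the weight is at
   most 1 / (A - 1). *)
pose B := L * expR (m / (A - 1)).
have B0 : 0 <= B by rewrite mulr_ge0 ?expR_ge0// ltW.
have V_le j x t : 0 < t -> sg j t * `|V phi F j x t| <= B * w phi x t.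
  move=> t0; have [_] := admissible_V iphi C0 A1 L0 m0 super sF j x t0.
  move=> /le_trans; apply; apply: ler_wpM2r; first exact: w_ge0.
  exact: Lamsc_le (ltW m0).
have FE' z : 0 < z.1 -> F z = f z.2 z.1 (V phi F None z.2 z.1) (\row_i V phi F (Some i) z.2 z.1).
  by move=> z0; rewrite {1}FE /NL mulr0 z0 subr0.
exists (fun x t => V phi F None x t).
split; first exact: (mild_solution_u iphi th_ge0 th_eq0 ith Cth0 th_near a0 sF B0 V_le FE').
split; first by move=> x t; exact: (has_partials_V iphi th_ge0 th_eq0 ith Cth0 th_near a0 sF).
split; first exact: (within_continuous_u iphi th_ge0 th_eq0 ith Cth0 th_near a0 sF).
split; first exact: (within_continuous_grad iphi th_ge0 th_eq0 ith Cth0 th_near a0 sF).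
split; first by move=> q; exact: (decay_Lq iphi th_ge0 th_eq0 ith Cth0 th_near a0 sF B0 V_le).
split; first by move=> l; exact: (moments_bounded iphi th_ge0 th_eq0 ith Cth0 th_near a0 sF B0 V_le wK).
exists (limit_mass phi F).
split; first exact: (mass_cvg iphi th_ge0 th_eq0 ith Cth0 th_near a0 sF V_le).
have [h1 h2] := source_mass iphi th_ge0 th_eq0 ith Cth0 th_near a0 sF FE'.
split; first exact: h1.
split; first exact: h2.
move=> q q1; split; first exact: (asymptotic_Lq iphi th_ge0 th_eq0 ith Cth0 th_near a0 sF q1).
exact: (asymptotic_grad_Lq iphi th_ge0 th_eq0 ith Cth0 th_near a0 sF q1).
Qed.
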